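(* In the setting of the context (Neimark--Sacker bifurcation of a $2\pi$-periodically forced system), assume there is no strong resonance, i.e. $\omega^\star\notin\{\frac13,\frac14\}$. Then the system $$\boldsymbol G(\boldsymbol z(\theta,\phi),\lambda,\theta;\varepsilon)-\frac{\partial\boldsymbol z}{\partial\theta}(\theta,\phi)-\omega\frac{\partial\boldsymbol z}{\partial\phi}(\theta,\phi)=\boldsymbol 0,\qquad\boldsymbol\gamma(\boldsymbol z)-\widehat{\boldsymbol e}_1=\boldsymbol 0$$ can be expanded in powers of $\varepsilon$ and an asymptotic solution $\lambda^E(\varepsilon)$, $\omega^E(\varepsilon)$, $\boldsymbol z^E(\theta,\phi;\varepsilon)$ constructed up to and including the $\varepsilon^2$ term (i.e. satisfying the system up to a remainder $O(\varepsilon^3)$), of the form $$\lambda^E(\varepsilon)=\lambda^\star+\varepsilon^2\lambda_2^E,\quad\omega^E(\varepsilon)=\omega^\star+\varepsilon^2\omega_2^E,\quad\boldsymbol z^E(\theta,\phi;\varepsilon)=\boldsymbol a^\star(\phi)+\varepsilon\boldsymbol z_2^E(\theta,\phi)+\varepsilon^2\boldsymbol z_3^E(\theta,\phi),$$ where $\boldsymbol z_2^E$ only depends on the Fourier $\phi$-modes $0$ and $2$ and $\boldsymbol z_3^E$ only depends on the Fourier $\phi$-modes $1$ and $3$. The amplitude and phase conditions force $$\langle\langle\boldsymbol z_3^E(\theta,\phi),\boldsymbol a^\star(\phi)\rangle\rangle=0=\langle\langle\boldsymbol z_3^E(\theta,\phi),\dot{\boldsymbol a}^\star(\phi)\rangle\rangle.$$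 In terms of Fourier $\phi$-modes, $$\boldsymbol z^E(\theta,\phi;\varepsilon)=\boldsymbol a^\star(\phi)+\boldsymbol a_0^E(\theta;\varepsilon)+\sum_{m=1}^3\left\{\boldsymbol a_m^E(\theta;\varepsilon)\cos m\phi+\boldsymbol b_m^E(\theta;\varepsilon)\sin m\phi\right\},$$ where $\boldsymbol a_0^E,\boldsymbol a_2^E,\boldsymbol b_2^E$ are $\varepsilon$-terms (i.e. $\varepsilon$ times a function of $\theta$) and $\boldsymbol a_1^E,\boldsymbol b_1^E,\boldsymbol a_3^E,\boldsymbol b_3^E$ are $\varepsilon^2$-terms. Again, the amplitude and phase conditions force $$\langle\boldsymbol a_1^E(\theta;\varepsilon),\boldsymbol e_1\rangle+\langle\boldsymbol b_1^E(\theta;\varepsilon),\boldsymbol e_2\rangle=0=\langle\boldsymbol a_1^E(\theta;\varepsilon),\boldsymbol e_2\rangle-\langle\boldsymbol b_1^E(\theta;\varepsilon),\boldsymbol e_1\rangle.$$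
   Context: Setting (periodically forced Neimark--Sacker bifurcation). $\mathbb S^1=\mathbb R/2\pi\mathbb Z$; $\boldsymbol F:\mathbb R^n\times\mathbb S^1\times\mathbb R\to\mathbb R^n$ is smooth; the system is $\frac{d\boldsymbol v}{d\theta}(\theta)=\boldsymbol F(\boldsymbol v,\theta,\lambda)$; $\mathsf J(\boldsymbol v,\theta,\lambda)$ is the Jacobian matrix of $\boldsymbol F$ with respect to $\boldsymbol v$. Assume: (1) $\boldsymbol v^\star:\mathbb S^1\to\mathbb R^n$ satisfies $\boldsymbol F(\boldsymbol v^\star(\theta),\theta,\lambda^\star)-\frac{d}{d\theta}\boldsymbol v^\star(\theta)=\boldsymbol 0$ for all $\theta$. (2) There are $\mathsf E^\star\in\mathbb R^{n\times n}$ and $\mathsf P^\star:\mathbb S^1\to\mathbb R^{n\times n}$ with $\mathsf P^\star(\theta)$ non-singular for all $\theta$ (so all Floquet vectors are taken $2\pi$-periodic) such that $\mathsf J(\boldsymbol v^\star(\theta),\theta,\lambda^\star)\mathsf P^\star(\theta)-\dot{\mathsf P}^\star(\theta)=\mathsf P^\star(\theta)\mathsf E^\star$, $\mathsf E^\star=\mathrm{diag}(\widehat{\mathsf E}^\star,\widetilde{\mathsf E}^\star)$, $\widehat{\mathsf E}^\star=\begin{pmatrix}0&-\omega^\star\\ \omega^\star&0\end{pmatrix}$, $\omega^\star>0$, and $\widetilde{\mathsf E}^\star\in\mathbb R^{(n-2)\times(n-2)}$ with no eigenvalues on the imaginary axis. The imaginary parts of the eigenvalues of $\mathsf E^\star$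 (Floquet exponents) are taken in $(-\frac12,\frac12)$, so that $0<\omega^\star<\frac12$. Consequently, for $\lambda$ near $\lambda^\star$ there are smooth continuations $\boldsymbol v^\star(\theta;\lambda)$, $\mathsf P(\theta;\lambda)$ (non-singular, $2\pi$-periodic in $\theta$), $\mathsf E(\lambda)$ of $\boldsymbol v^\star,\mathsf P^\star,\mathsf E^\star$ with $\boldsymbol F(\boldsymbol v^\star(\theta;\lambda),\theta,\lambda)=\frac{d}{d\theta}\boldsymbol v^\star(\theta;\lambda)$, $\mathsf J(\boldsymbol v^\star(\theta;\lambda),\theta,\lambda)\mathsf P(\theta;\lambda)-\dot{\mathsf P}(\theta;\lambda)=\mathsf P(\theta;\lambda)\mathsf E(\lambda)$ (here $\dot{\mathsf P}=\partial\mathsf P/\partial\theta$), $\mathsf E(\lambda)=\mathrm{diag}(\widehat{\mathsf E}(\lambda),\widetilde{\mathsf E}(\lambda))$, $\widehat{\mathsf E}(\lambda)=\begin{pmatrix}\alpha_R(\lambda)&-\alpha_I(\lambda)\\ \alpha_I(\lambda)&\alpha_R(\lambda)\end{pmatrix}$. (3) Transversality: $\dot\alpha_R(\lambda^\star)\neq0$ (dot on $\alpha_R$ denotes $d/d\lambda$). Notation. $\boldsymbol a^\star(\phi)=(\cos\phi,\sin\phi,0,\dots,0)^T$, $\dot{\boldsymbol a}^\star(\phi)=(-\sin\phi,\cos\phi,0,\dots,0)^T\in\mathbb R^n$; $\boldsymbol e_1,\boldsymbol e_2$ are the first two unit vectors of $\mathbb R^n$; $\widehat{\boldsymbol e}_1=(1,0)^T$.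 $\langle\boldsymbol w_1,\boldsymbol w_2\rangle=\frac1{2\pi}\int_0^{2\pi}\boldsymbol w_1(\theta)\cdot\boldsymbol w_2(\theta)\,d\theta$; $\langle\langle\boldsymbol w_1,\boldsymbol w_2\rangle\rangle=\frac1{(2\pi)^2}\int_0^{2\pi}\int_0^{2\pi}\boldsymbol w_1(\theta,\phi)\cdot\boldsymbol w_2(\theta,\phi)\,d\theta\,d\phi$. For $\boldsymbol z:\mathbb S^1\times\mathbb S^1\to\mathbb R^n$, $\boldsymbol\gamma(\boldsymbol z)=(\langle\langle\boldsymbol z(\theta,\phi),\boldsymbol a^\star(\phi)\rangle\rangle,\langle\langle\boldsymbol z(\theta,\phi),\dot{\boldsymbol a}^\star(\phi)\rangle\rangle)^T$ (the equations $\boldsymbol\gamma(\boldsymbol z)=\widehat{\boldsymbol e}_1$ are the amplitude and phase conditions), and $$\boldsymbol G(\boldsymbol z,\lambda,\theta;\varepsilon)=\tfrac1\varepsilon\mathsf P(\theta;\lambda)^{-1}\Big\{\boldsymbol F\big(\boldsymbol v^\star(\theta;\lambda)+\varepsilon\mathsf P(\theta;\lambda)\boldsymbol z,\theta,\lambda\big)-\boldsymbol F\big(\boldsymbol v^\star(\theta;\lambda),\theta,\lambda\big)-\varepsilon\dot{\mathsf P}(\theta;\lambda)\boldsymbol z\Big\},$$ with expansion $\boldsymbol G=\mathsf E(\lambda)\boldsymbol z+\sum_{p\ge2}\varepsilon^{p-1}\boldsymbol G_p(\boldsymbol z;\lambda,\theta)$, $\boldsymbol G_p$ homogeneous of degree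 $p$ in $\boldsymbol z$. Fourier $\phi$-modes of $\boldsymbol z$ are the modes $\cos m\phi,\sin m\phi$ with $\theta$-dependent coefficients. *)

(* Defs.v *)
From mathcomp Require Import all_boot all_order all_algebra.
From mathcomp Require Import complex.
From mathcomp Require Import all_classical all_reals all_analysis.
Export numFieldNormedType.Exports.
Export Order.TTheory GRing.Theory Num.Theory.

Set Implicit Arguments.
Unset Strict Implicit.
Unset Printing Implicit Defensive.

Local Open Scope classical_set_scope.
Local Open Scope ring_scope.

(* C^k and C^oo on an open set U. Differentiability together with all
   directional derivatives being C^k is C^(k+1), the spaces used below being
   finite-dimensional. *)
Fixpoint Ck_on (R : realType) (V W : normedModType R) (k : nat) (U : set V)
    (f : V -> W) : Prop :=
  match k with
  | 0 => forall x, U x -> {for x, continuous f}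
  | k'.+1 => (forall x, U x -> differentiable f x) /\
             (forall u : V, Ck_on k' U ('D_u f))
  end.

Definition smooth_on (R : realType) (V W : normedModType R) (U : set V)
    (f : V -> W) : Prop := forall k, Ck_on k U f.

(* Functions on S^1 = R / 2 pi Z are 2pi-periodic functions on R. *)
Definition periodic2pi (R : realType) (T : Type) (f : R -> T) : Prop :=
  forall t, f (t + 2 * pi) = f t.

Definition smooth_torus (R : realType) (W : normedModType R)
    (z : R -> R -> W) : Prop :=
  [/\ smooth_on setT (fun p : R * R => z p.1 p.2),
      forall phi, periodic2pi (z ^~ phi)
    & forall theta, periodic2pi (z theta)].

Definition dotv (R : realType) (n : nat) (u w : 'cV[R]_n) : R :=
  \sum_(i < n) u i 0 * w i 0.

(* < w1, w2 > *)
Definition bracket (R : realType) (n : nat) (w1 w2 : R -> 'cV[R]_n) : R :=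
  (2 * pi)^-1 *
  \int[lebesgue_measure]_(theta in `[0, 2 * pi]) dotv (w1 theta) (w2 theta).

(* << w1, w2 >> *)
Definition dbracket (R : realType) (n : nat) (w1 w2 : R -> R -> 'cV[R]_n) : R :=
  ((2 * pi) ^+ 2)^-1 *
  \int[lebesgue_measure]_(phi in `[0, 2 * pi])
    (\int[lebesgue_measure]_(theta in `[0, 2 * pi])
      dotv (w1 theta phi) (w2 theta phi)).

Definition e1 {R : realType} {m : nat} : 'cV[R]_(2 + m) :=
  delta_mx (lshift m (0 : 'I_2)) 0.
Definition e2 {R : realType} {m : nat} : 'cV[R]_(2 + m) :=
  delta_mx (lshift m (1 : 'I_2)) 0.

Definition astar {R : realType} {m : nat} (phi : R) : 'cV[R]_(2 + m) :=
  cos phi *: e1 + sin phi *: e2.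
Definition dastar {R : realType} {m : nat} (phi : R) : 'cV[R]_(2 + m) :=
  - sin phi *: e1 + cos phi *: e2.

(* [[a, -b], [b, a]] *)
Definition rot_block (R : realType) (a b : R) : 'M[R]_2 :=
  block_mx (a%:M : 'M[R]_1) (- b)%:M b%:M (a%:M : 'M[R]_1).

Definition Emat (R : realType) (m : nat) (a b : R) (Et : 'M[R]_m) :
    'M[R]_(2 + m) :=
  block_mx (rot_block a b) 0 0 Et.

(* mu is a complex eigenvalue of the real matrix A *)
Definition ceigenvalue (R : realType) (n : nat) (A : 'M[R]_n) (mu : R[i]) : bool :=
  eigenvalue (map_mx (real_complex R) A) mu.

Section System.
Context {R : realType} {m : nat}.
Local Notation vec := 'cV[R]_(2 + m).
Local Notation mat := 'M[R]_(2 + m).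
Implicit Types (F : vec -> R -> R -> vec) (v : R -> R -> vec) (P : R -> R -> mat).

Definition Jac F (x : vec) (theta lambda : R) : mat :=
  \matrix_(i, j) ('D_(delta_mx j 0) (fun y : vec => F y theta lambda) x) i 0.

Definition Gfun F v P (z : vec) (lambda theta eps : R) : vec :=
  eps^-1 *: (invmx (P theta lambda) *m
    (F (v theta lambda + eps *: (P theta lambda *m z)) theta lambda
     - F (v theta lambda) theta lambda
     - eps *: (derive1 (P ^~ lambda) theta *m z))).

Definition gamma (z : R -> R -> vec) : 'cV[R]_2 :=
  \col_(i < 2) dbracket z
    (fun _ phi => if i == 0 then astar phi else dastar phi).

Definition pde_residual F v P (z : R -> R -> vec) (lambda omega eps : R)
    (p : R * R) : vec :=
  Gfun F v P (z p.1 p.2) lambda p.1 eps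
  - derive1 (z ^~ p.2) p.1 - omega *: derive1 (z p.1) p.2.

Definition constraint_residual (z : R -> R -> vec) : 'cV[R]_2 :=
  gamma z - delta_mx 0 0.

(* r(eps, t) = O(eps^N) as eps -> 0, uniformly in t; eps = 0 is excluded
   since G is only defined for eps <> 0. *)
Definition bigO_eps {W : normedModType R} {T : Type} (N : nat)
    (r : R -> T -> W) : Prop :=
  exists C eps0 : R, 0 < eps0 /\
    forall eps t, 0 < `|eps| < eps0 -> `|r eps t| <= C * `|eps| ^+ N.

Definition expands_in_powers {W : normedModType R} {T : Type}
    (r : R -> T -> W) : Prop :=
  exists c : nat -> T -> W, forall N : nat,
    bigO_eps N.+1 (fun eps t => r eps t - \sum_(k < N.+1) eps ^+ k *: c k t).

(* From here on lamE, omE, zE are families depending on eps, with zE taking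
   its arguments in the order theta, phi, eps. *)
Definition system_expands F v P (lamE omE : R -> R) (zE : R -> R -> R -> vec) :
    Prop :=
  expands_in_powers (fun eps (p : R * R) =>
    pde_residual F v P (fun theta phi => zE theta phi eps)
      (lamE eps) (omE eps) eps p) /\
  expands_in_powers (fun eps (_ : unit) =>
    constraint_residual (fun theta phi => zE theta phi eps)).

Definition asymptotic_solution F v P (N : nat) (lamE omE : R -> R)
    (zE : R -> R -> R -> vec) : Prop :=
  bigO_eps N.+1 (fun eps (p : R * R) =>
    pde_residual F v P (fun theta phi => zE theta phi eps)
      (lamE eps) (omE eps) eps p) /\
  bigO_eps N.+1 (fun eps (_ : unit) =>
    constraint_residual (fun theta phi => zE theta phi eps)).

Definition quadratic_in_eps (c c2 : R) (eps : R) : R := c + eps ^+ 2 * c2.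

Definition z_ansatz (z2 z3 : R -> R -> vec) (theta phi eps : R) : vec :=
  astar phi + eps *: z2 theta phi + eps ^+ 2 *: z3 theta phi.

(* The coefficients a k, b k are determined by z, so they inherit periodicity
   and smoothness in theta from z; the same holds for the coefficients in
   fourier_form. *)
Definition only_phi_modes (ks : seq nat) (z : R -> R -> vec) : Prop :=
  exists a b : nat -> R -> vec, forall theta phi,
    z theta phi = \sum_(k <- ks)
      (cos (k%:R * phi) *: a k theta + sin (k%:R * phi) *: b k theta).

Definition eps_term (k : nat) (f : R -> R -> vec) : Prop :=
  exists g : R -> vec, forall theta eps, f theta eps = eps ^+ k *: g theta.

Definition fourier_form (zE : R -> R -> R -> vec) (a b : nat -> R -> R -> vec) :
    Prop :=
  forall theta phi eps,
    zE theta phi eps = astar phi + a 0%N theta eps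
      + \sum_(1 <= k < 4) (cos (k%:R * phi) *: a k theta eps
                         + sin (k%:R * phi) *: b k theta eps).

End System.

(* Main.v *)
Require Import Defs.
From HB Require Import structures.
From mathcomp Require Import all_boot all_order all_algebra.
From mathcomp Require Import complex.
From mathcomp Require Import all_classical all_reals all_analysis.
From mathcomp Require Import ring lra.

Set Implicit Arguments.
Unset Strict Implicit.
Unset Printing Implicit Defensive.

Import Order.TTheory GRing.Theory Num.Theory numFieldNormedType.Exports.

Local Open Scope classical_set_scope.
Local Open Scope ring_scope.

(* In Floquet coordinates y = P^-1 (x - v) the field g(y, theta, lambda) vanishes
   at y = 0 and has linear part E(lambda), and G = eps^-1 g(eps z). Hence the
   residual of the ansatz has a uniform expansion in eps, whose coefficients of
   1, eps, eps^2 are, with L z = E z - d_theta z - omega d_phi z,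
     L a,    L z2 + Q,    L z3 + C + lambda_2 E'(lambda) a - omega_2 da/dphi,
   all taken at lambda = lams, omega = oms, where Q (modes 0, 2) and C (modes
   1, 3) are the quadratic and cubic terms of g. On the k-th phi-mode L is a
   linear ODE in theta. Its hyperbolic block is always solvable by periodic
   functions, and its rotation block is when +-omega - k omega is not an
   integer; for k = 0, 2, 3 and 0 < omega < 1/2 this is exactly what excludes
   1/3 and 1/4. In mode 1 one resonant complex condition remains, which
   transversality lets us meet by the choice of lambda_2 and omega_2. *)

(** Error bounds must be uniform over the torus, while coefficients are easy to compute only at a
    fixed point. The two tasks are separated: compactness of the torus gives a uniform expansion
    with unknown coefficients, one-variable Taylor expansions at each fixed [(theta, phi)] give
    their values, and uniqueness of asymptotic coefficients joins the two. Parity explains the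
    modes: each factor [astar] moves a phi-mode one step up or down, so two factors give modes 0 and
    2, three factors modes 1 and 3. Only scalar complex equations y' = mu y + f are integrated; the
    rotation block is diagonalised, and the hyperbolic block, possibly not diagonalisable, is
    reduced to them eigenvalue by eigenvalue. In the resonant component of mode 1 the equation is a
    plain integration, and its free constant is spent on the amplitude and phase conditions. The
    last claim concerns every asymptotic solution of the given form, whose Fourier coefficients come
    without regularity; they are recovered from values of [z3] at four phases before any integral is
    split. *)

Section CkCalculus.
Context {R : realType}.
Implicit Types V W X : normedModType R.

(** A first-order expansion of [f] at [x] is also one of [g], since the two agree near [x];
    uniqueness of the differential then identifies ['d g x] with ['d f x]. *)
Lemma near_eq_differentiable V W (f g : V -> W) (x : V) :
  {near x, f =1 g} -> differentiable f x -> differentiable g x.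
Proof.
move=> fg df.
have cdf : continuous ('d f x) by exact: diff_continuous.
have key : g \o shift x = cst (g x) + 'd f x +o_ 0 id.
  apply/eqaddoP => e e0.
  have /eqaddoP/(_ e e0) := diff_locally df.
  have fg0 : \forall h \near 0, f (h + x) = g (h + x).
    by move: fg; rewrite [X in X -> _](near_shift 0) subr0; apply.
  rewrite -(nbhs_singleton fg).
  by apply: filterS2 fg0 => h /= fgh; rewrite /= !fctE/= -fgh.
apply/diff_locallyP; split; first by rewrite (diff_unique cdf key).
by rewrite (diff_unique cdf key).
Qed.

(** Since [U] is open, a derivative at one of its points sees only values taken in [U]. The rules
    below know their derivative formulas on [U] only and transport smoothness across them by this
    lemma. *)
Lemma Ck_on_ext V W k (U : set V) (f g : V -> W) :
  open U -> (forall x, U x -> f x = g x) -> Ck_on k U f -> Ck_on k U g.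
Proof.
move=> oU; elim: k f g => [|k IH] f g fg /=.
  move=> cf x Ux; rewrite /prop_for /continuous_at -(fg _ Ux).
  apply: cvg_trans (cf x Ux); apply: near_eq_cvg.
  by near=> y; apply/fg; near: y; exact: open_nbhs_nbhs.
have nfg x : U x -> {near x, f =1 g}.
  by move=> Ux; near=> y; apply: fg; near: y; exact: open_nbhs_nbhs.
move=> [df Cf]; split=> [x Ux|u].
  by apply: near_eq_differentiable (df x Ux); exact: nfg.
by apply: IH (Cf u) => x Ux; apply: near_eq_derive; exact: nfg.
Unshelve. all: by end_near. Qed.

Lemma Ck_onW V W k (U : set V) (f : V -> W) : Ck_on k.+1 U f -> Ck_on k U f.
Proof.
elim: k f => [|k IH] f /=; first by move=> [df _] x /df/differentiable_continuous.
by move=> [df Cf]; split=> // u; apply: IH; exact: Cf.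
Qed.

Lemma Ck_on_cst V W k (U : set V) (a : W) : Ck_on k U (cst a).
Proof.
elim: k a => [|k IH] a /=; first by move=> x _; exact: cvg_cst.
split=> [x _|u]; first exact: differentiable_cst.
rewrite (_ : 'D_u _ = cst 0); first exact: IH.
by apply/funext => x; rewrite derive_val.
Qed.

Lemma Ck_onD V W k (U : set V) (f g : V -> W) : open U ->
  Ck_on k U f -> Ck_on k U g -> Ck_on k U (fun x => f x + g x).
Proof.
move=> oU; elim: k f g => [|k IH] f g /=.
  by move=> cf cg x Ux; apply: cvgD; [exact: cf|exact: cg].
move=> [df Cf] [dg Cg]; split=> [x Ux|u].
  by apply: differentiableD; [exact: df|exact: dg].
apply: (@Ck_on_ext _ _ _ _ (fun x => 'D_u f x + 'D_u g x)) => //; last exact: IH.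
by move=> x Ux; rewrite deriveD//; apply: diff_derivable; [exact: df|exact: dg].
Qed.

Lemma Ck_on_sum V W k (U : set V) (I : Type) (r : seq I) (f : I -> V -> W) :
  open U -> (forall i, Ck_on k U (f i)) ->
  Ck_on k U (fun x => \sum_(i <- r) f i x).
Proof.
move=> oU Cf; elim: r => [|i r IH].
  rewrite (_ : (fun _ => _) = cst 0); first exact: Ck_on_cst.
  by apply/funext => x; rewrite big_nil.
rewrite (_ : (fun _ => _) = (fun x => f i x + \sum_(j <- r) f j x)).
  exact: Ck_onD.
by apply/funext => x; rewrite big_cons.
Qed.

Lemma Ck_on_lin V W X k (U : set V) (f : V -> W) (L : {linear W -> X}) :
  open U -> continuous L -> Ck_on k U f -> Ck_on k U (fun x => L (f x)).
Proof.
move=> oU cL; elim: k f => [|k IH] f /=.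
  by move=> cf x Ux; apply: continuous_comp; [exact: cf|exact: cL].
have dL y : differentiable L y by exact: linear_differentiable.
move=> [df Cf]; split=> [x Ux|u].
  by apply: differentiable_comp => //; exact: df.
apply: (@Ck_on_ext _ _ _ _ (fun x => L ('D_u f x))) => //; last exact: IH.
move=> x Ux; have dfx := df x Ux.
rewrite -[fun y => L (f y)]/(L \o f) !deriveE//; last exact: differentiable_comp.
by rewrite [RHS](congr1 (fun h => h u) (diff_comp dfx (dL (f x))))/= (diff_lin _ cL).
Qed.

Lemma Ck_on_linT V W k (U : set V) (L : {linear V -> W}) :
  continuous L -> Ck_on k U L.
Proof.
move=> cL; case: k => [|k] /=; first by move=> x _; exact: cL.
split=> [x _|u]; first exact: linear_differentiable.
rewrite (_ : 'D_u L = cst (L u)); first exact: Ck_on_cst.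
apply/funext => x; rewrite deriveE//; last exact: linear_differentiable.
by rewrite diff_lin.
Qed.

Lemma Ck_onM V k (U : set V) (f g : V -> R) : open U ->
  Ck_on k U f -> Ck_on k U g -> Ck_on k U (fun x => f x * g x).
Proof.
move=> oU; elim: k f g => [|k IH] f g.
  by move=> cf cg x Ux; exact: (cvgM (cf x Ux) (cg x Ux)).
move=> Cf Cg; have [df Cdf] := Cf; have [dg Cdg] := Cg.
split=> [x Ux|u]; first by apply: differentiableM; [exact: df|exact: dg].
apply: (@Ck_on_ext _ _ _ _ (fun x => f x * 'D_u g x + g x * 'D_u f x)) => //.
  move=> x Ux; have dfx := @diff_derivable _ _ _ _ _ u (df x Ux).
  by rewrite (deriveM dfx (@diff_derivable _ _ _ _ _ u (dg x Ux))).
apply: Ck_onD => //; apply: IH; [exact: Ck_onW Cf|exact: Cdg|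
  exact: Ck_onW Cg|exact: Cdf].
Qed.

Lemma Ck_onN V W k (U : set V) (f : V -> W) : open U ->
  Ck_on k U f -> Ck_on k U (fun x => - f x).
Proof.
move=> oU; apply: (@Ck_on_lin _ _ _ _ _ _ (-%R : {linear W -> W})) => //.
exact: opp_continuous.
Qed.

Lemma Ck_onB V W k (U : set V) (f g : V -> W) : open U ->
  Ck_on k U f -> Ck_on k U g -> Ck_on k U (fun x => f x - g x).
Proof. by move=> oU Cf Cg; apply: Ck_onD => //; exact: Ck_onN. Qed.

(** The derivative of 1/f is again a product of 1/f with itself and with ['D_u f], so the induction
    on [k] closes. *)
Lemma Ck_onV V k (U : set V) (f : V -> R) : open U ->
  (forall x, U x -> f x != 0) ->
  Ck_on k U f -> Ck_on k U (fun x => (f x)^-1).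
Proof.
move=> oU f0; elim: k => [|k IH].
  by move=> cf x Ux; exact: (cvgV (f0 x Ux) (cf x Ux)).
move=> Cf; have [df Cdf] := Cf.
split=> [x Ux|u]; first by apply: differentiableV; [exact: df|exact: f0].
apply: (@Ck_on_ext _ _ _ _ (fun x => - ((f x)^-1 * (f x)^-1 * 'D_u f x))) => //.
  move=> x Ux; rewrite (deriveV (f0 x Ux) (@diff_derivable _ _ _ _ _ u (df x Ux))).
  by rewrite scaleNr -exprVn expr2.
apply: Ck_onN => //; apply: Ck_onM => //; last exact: Cdf.
by apply: Ck_onM => //; apply: IH; exact: Ck_onW Cf.
Qed.

Lemma Ck_on_prod V k (U : set V) (I : Type) (r : seq I) (f : I -> V -> R) :
  open U -> (forall i, Ck_on k U (f i)) ->
  Ck_on k U (fun x => \prod_(i <- r) f i x).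
Proof.
move=> oU Cf; elim: r => [|i r IH].
  rewrite (_ : (fun _ => _) = cst 1); first exact: Ck_on_cst.
  by apply/funext => x; rewrite big_nil.
rewrite (_ : (fun _ => _) = (fun x => f i x * \prod_(j <- r) f j x)).
  exact: Ck_onM.
by apply/funext => x; rewrite big_cons.
Qed.

Lemma Ck_on_pair V W X k (U : set V) (f : V -> W) (g : V -> X) : open U ->
  Ck_on k U f -> Ck_on k U g -> Ck_on k U (fun x => (f x, g x)).
Proof.
move=> oU; elim: k f g => [|k IH] f g.
  by move=> cf cg x Ux; exact: (cvg_pair (cf x Ux) (cg x Ux)).
move=> [df Cdf] [dg Cdg].
split=> [x Ux|u]; first by exact: (differentiable_pair (df x Ux) (dg x Ux)).
apply: (@Ck_on_ext _ _ _ _ (fun x => ('D_u f x, 'D_u g x))) => //; last first.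
  by apply: IH; [exact: Cdf|exact: Cdg].
move=> x Ux; have dfx := df x Ux; have dgx := dg x Ux.
by rewrite !deriveE//; [rewrite diff_pair|exact: differentiable_pair].
Qed.

(* Finitely many directions [w i] with continuous coordinates [l i]: through them
   the directional derivatives in [Ck_on] obey the chain rule. *)
Definition frame W (I : finType) (w : I -> W) (l : I -> {linear W -> R}) :=
  (forall i, continuous (l i)) /\ forall y, y = \sum_i l i y *: w i.

Lemma derive_frame W (I : finType) (w : I -> W) (l : I -> {linear W -> R})
    (g : W -> R) (y u : W) :
  frame w l -> differentiable g y ->
  'D_u g y = \sum_i l i u * 'D_(w i) g y.
Proof.
move=> [_ lw] dg; rewrite deriveE// {1}(lw u) linear_sum.
by apply: eq_bigr => i _; rewrite linearZ deriveE.
Qed.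

Lemma Ck_on_comp V W k (U : set V) (U' : set W) (f : V -> W) (g : W -> R)
    (I : finType) (w : I -> W) (l : I -> {linear W -> R}) :
  frame w l -> open U -> open U' -> (forall x, U x -> U' (f x)) ->
  Ck_on k U f -> Ck_on k U' g -> Ck_on k U (fun x => g (f x)).
Proof.
move=> wl oU oU' UU'; elim: k g => [|k IH] g.
  move=> cf cg x Ux; apply: continuous_comp; first exact: cf.
  by apply: cg; exact: UU'.
move=> Cf Cg; have [df Cdf] := Cf; have [dg Cdg] := Cg.
split=> [x Ux|u].
  exact: (differentiable_comp (df x Ux) (dg _ (UU' x Ux))).
(* The direction ['D_u f x] of the outer derivative moves with [x], whereas [Ck_on] speaks of fixed
   directions; the frame trades it for the directions [w i], with coefficients controlled by the
   smoothness of [f]. *)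
apply: (@Ck_on_ext _ _ _ _
  (fun x => \sum_i l i ('D_u f x) * 'D_(w i) g (f x))) => //.
  move=> x Ux; have dfx := df x Ux; have dgx := dg _ (UU' x Ux).
  rewrite -(derive_frame _ wl)// !deriveE//; last exact: differentiable_comp.
  by rewrite (diff_comp dfx dgx).
apply: Ck_on_sum => // i; apply: Ck_onM => //.
  by apply: Ck_on_lin => //; [exact: wl.1|exact: Cdf].
by apply: (IH ('D_(w i) g)); [exact: Ck_onW Cf|exact: Cdg].
Qed.

End CkCalculus.

(** * Coordinate maps and frames of the concrete spaces *)

Section Coordinates.
Context {R : realType}.
Implicit Types V W X : normedModType R.

Lemma coord_is_linear m n (i : 'I_m) (j : 'I_n) :
  linear (fun A : 'M[R]_(m, n) => A i j : R).
Proof. by move=> a u v; rewrite !mxE. Qed.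

Definition coord_lin m n (i : 'I_m) (j : 'I_n) : {linear 'M[R]_(m, n) -> R} :=
  HB.pack (fun A : 'M[R]_(m, n) => A i j : R)
    (GRing.isLinear.Build _ _ _ _ _ (coord_is_linear i j)).

Lemma continuous_coord_lin m n (i : 'I_m) (j : 'I_n) : continuous (coord_lin i j).
Proof. exact: coord_continuous. Qed.

Lemma scalel_is_linear W (w : W) : linear (fun a : R => a *: w).
Proof. by move=> a u v; rewrite scalerDl scalerA. Qed.

Definition scalel_lin W (w : W) : {linear R -> W} :=
  HB.pack (fun a : R => a *: w)
    (GRing.isLinear.Build _ _ _ _ _ (scalel_is_linear w)).

Lemma continuous_scalel_lin W (w : W) : continuous (scalel_lin w).
Proof. exact: scalel_continuous. Qed.

Lemma fst_is_linear V W : linear (@fst V W).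
Proof. by []. Qed.

Definition fst_lin V W : {linear (V * W)%type -> V} :=
  HB.pack (@fst V W) (GRing.isLinear.Build _ _ _ _ _ (@fst_is_linear V W)).

Lemma continuous_fst_lin V W : continuous (fst_lin V W).
Proof. by move=> p; exact: cvg_fst. Qed.

Lemma snd_is_linear V W : linear (@snd V W).
Proof. by []. Qed.

Definition snd_lin V W : {linear (V * W)%type -> W} :=
  HB.pack (@snd V W) (GRing.isLinear.Build _ _ _ _ _ (@snd_is_linear V W)).

Lemma continuous_snd_lin V W : continuous (snd_lin V W).
Proof. by move=> p; exact: cvg_snd. Qed.

Definition framed W := exists (I : finType) (w : I -> W) (l : I -> {linear W -> R}),
  frame w l.

Lemma framed_real : framed R.
Proof.
exists unit, (fun=> 1), (fun=> idfun); split=> [_ x //|y].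
by rewrite (big_pred1 tt) => [|[]//]; rewrite [RHS]mulr1.
Qed.

Lemma framed_mx m n : framed 'M[R]_(m.+1, n.+1).
Proof.
exists ('I_m.+1 * 'I_n.+1)%type, (fun ij => delta_mx ij.1 ij.2),
  (fun ij => coord_lin ij.1 ij.2); split=> [i|y].
  exact: continuous_coord_lin.
by rewrite {1}[y]matrix_sum_delta pair_big.
Qed.

Lemma framed_pair V W : framed V -> framed W -> framed (V * W)%type.
Proof.
move=> [I [v [l [cl Vl]]]] [J [w [h [ch Wh]]]].
exists (I + J)%type,
  (fun k => match k with inl i => (v i, 0) | inr j => (0, w j) end),
  (fun k => match k with
    | inl i => (l i \o fst_lin V W) : {linear (V * W)%type -> R}
    | inr j => (h j \o snd_lin V W) : {linear (V * W)%type -> R} end).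
split=> [[i|j] p|[x y]].
- by apply: continuous_comp; [exact: continuous_fst_lin|exact: cl].
- by apply: continuous_comp; [exact: continuous_snd_lin|exact: ch].
rewrite big_sumType/= [RHS]surjective_pairing; congr pair.
  rewrite -[RHS]/(fst_lin V W _) linearD !linear_sum/=.
  rewrite [X in _ + X]big1 ?addr0; first exact: Vl.
  by move=> j _; rewrite scaler0.
rewrite -[RHS]/(snd_lin V W _) linearD !linear_sum/=.
rewrite [X in X + _]big1 ?add0r; first exact: Wh.
by move=> j _; rewrite scaler0.
Qed.

Lemma Ck_on_mx V m n k (U : set V) (f : V -> 'M[R]_(m.+1, n.+1)) : open U ->
  (forall i j, Ck_on k U (fun x => f x i j)) -> Ck_on k U f.
Proof.
move=> oU Cf; apply: (@Ck_on_ext _ _ _ _ _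
    (fun x => \sum_i \sum_j (scalel_lin (delta_mx i j) (f x i j)))) => //.
  by move=> x _; rewrite [RHS]matrix_sum_delta.
apply: Ck_on_sum => // i; apply: Ck_on_sum => // j.
by apply: Ck_on_lin => //; exact: continuous_scalel_lin.
Qed.

Lemma Ck_on_coord V m n k (U : set V) (f : V -> 'M[R]_(m.+1, n.+1)) i j : open U ->
  Ck_on k U f -> Ck_on k U (fun x => f x i j).
Proof.
by move=> oU; apply: (@Ck_on_lin _ _ _ _ _ _ _ (coord_lin i j)) => //; exact: continuous_coord_lin.
Qed.

Lemma Ck_on_fst V W k (U : set (V * W)) : Ck_on k U fst.
Proof. exact: (Ck_on_linT _ _ (@continuous_fst_lin V W)). Qed.

Lemma Ck_on_snd V W k (U : set (V * W)) : Ck_on k U snd.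
Proof. exact: (Ck_on_linT _ _ (@continuous_snd_lin V W)). Qed.

(** Sine and cosine go through the induction together because differentiation exchanges them. *)
Lemma Ck_on_sin_cos V k (U : set V) (f : V -> R) : open U -> Ck_on k U f ->
  Ck_on k U (fun x => sin (f x)) /\ Ck_on k U (fun x => cos (f x)).
Proof.
move=> oU; elim: k => [|k IH] Cf.
  by split=> x Ux; apply: continuous_comp;
    [exact: Cf|exact: continuous_sin|exact: Cf|exact: continuous_cos].
have [Cs Cc] := IH (Ck_onW Cf); have [df Cdf] := Cf.
have ds (x : R) : differentiable (@sin R) x.
  by apply/derivable1_diffP; have [] := is_derive_sin x.
have dc (x : R) : differentiable (@cos R) x.
  by apply/derivable1_diffP; have [] := is_derive_cos x.
have chain (h h' : R -> R) x u : (forall y, is_derive (y : R) 1 h (h' y)) -> U x ->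
    'D_u (fun y => h (f y)) x = 'D_u f x * h' (f x).
  move=> dh Ux; have dfx := df x Ux.
  have dhx : differentiable h (f x) by apply/derivable1_diffP; have [] := dh (f x).
  rewrite !deriveE//; last exact: (differentiable_comp dfx dhx).
  by rewrite (diff_comp dfx dhx)/= diff1E//= derive1E derive_val.
split; split=> [x Ux|u].
- exact: (differentiable_comp (df x Ux) (ds (f x))).
- apply: (@Ck_on_ext _ _ _ _ _ (fun x => 'D_u f x * cos (f x))) => //.
    by move=> x Ux; rewrite (chain sin cos).
  by apply: Ck_onM => //; exact: Cdf.
- exact: (differentiable_comp (df x Ux) (dc (f x))).
- apply: (@Ck_on_ext _ _ _ _ _ (fun x => 'D_u f x * - sin (f x))) => //.
    by move=> x Ux; rewrite (chain cos (fun y => - sin y)).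
  by apply: Ck_onM => //; [exact: Cdf|exact: Ck_onN].
Qed.

End Coordinates.

(** * Uniform Taylor expansions *)

Section Taylor.
Context {R : realType}.

(** Mean value theorem between 0 and [x]: the intermediate point is no larger than [x] in modulus,
    so the bound on [dh] there is at most the bound at [x]. *)
Lemma growth_from_derivative (h dh : R -> R) (r M : R) n :
  (forall x : R, `|x| < r -> is_derive x 1 h (dh x)) -> h 0 = 0 ->
  (forall x : R, `|x| < r -> `|dh x| <= M * `|x| ^+ n) ->
  forall x : R, `|x| < r -> `|h x| <= M * `|x| ^+ n.+1.
Proof.
move=> hd h0 bd x xr.
have cont (a b : R) : (forall y, y \in `[a, b] -> `|y| < r) ->
    {within `[a, b], continuous h}.
  move=> abr; apply: derivable_within_continuous => y /abr yr.
  by have [] := hd y yr.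
have M0 : 0 <= M * `|x| ^+ n by apply: le_trans (bd x xr).
have fin (c : R) : `|c| <= `|x| -> `|dh c| <= M * `|x| ^+ n.
  move=> cx; have := bd c (le_lt_trans cx xr).
  (* The sign of [M] is free. A negative [M] forces [|c| ^+ n = 0], hence [dh c = 0], and [M0]
     closes that case. *)
  case: (ltP M 0) => M1.
    move=> H; have := le_trans (normr_ge0 _) H; rewrite nmulr_rge0// => cn.
    have c0 : `|c| ^+ n = 0 by apply/le_anti; rewrite cn exprn_ge0.
    by rewrite c0 mulr0 in H; apply: le_trans H _.
  move/le_trans; apply; apply: ler_wpM2l => //.
  by rewrite lerXn2r// nnegrE.
have close (c : R) : `|c| <= `|x| -> `|h x - 0| = `|dh c| * `|x| ->
    `|h x| <= M * `|x| ^+ n.+1.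
  move=> cx; rewrite subr0 => ->; rewrite exprSr mulrA; apply: ler_wpM2r => //.
  exact: fin.
have [x0|x0] := leP 0 x.
  have abr y : y \in `[0, x] -> `|y| < r.
    rewrite in_itv/= => /andP[y0 yx]; apply: le_lt_trans xr.
    by rewrite !ger0_norm.
  have [|c cx E] := MVT_segment x0 _ (cont _ _ abr) (df := dh).
    by move=> y /subset_itv_oo_cc/abr; exact: hd.
  apply: (close c); last by rewrite -h0 E subr0 normrM.
  by move: cx; rewrite in_itv/= => /andP[c0 cx]; rewrite !ger0_norm.
have abr y : y \in `[x, 0] -> `|y| < r.
  rewrite in_itv/= => /andP[y0 yx]; apply: le_lt_trans xr.
  by rewrite !ler0_norm// ?lerN2// ltW.
have [|c cx E] := MVT_segment (ltW x0) _ (cont _ _ abr) (df := dh).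
  by move=> y /subset_itv_oo_cc/abr; exact: hd.
apply: (close c); last by rewrite distrC -h0 E sub0r normrM normrN.
by move: cx; rewrite in_itv/= => /andP[c0 cx]; rewrite !ler0_norm// ?lerN2// ltW.
Qed.

Definition taylor_poly (phi : nat -> R -> R) n : {poly R} :=
  \poly_(k < n) (phi k 0 / k`!%:R).

Lemma deriv_taylor_poly (phi : nat -> R -> R) n :
  (taylor_poly phi n.+1)^`() = taylor_poly (fun k => phi k.+1) n.
Proof.
apply/polyP => i; rewrite coef_deriv !coef_poly ltnS.
case: ltnP => // _; last by rewrite mul0rn.
rewrite factS natrM -mulr_natr; field.
by rewrite pnatr_eq0 -lt0n fact_gt0 nat1r pnatr_eq0.
Qed.

(** [phi] lists successive derivatives. Differentiating the difference with the Taylor polynomial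
    only shifts this list, so each induction step integrates the previous bound once; the factor
    1/n! of the sharp remainder is given up. *)
Lemma taylor_bound (phi : nat -> R -> R) n (r M : R) :
  (forall k (x : R), (k < n)%N -> `|x| < r -> is_derive x 1 (phi k) (phi k.+1 x)) ->
  (forall x : R, `|x| < r -> `|phi n x| <= M) ->
  forall x : R, `|x| < r -> `|phi 0%N x - (taylor_poly phi n).[x]| <= M * `|x| ^+ n.
Proof.
elim: n phi => [|n IH] phi dphi bphi x xr.
  rewrite /taylor_poly poly_def big_ord0 horner0 subr0 expr0 mulr1.
  exact: bphi.
apply: (@growth_from_derivative (fun y => phi 0%N y - (taylor_poly phi n.+1).[y])
  (fun y => phi 1%N y - (taylor_poly (fun k => phi k.+1) n).[y]) r M n _ _ _ x xr).
- move=> y yr; rewrite -deriv_taylor_poly.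
  by apply: is_deriveB; exact: dphi.
- rewrite horner_coef0 coef_poly/= fact0 divr1 subrr//.
- by move=> y yr; apply: (IH (fun k => phi k.+1)) => // k z kn; apply: dphi.
Qed.

End Taylor.

Section Periodic.
Context {R : realType}.

(** Removing [floor (t / (2 pi))] periods brings [t] into one compact period, which opens the whole
    line to compactness arguments. *)
Lemma periodic_reduce (T : Type) (f : R -> T) (t : R) : periodic2pi f ->
  exists2 t0 : R, 0 <= t0 <= 2 * pi & f t = f t0.
Proof.
move=> pf; have tpi : 0 < 2 * pi :> R by rewrite mulr_gt0// pi_gt0.
have pn (n : nat) s : f (s + n%:R * (2 * pi)) = f s.
  elim: n => [|n IH]; first by rewrite mul0r addr0.
  by rewrite -natr1 mulrDl mul1r addrA pf.
pose k := Num.floor (t / (2 * pi)).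
exists (t - k%:~R * (2 * pi)).
  have /andP[k1 k2] := floor_itv (t / (2 * pi)).
  rewrite subr_ge0 -ler_pdivlMr// k1/= lerBlDl -[X in _ + X]mul1r -mulrDl.
  by rewrite -ler_pdivrMr// ltW// -[X in _ + X]/(1%:~R) -intrD.
case: k => n; first by rewrite -[in LHS](subrK (n%:R * (2 * pi)) t) pn.
by rewrite NegzE mulrNz mulNr opprK pn.
Qed.

End Periodic.

Section Expansion.
Context {R : realType}.

Lemma is_derive_line (V W : normedModType R) (f : V -> W) (x u : V) (s : R) :
  differentiable f (s *: u + x) ->
  is_derive s 1 (fun t => f (t *: u + x)) ('D_u f (s *: u + x)).
Proof.
move=> df; have dfu := @diff_derivable _ _ _ _ _ u df.
have E : (fun h : R => h^-1 *: (((fun t => f (t *: u + x)) \o shift s) (h *: 1) -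
      f (s *: u + x))) =
    (fun h => h^-1 *: ((f \o shift (s *: u + x)) (h *: u) - f (s *: u + x))).
  apply/funext => h /=; congr (_ *: (f _ - _)).
  by rewrite [h *: 1]mulr1 scalerDl addrA.
by split; rewrite /derivable /derive E.
Qed.

(** The derivative at [p + s] is that of the translated function at [p], which agrees with [f] near
    [p]. Invariance is asked on [U] only, as periodicity of the continuations is known only for
    [lambda] near [lams]. *)
Lemma derive_translate (V W : normedModType R) (f : V -> W) (U : set V) (s : V) :
  open U -> (forall p, U p -> f (p + s) = f p) ->
  forall u p, U p -> 'D_u f (p + s) = 'D_u f p.
Proof.
move=> oU fs u p Up; transitivity ('D_u (fun q => f (q + s)) p).
  have E : (fun h : R => h^-1 *: ((f \o shift (p + s)) (h *: u) - f (p + s))) =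
    (fun h => h^-1 *: (((fun q => f (q + s)) \o shift p) (h *: u) - f (p + s))).
    by apply/funext => h /=; rewrite addrA.
  by rewrite /derive E.
apply: (@near_eq_derive _ _ _ (fun q => f (q + s)) f p u).
near=> q; apply: fs.
by near: q; exact: open_nbhs_nbhs.
Unshelve. all: by end_near. Qed.

Lemma smooth_onD1 (V W : normedModType R) (U : set V) (f : V -> W) u :
  smooth_on U f -> smooth_on U ('D_u f).
Proof. by move=> sf k; have [_] := sf k.+1; apply. Qed.

Lemma smooth_on_diff (V W : normedModType R) (U : set V) (f : V -> W) x :
  smooth_on U f -> U x -> differentiable f x.
Proof. by move=> /(_ 1%N)[df _]; exact: df. Qed.

Lemma smooth_on_cont (V W : normedModType R) (U : set V) (f : V -> W) x :
  smooth_on U f -> U x -> {for x, continuous f}.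
Proof. by move=> /(_ 0%N); apply. Qed.

Section Slab.
Variable e0 : R.
Hypothesis e0_gt0 : 0 < e0.
(** Points are [(eps, (theta, phi))]: with eps split off, the direction [(1, 0)] differentiates in
    eps at a fixed point of the torus. *)
Definition slab : set (R * (R * R)) := [set p | `|p.1| < e0].

Lemma open_slab : open slab.
Proof.
apply: (@open_comp _ _ (fun p : R * (R * R) => `|p.1|) [set x | x < e0]).
  by move=> p _; apply: continuous_comp; [exact: cvg_fst|exact: norm_continuous].
exact: open_lt.
Qed.

Definition slab_periodic (K : R * (R * R) -> R) := forall e th ph,
  `|e| < e0 -> K (e, (th + 2 * pi, ph)) = K (e, (th, ph)) /\
               K (e, (th, ph + 2 * pi)) = K (e, (th, ph)).

Lemma slab_periodic_derive K u : slab_periodic K -> slab_periodic ('D_u K).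
Proof.
move=> pK; have addE (V W : normedModType R) (a a' : V) (b b' : W) :
    (a, b) + (a', b') = (a + a', b + b') by [].
have pt (s : R * R) : (forall p, slab p -> K (p + (0, s)) = K p) ->
    forall e t, `|e| < e0 -> 'D_u K (e, t + s) = 'D_u K (e, t).
  move=> Ks e t ee0; rewrite -[RHS](derive_translate open_slab Ks)//.
  by rewrite addE addr0.
move=> e th ph ee0; split.
  have -> : (th + 2 * pi, ph) = (th, ph) + (2 * pi, 0) by rewrite addE addr0.
  apply: pt => // -[e' [th' ph']] ee'; rewrite !addE !addr0.
  by have [] := pK e' th' ph' ee'.
have -> : (th, ph + 2 * pi) = (th, ph) + (0, 2 * pi) by rewrite addE addr0.
apply: pt => // -[e' [th' ph']] ee'; rewrite !addE !addr0.
by have [] := pK e' th' ph' ee'.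
Qed.

(** The extreme value theorem bounds [K] on a compact box spanning one period in each angle, and
    periodicity carries the bound to all angles; this is where uniformity over the torus comes from.
    Halving [e0] puts the closed box inside the open slab. *)
Lemma slab_bounded (K : R * (R * R) -> R) : slab_periodic K ->
  (forall p, slab p -> {for p, continuous K}) ->
  exists M, forall e t, `|e| < e0 / 2 -> `|K (e, t)| <= M.
Proof.
move=> pK cK.
pose box : set (R * (R * R)) :=
  `[- (e0 / 2), e0 / 2] `*` (`[0, 2 * pi] `*` `[0, 2 * pi]).
have tpi : 0 <= 2 * pi :> R by rewrite mulr_ge0// pi_ge0.
have e2 : 0 < e0 / 2 by rewrite divr_gt0.
have e20 : e0 / 2 < e0 by rewrite ltr_pdivrMr// ltr_pMr// ltr1n.
have cbox : compact box.
  by apply: compact_setX; [|apply: compact_setX]; exact: segment_compact.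
have box0 : box !=set0.
  exists (0, (0, 0)); split=> /=; last by split; rewrite /= in_itv/= lexx.
  by rewrite in_itv/= oppr_le0 !ltW.
have slabbox p : box p -> slab p.
  move=> [/=]; rewrite in_itv/= /slab/= -ler_norml => pe _.
  exact: le_lt_trans pe e20.
have cont : {within box, continuous (fun p => `|K p|)}.
  apply: continuous_in_subspaceT => p /set_mem/slabbox/cK cKp.
  by apply: continuous_comp cKp _; exact: norm_continuous.
have [c _ cmax] := compact_EVT_max box0 cbox cont.
exists `|K c| => e [th ph] ee.
have ee0 : `|e| < e0 by exact: lt_trans ee e20.
have [th0 th0P ->] := @periodic_reduce _ _ (fun th => K (e, (th, ph))) th
  (fun s => (pK e s ph ee0).1).
have [ph0 ph0P ->] := @periodic_reduce _ _ (fun ph => K (e, (th0, ph))) ph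
  (fun s => (pK e th0 s ee0).2).
apply: cmax; apply/mem_set; split=> /=; last by split; rewrite /= in_itv.
by rewrite in_itv/= -ler_norml ltW.
Qed.

(** Taylor's formula in eps at fixed [t]; the remainder is controlled uniformly in [t] by the
    eps-derivative of order [N.+2]. Since [K] vanishes at eps = 0, the factor [e^-1] lowers every
    order by one, whence the index shift in the coefficients. *)
Lemma smooth_expands (K : R * (R * R) -> R) :
  smooth_on slab K -> slab_periodic K -> (forall t, K (0, t) = 0) ->
  expands_in_powers (fun e t => e^-1 * K (e, t)).
Proof.
move=> sK pK K0.
pose D k := iter k (fun f : R * (R * R) -> R => 'D_(1, 0) f) K.
have sD k : smooth_on slab (D k).
  by elim: k => [//|k IH]; exact: smooth_onD1.
have pD k : slab_periodic (D k).
  by elim: k => [//|k IH]; exact: slab_periodic_derive.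
have dD k (x : R) t : `|x| < e0 ->
    is_derive x 1 (fun y => D k (y, t)) (D k.+1 (x, t)).
  move=> xe; have lineE (y : R) : y *: (1, 0) + (0, t) = (y, t).
    by congr pair; rewrite /= ?scaler0 ?add0r// [_ *: _]mulr1 addr0.
  have E : (fun y => D k (y, t)) = (fun y => D k (y *: (1, 0) + (0, t))).
    by apply/funext => y; rewrite lineE.
  rewrite E /= -[(x, t)]lineE; apply: is_derive_line; rewrite lineE.
  exact: smooth_on_diff (sD k) _.
exists (fun k t => D k.+1 (0, t) / k.+1`!%:R) => N.
have [M bM] := slab_bounded (pD N.+2) (fun p => @smooth_on_cont _ _ _ _ p (sD N.+2)).
have e2 : 0 < e0 / 2 by rewrite divr_gt0.
have e20 : e0 / 2 < e0 by rewrite ltr_pdivrMr// ltr_pMr// ltr1n.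
exists M, (e0 / 2); split=> // e t /andP[ep ee].
have e_neq0 : e != 0 by rewrite -normr_gt0.
have T := @taylor_bound _ (fun k y => D k (y, t)) N.+2 (e0 / 2) M _ _ e ee.
have {}T : `|D 0 (e, t) - (taylor_poly (fun k y => D k (y, t)) N.+2).[e]|
    <= M * `|e| ^+ N.+2.
  apply: T => [k x _ xe|x xe]; last exact: bM.
  by apply: dD; exact: lt_trans xe e20.
have E : (taylor_poly (fun k y => D k (y, t)) N.+2).[e] =
    e * \sum_(k < N.+1) e ^+ k *: (D k.+1 (0, t) / k.+1`!%:R).
  rewrite horner_poly big_ord_recl/= K0 !mul0r add0r mulr_sumr.
  by apply: eq_bigr => i _; rewrite exprS/= [_ *: _]mulrC mulrCA.
rewrite E in T; rewrite -(ler_pM2l ep) -normrM mulrBr mulrA divff// mul1r.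
by rewrite mulrCA -exprS.
Qed.

End Slab.

Lemma bigO_eps_cV (T : Type) n N (r : R -> T -> 'cV[R]_n.+1) :
  (forall i, bigO_eps N (fun e t => r e t i 0)) -> bigO_eps N r.
Proof.
move=> /choice[C /choice[d Cd]].
(* Nothing is known about the signs of the constants [C i], hence the absolute values in the sum
   that dominates each of them. *)
exists (\sum_i `|C i|), (\big[Num.min/1]_i d i); split.
  by apply/bigmin_gtP; split=> // i _; have [] := Cd i.
move=> e t /andP[e0 ed]; rewrite {1}/Num.Def.normr/= mx_normrE.
apply: bigmax_le => [|[i j] _].
  by rewrite mulr_ge0// sumr_ge0.
rewrite (ord1 j)/=; have [_ /(_ e t)] := Cd i; rewrite e0 /=.
have -> : `|e| < d i by apply: lt_le_trans ed _; exact: bigmin_le.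
move=> /(_ isT) H; apply: le_trans H _; apply: ler_wpM2r => //.
by rewrite (bigD1 i)//= (le_trans (ler_norm _))// lerDl sumr_ge0.
Qed.

Lemma expands_cV (T : Type) n (r : R -> T -> 'cV[R]_n.+1) :
  (forall i, expands_in_powers (fun e t => r e t i 0)) -> expands_in_powers r.
Proof.
move=> /choice[c cP]; exists (fun k t => \col_i c i k t) => N.
apply: bigO_eps_cV => i; have [C [d [d0 H]]] := cP i N.
exists C, d; split=> // e t ed; have := H e t ed.
rewrite !mxE summxE; congr (`|_ - _| <= _).
by apply: eq_bigr => k _; rewrite !mxE.
Qed.

End Expansion.

(** * Floquet coordinates *)

Section MatrixCalculus.
Context {R : realType} (V : normedModType R) (U : set V) (oU : open U).

Lemma Ck_on_det k n (A : V -> 'M[R]_n) :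
  (forall i j, Ck_on k U (fun x => A x i j)) -> Ck_on k U (fun x => \det (A x)).
Proof.
move=> CA; apply: Ck_on_sum => // s; apply: Ck_onM => //; first exact: Ck_on_cst.
exact: Ck_on_prod.
Qed.

(** By Cramer's rule each entry of the inverse is a polynomial in the entries of [A] divided by the
    nonvanishing determinant. *)
Lemma Ck_on_invmx k n (A : V -> 'M[R]_n) i j : (forall x, U x -> A x \in unitmx) ->
  (forall i j, Ck_on k U (fun x => A x i j)) -> Ck_on k U (fun x => invmx (A x) i j).
Proof.
move=> uA CA.
apply: (@Ck_on_ext _ _ _ _ _ (fun x => (\det (A x))^-1 * \adj (A x) i j)) => //.
  by move=> x /uA uAx; rewrite /invmx uAx !mxE.
apply: Ck_onM => //.
  apply: Ck_onV => //; last exact: Ck_on_det.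
  by move=> x /uA; rewrite unitmxE unitfE.
apply: (@Ck_on_ext _ _ _ _ _ (fun x => (-1) ^+ (j + i) *
    \det (\matrix_(k, l) A x (lift j k) (lift i l)))) => //.
  by move=> x _; rewrite !mxE /cofactor; congr (_ * \det _); apply/matrixP => a b; rewrite !mxE.
apply: Ck_onM => //; first exact: Ck_on_cst.
apply: Ck_on_det => a b.
by apply: (@Ck_on_ext _ _ _ _ _ (fun x => A x (lift j a) (lift i b))) => // x _; rewrite mxE.
Qed.

Lemma Ck_on_mulmx k m n p (A : V -> 'M[R]_(m, n)) (B : V -> 'M[R]_(n, p)) i j :
  (forall i j, Ck_on k U (fun x => A x i j)) ->
  (forall i j, Ck_on k U (fun x => B x i j)) ->
  Ck_on k U (fun x => (A x *m B x) i j).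
Proof.
move=> CA CB.
apply: (@Ck_on_ext _ _ _ _ _ (fun x => \sum_l A x i l * B x l j)) => //.
  by move=> x _; rewrite mxE.
by apply: Ck_on_sum => // l; apply: Ck_onM.
Qed.

End MatrixCalculus.

Section Partial.
Context {R : realType}.

Lemma is_derive_fst (W : normedModType R) (f : R * R -> W) (s t : R) :
  differentiable f (s, t) ->
  is_derive s 1 (fun x => f (x, t)) ('D_(1, 0) f (s, t)).
Proof.
move=> df; have lineE (x : R) : x *: (1, 0) + (0, t) = (x, t).
  by congr pair; rewrite /= ?scaler0 ?add0r// [_ *: _]mulr1 addr0.
have -> : (fun x => f (x, t)) = (fun x => f (x *: (1, 0) + (0, t))).
  by apply/funext => x; rewrite lineE.
by rewrite -[(s, t)]lineE; apply: is_derive_line; rewrite lineE.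
Qed.

Lemma is_derive_snd (W : normedModType R) (f : R * R -> W) (s t : R) :
  differentiable f (s, t) ->
  is_derive t 1 (fun x => f (s, x)) ('D_(0, 1) f (s, t)).
Proof.
move=> df; have lineE (x : R) : x *: (0, 1) + (s, 0) = (s, x).
  by congr pair; rewrite /= ?scaler0 ?add0r// [_ *: _]mulr1 addr0.
have -> : (fun x => f (s, x)) = (fun x => f (x *: (0, 1) + (s, 0))).
  by apply/funext => x; rewrite lineE.
by rewrite -[(s, t)]lineE; apply: is_derive_line; rewrite lineE.
Qed.

Lemma derive_coord (V : normedModType R) m n (f : V -> 'M[R]_(m.+1, n.+1)) p u i j :
  differentiable f p -> 'D_u f p i j = 'D_u (fun q => f q i j) p.
Proof.
by move=> df; rewrite derive_mx ?mxE//; exact: diff_derivable.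
Qed.

Lemma derive1_fst_coord m n (f : R -> R -> 'M[R]_(m.+1, n.+1)) (s t : R) i j :
  differentiable (fun p => f p.1 p.2) (s, t) ->
  derive1 (f ^~ t) s i j = 'D_(1, 0) (fun p => f p.1 p.2 i j) (s, t).
Proof.
move=> df; rewrite derive1E.
have [_ ->] := is_derive_fst df.
exact: derive_coord.
Qed.

Lemma derive1_snd_coord m n (f : R -> R -> 'M[R]_(m.+1, n.+1)) (s t : R) i j :
  differentiable (fun p => f p.1 p.2) (s, t) ->
  derive1 (f s) t i j = 'D_(0, 1) (fun p => f p.1 p.2 i j) (s, t).
Proof.
move=> df; rewrite derive1E.
have [_ E] := is_derive_snd df; rewrite -/(f s) in E.
by rewrite (_ : f s = (fun x => f (s, x).1 (s, x).2))// E; exact: derive_coord.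
Qed.

End Partial.

Section Shifted.
Context {R : realType} {m : nat}.
Local Notation vec := 'cV[R]_(2 + m).
Local Notation mat := 'M[R]_(2 + m).
Variables (F : vec -> R -> R -> vec) (lams delta : R).
Variables (v : R -> R -> vec) (P : R -> R -> mat) (E : R -> mat).
Hypothesis F_smooth : smooth_on setT (fun p : vec * R * R => F p.1.1 p.1.2 p.2).
Hypothesis F_periodic : forall x lambda, periodic2pi (fun theta => F x theta lambda).
Hypothesis v_smooth : smooth_on [set p : R * R | `|p.2 - lams| < delta]
  (fun p => v p.1 p.2).
Hypothesis P_smooth : smooth_on [set p : R * R | `|p.2 - lams| < delta]
  (fun p => P p.1 p.2).
Hypothesis v_periodic : forall lambda, `|lambda - lams| < delta ->
  periodic2pi (v ^~ lambda).
Hypothesis P_periodic : forall lambda, `|lambda - lams| < delta ->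
  periodic2pi (P ^~ lambda).
Hypothesis P_unit : forall theta lambda, `|lambda - lams| < delta ->
  P theta lambda \in unitmx.
Hypothesis P_floquet : forall theta lambda, `|lambda - lams| < delta ->
  Jac F (v theta lambda) theta lambda *m P theta lambda
    - derive1 (P ^~ lambda) theta
  = P theta lambda *m E lambda.

(* The vector field in Floquet coordinates around the periodic orbit, so that
   [Gfun] is [eps^-1] times this field at [eps z]. *)
Definition floquet_field (y : vec) (theta lambda : R) : vec :=
  invmx (P theta lambda) *m
    (F (v theta lambda + P theta lambda *m y) theta lambda
     - F (v theta lambda) theta lambda
     - derive1 (P ^~ lambda) theta *m y).

(** The regions where the continuations are controlled: only [lambda] is restricted, the angle and,
    in [tube], the Floquet coordinate being free. *)
Definition strip : set (R * R) := [set p | `|p.2 - lams| < delta].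
Definition tube : set (vec * R * R) := [set p | `|p.2 - lams| < delta].

Lemma Gfun_floquet_field z lambda theta eps :
  Gfun F v P z lambda theta eps
  = eps^-1 *: floquet_field (eps *: z) theta lambda.
Proof. by rewrite /Gfun /floquet_field -!scalemxAr. Qed.

Lemma floquet_field0 theta lambda : floquet_field 0 theta lambda = 0.
Proof. by rewrite /floquet_field !mulmx0 addr0 subrr subr0 mulmx0. Qed.

Lemma floquet_field_periodic y lambda : `|lambda - lams| < delta ->
  periodic2pi (floquet_field y ^~ lambda).
Proof.
move=> ld t; rewrite /floquet_field.
have -> : derive1 (P ^~ lambda) (t + 2 * pi) = derive1 (P ^~ lambda) t.
  rewrite !derive1E; apply: (@derive_translate _ _ _ (P ^~ lambda) setT) => //.
    exact: openT.
  by move=> p _; exact: P_periodic.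
by rewrite (P_periodic ld) (v_periodic ld) !F_periodic.
Qed.

Lemma open_norm_lt (V : normedModType R) (f : V -> R) (a d : R) :
  continuous f -> open [set p | `|f p - a| < d].
Proof.
move=> cf; apply: (@open_comp _ _ (fun p => `|f p - a|) [set x | x < d]).
  move=> p _; apply: (@continuous_comp _ _ _ (fun p => f p - a)); last exact: norm_continuous.
  by apply: continuousB; [exact: cf|exact: cst_continuous].
exact: open_lt.
Qed.

Lemma open_strip : open strip.
Proof. by apply: open_norm_lt => p; exact: cvg_snd. Qed.

Lemma open_tube : open tube.
Proof. by apply: open_norm_lt => p; exact: cvg_snd. Qed.

Lemma derive1_P_coord theta lambda i j : `|lambda - lams| < delta ->
  derive1 (P ^~ lambda) theta i j = 'D_(1, 0) (fun p : R * R => P p.1 p.2 i j) (theta, lambda).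
Proof.
by move=> ld; apply: derive1_fst_coord; exact: (smooth_on_diff P_smooth).
Qed.

Lemma floquet_field_smooth i :
  smooth_on tube (fun p => floquet_field p.1.1 p.1.2 p.2 i 0).
Proof.
have oU := open_tube; have oS := open_strip.
have fR2 := framed_pair (@framed_real R) (@framed_real R).
have fvec : framed (vec * R * R)%type.
  by apply: framed_pair; [apply: framed_pair|]; [exact: framed_mx|exact: framed_real..].
move=> k.
have Cth : Ck_on k tube (fun p => (p.1.2, p.2)).
  apply: Ck_on_pair => //; last exact: Ck_on_snd.
  apply: (@Ck_on_lin _ _ _ _ _ _ _ (snd_lin _ _)) => //; first exact: continuous_snd_lin.
  exact: Ck_on_fst.
have Cy j : Ck_on k tube (fun p => p.1.1 j 0).
  apply: (@Ck_on_lin _ _ _ _ _ _ _ (coord_lin _ _)) => //; first exact: continuous_coord_lin.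
  apply: (@Ck_on_lin _ _ _ _ _ _ _ (fst_lin _ _)) => //; first exact: continuous_fst_lin.
  exact: Ck_on_fst.
have pull (f : R * R -> R) : Ck_on k strip f -> Ck_on k tube (fun p => f (p.1.2, p.2)).
  move=> Cf; have [I [w [l wl]]] := fR2.
  exact: (Ck_on_comp (f := fun p => (p.1.2, p.2)) wl oU oS).
have CP a b : Ck_on k tube (fun p => P p.1.2 p.2 a b).
  apply: (pull (fun q => P q.1 q.2 a b)); apply: Ck_on_coord => //; exact: P_smooth.
have Cv a : Ck_on k tube (fun p => v p.1.2 p.2 a 0).
  apply: (pull (fun q => v q.1 q.2 a 0)); apply: Ck_on_coord => //; exact: v_smooth.
have CdP a b : Ck_on k tube (fun p => derive1 (P ^~ p.2) p.1.2 a b).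
  (* The theta-derivative of [P] is read as the directional derivative along [(1, 0)], whose
     smoothness is part of that of [P]. *)
  apply: (@Ck_on_ext _ _ _ _ _
    (fun p => 'D_(1, 0) (fun p : R * R => P p.1 p.2 a b) (p.1.2, p.2))) => //.
    by move=> p Up; rewrite derive1_P_coord.
  apply: (pull (fun q => 'D_(1, 0) (fun p : R * R => P p.1 p.2 a b) q)).
  apply: smooth_onD1 => k'; apply: Ck_on_coord => //; exact: P_smooth.
have CF (f : vec * R * R -> vec) a : (forall b, Ck_on k tube (fun p => f p b 0)) ->
    Ck_on k tube (fun p => F (f p) p.1.2 p.2 a 0).
  move=> Cf; have [I [w [l wl]]] := fvec.
  apply: (@Ck_on_comp _ _ _ k tube setT (fun p => (f p, p.1.2, p.2))
    (fun q => F q.1.1 q.1.2 q.2 a 0) _ _ _ wl) => //.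
  - exact: openT.
  - apply: Ck_on_pair => //; last exact: Ck_on_snd.
    apply: Ck_on_pair => //.
      apply: Ck_on_mx => // b c; rewrite (ord1 c); exact: Cf.
    apply: (@Ck_on_lin _ _ _ _ _ _ _ (snd_lin _ _)) => //; first exact: continuous_snd_lin.
    exact: Ck_on_fst.
  - apply: Ck_on_coord; first exact: openT.
    exact: F_smooth.
rewrite /floquet_field; apply: Ck_on_mulmx => // [a b|a b].
  by apply: Ck_on_invmx => // p Up; exact: P_unit.
rewrite (ord1 b).
apply: (@Ck_on_ext _ _ _ _ _ (fun p =>
   F (v p.1.2 p.2 + P p.1.2 p.2 *m p.1.1) p.1.2 p.2 a 0
     - F (v p.1.2 p.2) p.1.2 p.2 a 0
     - (derive1 (P ^~ p.2) p.1.2 *m p.1.1) a 0)) => //.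
  by move=> p _; rewrite !mxE.
apply: Ck_onB => //; last by apply: Ck_on_mulmx => // c d; rewrite (ord1 d).
apply: Ck_onB => //; last exact: CF.
apply: CF => c; apply: (@Ck_on_ext _ _ _ _ _ (fun p =>
   v p.1.2 p.2 c 0 + (P p.1.2 p.2 *m p.1.1) c 0)) => //.
  by move=> p _; rewrite !mxE.
apply: Ck_onD => //; apply: Ck_on_mulmx => // d d'; by rewrite (ord1 d').
Qed.

(** Differentiating [F] along [P w] produces [J P w], so the linear part at 0 is
    [P^-1 (J P - dP/dtheta)]; the Floquet equation turns it into [E lambda], which does not depend
    on [theta]. *)
Lemma derive_floquet_field theta lambda i j : `|lambda - lams| < delta ->
  'D_(delta_mx j 0, 0, 0) (fun p => floquet_field p.1.1 p.1.2 p.2 i 0)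
    (0, theta, lambda) = E lambda i j.
Proof.
move=> ld; set w : vec := delta_mx j 0.
set v0 := v theta lambda; set P0 := P theta lambda.
set dP := derive1 (P ^~ lambda) theta.
pose Fx (y : vec) := F y theta lambda.
have lineE t : t *: (w, 0, 0) + (0, theta, lambda) = (t *: w, theta, lambda) :> vec * R * R.
  by congr (_, _, _); rewrite /= ?scaler0 ?add0r ?addr0.
have dff : differentiable (fun p : vec * R * R => floquet_field p.1.1 p.1.2 p.2 i 0)
    ((0 : R) *: (w, 0, 0) + (0, theta, lambda)).
  by rewrite lineE scale0r; apply: smooth_on_diff (floquet_field_smooth i) _.
have [_ ] := is_derive_line dff; rewrite lineE scale0r => <-.
have dFx y : differentiable Fx y.
  have -> : Fx = (fun p : vec * R * R => F p.1.1 p.1.2 p.2) \o (fun y => (y, theta, lambda)) by [].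
  apply: differentiable_comp; last exact: (smooth_on_diff F_smooth).
  by apply: differentiable_pair => //; apply: differentiable_pair.
have dh k : is_derive (0 : R) 1 (fun t => Fx (v0 + P0 *m (t *: w)) k 0)
    ((Jac F v0 theta lambda *m P0) k j).
  have -> : (fun t => Fx (v0 + P0 *m (t *: w)) k 0) =
      (fun t => (fun y => Fx y k 0) (t *: (P0 *m w) + v0)).
    by apply/funext => t; rewrite addrC -scalemxAr.
  have dFk y : differentiable (fun y => Fx y k 0) y.
    exact: (differentiable_comp (dFx y) (differentiable_coord _ _ _)).
  have := @is_derive_line _ _ _ (fun y => Fx y k 0) v0 (P0 *m w) 0 (dFk _).
  rewrite scale0r add0r.
  suff -> : 'D_(P0 *m w) (fun y => Fx y k 0) v0 = (Jac F v0 theta lambda *m P0) k j by [].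
  rewrite -derive_coord// deriveE// [P0 *m w]matrix_sum_delta linear_sum summxE mxE.
  apply: eq_bigr => l _; rewrite big_ord1 linearZ !mxE mulrC deriveE//; congr (_ * _).
  by rewrite (bigD1 j)//= big1 ?addr0 => [|b bj]; rewrite !mxE eqxx ?mulr1// (negbTE bj) mulr0.
have dsum : is_derive (0 : R) 1
    (\sum_(k < 2 + m) (fun t : R => (invmx P0) i k * (Fx (v0 + P0 *m (t *: w)) k 0 - Fx v0 k 0 - t * (dP k j))))
    (\sum_(k < 2 + m) (invmx P0) i k * ((Jac F v0 theta lambda *m P0) k j - dP k j)).
  apply: is_derive_sum => k.
  have dk := dh k.
  have : is_derive (0 : R) 1 ((invmx P0) i k *: ((fun t => Fx (v0 + P0 *m (t *: w)) k 0) - cst (Fx v0 k 0) - (dP k j) *: id))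
     ((invmx P0) i k *: ((Jac F v0 theta lambda *m P0) k j - 0 - (dP k j) *: 1)).
    by apply: is_deriveZ; apply: is_deriveB.
  rewrite subr0 [dP k j *: 1]mulr1 => H.
  rewrite [X in is_derive _ _ X _](_ : _ = (invmx P0) i k *: ((fun t => Fx (v0 + P0 *m (t *: w)) k 0) - cst (Fx v0 k 0) - (dP k j) *: id))//.
  by apply/funext => t; congr (_ * (_ - _)); exact: mulrC.
have -> : (fun t : R => floquet_field (t *: (w, 0, 0) + (0, theta, lambda)).1.1
    (t *: (w, 0, 0) + (0, theta, lambda)).1.2 (t *: (w, 0, 0) + (0, theta, lambda)).2 i 0) =
    \sum_(k < 2 + m) (fun t : R => (invmx P0) i k * (Fx (v0 + P0 *m (t *: w)) k 0 - Fx v0 k 0 - t * (dP k j))).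
  apply/funext => t; rewrite lineE /floquet_field/= mxE fct_sumE.
  apply: eq_bigr => k _; rewrite !mxE -/v0 -/P0 -/dP; congr (_ * (_ - _)).
  rewrite (bigD1 j)//= big1 ?addr0 => [|b bj]; rewrite !mxE ?eqxx ?mulr1 1?mulrC//.
  by rewrite (negbTE bj) !mulr0 ?mul0r.
have [_ ->] := dsum.
have -> : \sum_(k < 2 + m) (invmx P0) i k * ((Jac F v0 theta lambda *m P0) k j - dP k j) =
    (invmx P0 *m (Jac F v0 theta lambda *m P0 - dP)) i j.
  by rewrite mxE; apply: eq_bigr => k _; rewrite !mxE.
by rewrite P_floquet// mulKmx// P_unit.
Qed.

End Shifted.

Section Torus.
Context {R : realType}.

Lemma smooth_torus_coord m n (z : R -> R -> 'M[R]_(m.+1, n.+1)) i j :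
  smooth_torus z -> smooth_torus (fun th ph => z th ph i j : R).
Proof.
move=> [sz p1 p2]; split.
- by move=> k; apply: Ck_on_coord; [exact: openT|exact: sz].
- by move=> ph th; rewrite p1.
- by move=> th ph; rewrite p2.
Qed.

Lemma smooth_torus_derive (f : R -> R -> R) u : smooth_torus f ->
  smooth_torus (fun th ph => 'D_u (fun q => f q.1 q.2) (th, ph)).
Proof.
have addE (V W : normedModType R) (a a' : V) (b b' : W) :
    (a, b) + (a', b') = (a + a', b + b') by [].
move=> [sf p1 p2]; split.
- move=> k; have := smooth_onD1 u sf k.
  by apply: Ck_on_ext => [|[]//]; exact: openT.
- move=> ph th.
  have -> : (th + 2 * pi, ph) = (th, ph) + (2 * pi, 0) by rewrite addE addr0.
  apply: (derive_translate openT) => // -[th' ph'] _; rewrite addE/= addr0.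
  exact: p1.
- move=> th ph.
  have -> : (th, ph + 2 * pi) = (th, ph) + (0, 2 * pi) by rewrite addE addr0.
  apply: (derive_translate openT) => // -[th' ph'] _; rewrite addE/= addr0.
  exact: p2.
Qed.

Lemma smooth_torus_astar m : smooth_torus (fun _ ph : R => @astar R m ph).
Proof.
split=> [k|//|th ph]; last by rewrite /astar mulr_natl cosD2pi sinD2pi.
have oT := @openT (R * R)%type.
have [Cs Cc] := @Ck_on_sin_cos R _ k setT snd oT (@Ck_on_snd R R R k setT).
apply: Ck_onD => //.
  exact: (@Ck_on_lin _ _ _ _ _ _ _ (scalel_lin _) oT (@continuous_scalel_lin _ _ _)).
exact: (@Ck_on_lin _ _ _ _ _ _ _ (scalel_lin _) oT (@continuous_scalel_lin _ _ _)).
Qed.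

End Torus.

Lemma expands_eq {R : realType} (T : Type) (W : normedModType R) (r r' : R -> T -> W) :
  (forall e t, e != 0 -> r' e t = r e t) ->
  expands_in_powers r -> expands_in_powers r'.
Proof.
move=> rr' [c cP]; exists c => N; have [C [d [d0 H]]] := cP N.
exists C, d; split=> // e t ed; rewrite rr'; first exact: H.
by have /andP[] := ed; rewrite normr_gt0.
Qed.

(** * Uniform expansion of the residual of the ansatz *)

Section Residual.
Context {R : realType} {m : nat}.
Local Notation vec := 'cV[R]_(2 + m).
Variables (g : vec -> R -> R -> vec) (lams delta oms : R).
Local Notation tube := (@tube R m lams delta).
Hypothesis delta_gt0 : 0 < delta.
Hypothesis g_smooth : forall i, smooth_on tube (fun p => g p.1.1 p.1.2 p.2 i 0).
Hypothesis g0 : forall theta lambda, g 0 theta lambda = 0.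
Hypothesis g_periodic : forall y lambda, `|lambda - lams| < delta ->
  periodic2pi (g y ^~ lambda).
Variables (lam2 om2 : R) (z2 z3 : R -> R -> vec).
Hypotheses (z2_smooth : smooth_torus z2) (z3_smooth : smooth_torus z3).

Definition field_residual eps (q : R * R) : vec :=
  eps^-1 *: g (eps *: z_ansatz z2 z3 q.1 q.2 eps) q.1 (quadratic_in_eps lams lam2 eps)
  - derive1 (fun th => z_ansatz z2 z3 th q.2 eps) q.1
  - quadratic_in_eps oms om2 eps *: derive1 (fun ph => z_ansatz z2 z3 q.1 ph eps) q.2.

Let zc (z : R -> R -> vec) i : R * R -> R := fun q => z q.1 q.2 i 0.
Let ac i := zc (fun _ ph => astar ph) i.

Let zc_diff z i q : smooth_torus z -> differentiable (zc z i) q.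
Proof.
by move=> /(@smooth_torus_coord _ _ _ _ i 0)[sz _ _]; exact: (smooth_on_diff sz).
Qed.

Lemma derive_z_ansatz eps i u q :
  'D_u (fun q => z_ansatz z2 z3 q.1 q.2 eps i 0) q =
  'D_u (ac i) q + eps * 'D_u (zc z2 i) q + eps ^+ 2 * 'D_u (zc z3 i) q.
Proof.
have dz z : smooth_torus z -> is_derive q u (zc z i) ('D_u (zc z i) q).
  by move=> sz; apply: derivableP; apply: diff_derivable; exact: zc_diff.
have da := dz _ (@smooth_torus_astar R m).
have -> : (fun q => z_ansatz z2 z3 q.1 q.2 eps i 0) =
    ac i + eps *: zc z2 i + eps ^+ 2 *: zc z3 i.
  apply/funext => x.
  by rewrite -[RHS]/(astar x.2 i 0 + eps * z2 x.1 x.2 i 0 + eps ^+ 2 * z3 x.1 x.2 i 0) !mxE.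
by have [_ ->] := is_deriveD (is_deriveD da (is_deriveZ eps (dz z2 z2_smooth)))
  (is_deriveZ (eps ^+ 2) (dz z3 z3_smooth)).
Qed.

Lemma z_ansatz_diff eps q : differentiable (fun q => z_ansatz z2 z3 q.1 q.2 eps) q.
Proof.
have d z : smooth_torus z -> differentiable (fun q => z q.1 q.2) q.
  by case=> sz _ _; exact: (smooth_on_diff sz).
have -> : (fun q : R * R => z_ansatz z2 z3 q.1 q.2 eps) =
    (fun q : R * R => astar q.2) + eps *: (fun q : R * R => z2 q.1 q.2)
    + eps ^+ 2 *: (fun q : R * R => z3 q.1 q.2) by [].
apply: differentiableD; last by apply: differentiableZ; exact: d.
apply: differentiableD; first exact: d (@smooth_torus_astar R m).
by apply: differentiableZ; exact: d.
Qed.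

Lemma field_residual_coord eps th ph i :
  field_residual eps (th, ph) i 0 =
  eps^-1 * g (eps *: z_ansatz z2 z3 th ph eps) th (quadratic_in_eps lams lam2 eps) i 0
  - ('D_(1, 0) (ac i) (th, ph) + eps * 'D_(1, 0) (zc z2 i) (th, ph)
     + eps ^+ 2 * 'D_(1, 0) (zc z3 i) (th, ph))
  - quadratic_in_eps oms om2 eps *
    ('D_(0, 1) (ac i) (th, ph) + eps * 'D_(0, 1) (zc z2 i) (th, ph)
     + eps ^+ 2 * 'D_(0, 1) (zc z3 i) (th, ph)).
Proof.
rewrite -!derive_z_ansatz /field_residual !mxE/=.
rewrite (@derive1_fst_coord _ _ _ (fun th ph => z_ansatz z2 z3 th ph eps)).
  rewrite (@derive1_snd_coord _ _ _ (fun th ph => z_ansatz z2 z3 th ph eps))//.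
  exact: z_ansatz_diff.
exact: z_ansatz_diff.
Qed.

Lemma radius_exists : exists2 e0 : R, 0 < e0 &
  forall eps, `|eps| < e0 -> `|quadratic_in_eps lams lam2 eps - lams| < delta.
Proof.
have l1 : 0 < `|lam2| + 1 by rewrite ltr_wpDl.
(* The cap 1 gives [eps ^+ 2 <= |eps|]; the added 1 keeps the denominator positive when
   [lam2 = 0]. *)
exists (Num.min 1 (delta / (`|lam2| + 1))) => [|eps].
  by rewrite lt_min ltr01 divr_gt0.
rewrite lt_min => /andP[e1]; rewrite ltr_pdivlMr// => ed.
rewrite /quadratic_in_eps addrC addKr normrM normrX.
apply: le_lt_trans ed; rewrite mulrDr mulr1 expr2 -mulrA.
rewrite (le_trans _ (_ : `|eps| * `|lam2| <= _)) ?lerDl//.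
by rewrite ler_wpM2l// ler_piMl// ltW.
Qed.

Lemma field_residual_expands : expands_in_powers field_residual.
Proof.
have [e0 e0_gt0 e0P] := radius_exists.
apply: expands_cV => i.
pose D u (z : R -> R -> vec) (p : R * (R * R)) := 'D_u (zc z i) p.2.
pose a : R -> R -> vec := fun _ => astar.
(* [K] is eps times the residual: freed of the division it is smooth across eps = 0 and vanishes
   there, as [smooth_expands] requires. *)
pose K (p : R * (R * R)) : R :=
  g (p.1 *: z_ansatz z2 z3 p.2.1 p.2.2 p.1) p.2.1 (quadratic_in_eps lams lam2 p.1) i 0
  - p.1 * ((D (1, 0) a p + p.1 * D (1, 0) z2 p + p.1 ^+ 2 * D (1, 0) z3 p)
  + quadratic_in_eps oms om2 p.1 *
    (D (0, 1) a p + p.1 * D (0, 1) z2 p + p.1 ^+ 2 * D (0, 1) z3 p)).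
have : expands_in_powers (fun e t => e^-1 * K (e, t)).
  apply: (smooth_expands e0_gt0); last first.
  - by move=> t; rewrite /K/= scale0r g0 !mul0r !mxE subr0.
  - move=> e th ph ee; rewrite /K /D/=.
    have perD z u : smooth_torus z ->
        'D_u (zc z i) (th + 2 * pi, ph) = 'D_u (zc z i) (th, ph) /\
        'D_u (zc z i) (th, ph + 2 * pi) = 'D_u (zc z i) (th, ph).
      move=> /(@smooth_torus_coord _ _ _ _ i 0)/(smooth_torus_derive u)[_ h1 h2].
      by split; [exact: h1|exact: h2].
    have perz : z_ansatz z2 z3 (th + 2 * pi) ph e = z_ansatz z2 z3 th ph e /\
        z_ansatz z2 z3 th (ph + 2 * pi) e = z_ansatz z2 z3 th ph e.
      have [_ h1 h2] := z2_smooth; have [_ h3 h4] := z3_smooth.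
      have [_ _ h5] := @smooth_torus_astar R m.
      by rewrite /z_ansatz h1 h2 h3 h4 (h5 0 ph).
    have [a1 a2] := perD a (1, 0) (@smooth_torus_astar R m).
    have [b1 b2] := perD a (0, 1) (@smooth_torus_astar R m).
    have [c1 c2] := perD z2 (1, 0) z2_smooth; have [d1 d2] := perD z2 (0, 1) z2_smooth.
    have [f1 f2] := perD z3 (1, 0) z3_smooth; have [h1 h2] := perD z3 (0, 1) z3_smooth.
    rewrite a1 a2 b1 b2 c1 c2 d1 d2 f1 f2 h1 h2 perz.1 perz.2.
    by rewrite g_periodic//; exact: e0P.
  - have oU := @open_slab R e0.
    move=> k; have C1 : Ck_on k (slab e0) (fun p : R * (R * R) => p.1) by exact: Ck_on_fst.
    have Csq c c2 : Ck_on k (slab e0) (fun p => quadratic_in_eps c c2 p.1).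
      apply: Ck_onD => //; first exact: Ck_on_cst.
      by apply: Ck_onM => //; [exact: Ck_onM|exact: Ck_on_cst].
    have pull (f : R * R -> R) : Ck_on k setT f -> Ck_on k (slab e0) (fun p => f p.2).
      move=> Cf; have [I [w [l wl]]] := framed_pair (@framed_real R) (@framed_real R).
      apply: (Ck_on_comp (f := snd) wl oU openT) => //; exact: Ck_on_snd.
    have Cz z j : smooth_torus z -> Ck_on k (slab e0) (fun p => zc z j p.2).
      by move=> /(@smooth_torus_coord _ _ _ _ j 0)[sz _ _]; exact: (pull (zc z j)).
    have CD z u : smooth_torus z -> Ck_on k (slab e0) (D u z).
      move=> /(@smooth_torus_coord _ _ _ _ i 0)[sz _ _].
      by apply: (pull ('D_u (zc z i))); exact: smooth_onD1.
    have Csum (f1 f2 f3 : R * (R * R) -> R) : Ck_on k (slab e0) f1 ->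
        Ck_on k (slab e0) f2 -> Ck_on k (slab e0) f3 ->
        Ck_on k (slab e0) (fun p => f1 p + p.1 * f2 p + p.1 ^+ 2 * f3 p).
      move=> h1 h2 h3; apply: Ck_onD => //; first by apply: Ck_onD => //; exact: Ck_onM.
      by apply: Ck_onM => //; exact: Ck_onM.
    have sa := @smooth_torus_astar R m.
    have CDs u : Ck_on k (slab e0)
        (fun p => D u a p + p.1 * D u z2 p + p.1 ^+ 2 * D u z3 p).
      by apply: Csum; exact: CD.
    apply: Ck_onB => //; last first.
      apply: Ck_onM => //; apply: Ck_onD; [exact: oU|exact: CDs|].
      by apply: Ck_onM; [exact: oU|exact: Csq|exact: CDs].
    have [I [w [l wl]]] : framed (vec * R * R)%type.
      by apply: framed_pair; [apply: framed_pair|]; [exact: framed_mx|exact: framed_real..].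
    apply: (@Ck_on_comp _ _ _ k (slab e0) tube (fun p =>
       (p.1 *: z_ansatz z2 z3 p.2.1 p.2.2 p.1, p.2.1, quadratic_in_eps lams lam2 p.1))
      (fun q => g q.1.1 q.1.2 q.2 i 0) _ _ _ wl) => //.
    - exact: open_tube.
    - by move=> p Up; exact: e0P.
    - apply: Ck_on_pair => //; apply: Ck_on_pair => //.
        apply: Ck_on_mx => // j b; rewrite (ord1 b).
        apply: (@Ck_on_ext R (R * (R * R))%type R k (slab e0) (fun p => p.1 *
           (zc a j p.2 + p.1 * zc z2 j p.2 + p.1 ^+ 2 * zc z3 j p.2))) => //.
          by move=> p _; rewrite /zc /a !mxE.
        by apply: Ck_onM => //; apply: Csum; exact: Cz.
      exact: (pull fst (@Ck_on_fst _ _ _ _ _)).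
    - exact: g_smooth.
apply: expands_eq => e [th ph] en0.
by rewrite field_residual_coord /K /D/= -addrA -opprD mulrBr mulKf.
Qed.

End Residual.

(** * Second-order expansions in eps *)

Section PointwiseExpansion.
Context {R : realType}.

Lemma le0_of_small (x C d : R) : 0 < d ->
  (forall e, 0 < e < d -> x <= C * e) -> x <= 0.
Proof.
move=> d0 H; rewrite leNgt; apply/negP => x0.
have C1 : 0 < `|C| + 1 by rewrite ltr_wpDl.
(* Small enough that [|C| * e] stays below [x], whatever the sign of [C]. *)
pose e := Num.min (d / 2) (x / (2 * (`|C| + 1))).
have e0 : 0 < e by rewrite lt_min !divr_gt0// mulr_gt0.
have ed : e < d.
  by rewrite /e gt_min ltr_pdivrMr// ltr_pMr// ltr1n.
have := H e; rewrite e0 ed => /(_ isT); apply/negP; rewrite -ltNge.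
have ex : e * (2 * (`|C| + 1)) <= x.
  by rewrite -ler_pdivlMr ?mulr_gt0// ge_min lexx orbT.
apply: (@le_lt_trans _ _ (`|C| * e)); first by rewrite ler_wpM2r// ?ler_norm// ltW.
have : 0 < e * (`|C| + 2) by rewrite mulr_gt0// ltr_wpDl.
by move: ex; lra.
Qed.

(** Uniqueness of asymptotic coefficients: as eps tends to 0 only [c 0] survives, so it is zero;
    after division by eps the remaining sum satisfies the same hypothesis with [N] lowered by
    one. *)
Lemma bigO_eps_coef0 (W : normedModType R) N (c : nat -> W) :
  bigO_eps N (fun (e : R) (_ : unit) => \sum_(k < N) e ^+ k *: c k) ->
  forall k, (k < N)%N -> c k = 0.
Proof.
elim: N c => [//|N IH] c [C [d [d0 H]]].
have c0 : c 0%N = 0.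
  apply/eqP; rewrite -normr_le0.
  apply: (@le0_of_small _ (`|C| + \sum_(k < N) `|c k.+1|) (Num.min d 1)).
    by rewrite lt_min d0 ltr01.
  move=> e; rewrite lt_min => /andP[e0 /andP[ed e1]].
  have := H e tt; rewrite gtr0_norm// e0 ed => /(_ isT).
  rewrite big_ord_recl expr0 scale1r => He.
  rewrite -[c 0%N](addrK (\sum_(i < N) e ^+ (bump 0 i) *: c (bump 0 i))).
  apply: le_trans (ler_normB _ _) _; rewrite mulrDl; apply: lerD.
    apply: le_trans He _; apply: (@le_trans _ _ (`|C| * e ^+ N.+1)).
      by rewrite ler_wpM2r ?ler_norm// exprn_ge0// ltW.
    by rewrite ler_wpM2l// exprS ler_piMr ?exprn_ile1 ?ltW// ?exprn_ge0// ltW.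
  apply: le_trans (ler_norm_sum _ _ _) _; rewrite mulr_suml; apply: ler_sum => i _.
  rewrite normrZ mulrC ler_wpM2l//= /bump/= ?add1n exprS normrM normrX (gtr0_norm e0).
  by rewrite ler_piMr// ?exprn_ile1// ltW.
suff IHN : forall k, (k < N)%N -> c k.+1 = 0 by case=> [//|k]; exact: IHN.
apply: (IH (fun k => c k.+1)); exists C, d; split=> // e t /andP[e0 ed].
have := H e t; rewrite e0 ed big_ord_recl expr0 c0 scaler0 add0r => /(_ isT).
rewrite (_ : \sum_(i < N) _ = e *: \sum_(k < N) e ^+ k *: c k.+1).
  by rewrite normrZ exprS mulrCA ler_pM2l.
by rewrite scaler_sumr; apply: eq_bigr => i _; rewrite /bump/= ?add1n exprS scalerA.
Qed.

(* The coefficients of a uniform expansion are determined pointwise, so a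
   pointwise estimate of the remainder is automatically uniform. *)
Lemma bigO_eps_uniform (W : normedModType R) (T : Type) N (r : R -> T -> W) :
  expands_in_powers r ->
  (forall t, bigO_eps N.+1 (fun e (_ : unit) => r e t)) -> bigO_eps N.+1 r.
Proof.
move=> [c cP] rO; have [C [d [d0 H]]] := cP N; exists C, d; split=> // e t ed.
have c0 : forall k, (k < N.+1)%N -> c k t = 0.
  apply: (@bigO_eps_coef0 _ N.+1 (c^~ t)); have [C' [d' [d'0 H']]] := rO t.
  exists (C + C'), (Num.min d d'); split; first by rewrite lt_min d0.
  move=> e' u /andP[e'0]; rewrite lt_min => /andP[e'd e'd'].
  rewrite mulrDl addrC -[X in `|X|](subKr (r e' t)).
  apply: le_trans (ler_normB _ _) _; apply: lerD.
    by apply: H' => //; rewrite e'0.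
  by apply: H; rewrite e'0.
have := H e t ed; rewrite big1 ?subr0// => k _.
by rewrite c0// scaler0.
Qed.

(** The remainder is written as [e ^+ 3] times a bounded factor, so that rules for sums and products
    reduce to ring identities; [d <= 1] bounds all powers of [e] by 1. The point [e = 0] is excluded
    because residuals contain [e^-1]. *)
Definition exp2 (r : R -> R) (c0 c1 c2 : R) := exists C d : R, [/\ 0 < d, d <= 1 &
  forall e, 0 < `|e| < d -> exists2 rho, `|rho| <= C &
    r e = c0 + e * c1 + e ^+ 2 * c2 + e ^+ 3 * rho].

Lemma exp2_bigO (r : R -> R) : exp2 r 0 0 0 ->
  bigO_eps 3 (fun e (_ : unit) => r e).
Proof.
move=> [C [d [d0 _ H]]]; exists C, d; split=> // e _ /H[rho rC ->].
by rewrite !mulr0 !add0r normrM normrX mulrC ler_wpM2r// exprn_ge0.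
Qed.

Lemma exp2_eq (r r' : R -> R) c0 c1 c2 c0' c1' c2' : exp2 r c0 c1 c2 ->
  (forall e, e != 0 -> r' e = r e) -> c0' = c0 -> c1' = c1 -> c2' = c2 ->
  exp2 r' c0' c1' c2'.
Proof.
move=> [C [d [d0 d1 H]]] rr' -> -> ->; exists C, d; split=> // e ed.
by rewrite rr'; [exact: H|case/andP: ed; rewrite normr_gt0].
Qed.

Lemma exp2_cst (c : R) : exp2 (fun=> c) c 0 0.
Proof. by exists 0, 1; split=> // e _; exists 0; rewrite ?normr0// !mulr0 !addr0. Qed.

Lemma exp2_poly (c0 c1 c2 : R) : exp2 (fun e => c0 + e * c1 + e ^+ 2 * c2) c0 c1 c2.
Proof. by exists 0, 1; split=> // e _; exists 0; rewrite ?normr0// !mulr0 !addr0. Qed.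

Lemma exp2_rem (rho : R -> R) (C d : R) : 0 < d ->
  (forall e, 0 < `|e| < d -> `|rho e| <= C) -> exp2 (fun e => e ^+ 3 * rho e) 0 0 0.
Proof.
move=> d0 H; exists C, (Num.min d 1); split; first by rewrite lt_min d0 ltr01.
  by rewrite ge_min lexx orbT.
move=> e /andP[e0]; rewrite lt_min => /andP[ed _]; exists (rho e).
  by apply: H; rewrite e0.
by rewrite !mulr0 !add0r.
Qed.

Lemma exp2_bounded (r : R -> R) c0 c1 c2 : exp2 r c0 c1 c2 ->
  exists C d : R, 0 < d /\ forall e, 0 < `|e| < d -> `|r e| <= C.
Proof.
move=> [C [d [d0 d1 H]]]; exists (`|c0| + `|c1| + `|c2| + C), d; split=> // e ed.
have [rho rC ->] := H e ed; have /andP[_ {}ed] := ed.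
have e1 : `|e| <= 1 by rewrite (le_trans (ltW ed)).
have en (k : nat) x : `|e ^+ k * x| <= `|x|.
  by rewrite normrM normrX ler_piMl// exprn_ile1.
do 3?[apply: le_trans (ler_normD _ _) _; apply: lerD] => //.
- exact: (en 1%N).
- exact: le_trans (en _ _) rC.
Qed.

Lemma exp2_add (r s : R -> R) c0 c1 c2 d0 d1 d2 : exp2 r c0 c1 c2 ->
  exp2 s d0 d1 d2 -> exp2 (fun e => r e + s e) (c0 + d0) (c1 + d1) (c2 + d2).
Proof.
move=> [C [d [dp de H]]] [C' [d' [dp' de' H']]].
exists (C + C'), (Num.min d d'); split; first by rewrite lt_min dp.
  by rewrite ge_min de.
move=> e /andP[e0]; rewrite lt_min => /andP[ed ed'].
have [|rho rC ->] := H e; first by rewrite e0.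
have [|rho' rC' ->] := H' e; first by rewrite e0.
exists (rho + rho'); last by ring.
by apply: le_trans (ler_normD _ _) _; exact: lerD.
Qed.

Lemma exp2_mul (r s : R -> R) c0 c1 c2 d0 d1 d2 : exp2 r c0 c1 c2 ->
  exp2 s d0 d1 d2 -> exp2 (fun e => r e * s e) (c0 * d0) (c0 * d1 + c1 * d0)
    (c0 * d2 + c1 * d1 + c2 * d0).
Proof.
move=> er es; have [B [b [b0 Hb]]] := exp2_bounded es.
have [C [d [dp de H]]] := er; have [C' [d' [dp' de' H']]] := es.
(* Third-order part of the product: cross terms of the two quadratics, the first quadratic times the
   second remainder, and the first remainder times all of [s], which [B] bounds. *)
exists (`|c1 * d2 + c2 * d1| + `|c2 * d2| + (`|c0| + `|c1| + `|c2|) * C' + C * B),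
  (Num.min b (Num.min d d')); split; first by rewrite !lt_min b0 dp.
  by rewrite !ge_min de orbT.
move=> e /andP[e0]; rewrite !lt_min => /andP[eb /andP[ed ed']].
have e1 : `|e| <= 1 by rewrite (le_trans (ltW ed)).
have en (k : nat) x : `|e ^+ k * x| <= `|x|.
  by rewrite normrM normrX ler_piMl// exprn_ile1.
have [|rho rC E] := H e; first by rewrite e0.
have [|rho' rC' E'] := H' e; first by rewrite e0.
have sB : `|s e| <= B by apply: Hb; rewrite e0.
exists (c1 * d2 + c2 * d1 + e ^+ 1 * (c2 * d2)
  + (c0 + e ^+ 1 * c1 + e ^+ 2 * c2) * rho' + rho * s e); last by rewrite E E'; ring.
apply: le_trans (ler_normD _ _) _; apply: lerD; last first.
  by rewrite normrM ler_pM.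
apply: le_trans (ler_normD _ _) _; apply: lerD.
  by apply: le_trans (ler_normD _ _) _; apply: lerD.
rewrite normrM ler_pM//.
do 2?[apply: le_trans (ler_normD _ _) _; apply: lerD] => //.
Qed.

Lemma exp2_sum (I : Type) (s : seq I) (r : I -> R -> R) (c0 c1 c2 : I -> R) :
  (forall i, exp2 (r i) (c0 i) (c1 i) (c2 i)) ->
  exp2 (fun e => \sum_(i <- s) r i e)
    (\sum_(i <- s) c0 i) (\sum_(i <- s) c1 i) (\sum_(i <- s) c2 i).
Proof.
move=> H; elim: s => [|i s IH].
  by rewrite !big_nil; apply: (exp2_eq (exp2_cst 0)) => // e _; rewrite big_nil.
rewrite !big_cons; apply: (exp2_eq (exp2_add (H i) IH)) => // e _.
by rewrite big_cons.
Qed.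

(** Along the parabola [a + e^2 b] the first Taylor term is already of order 2 and the next
    remainder of order 4, so no linear coefficient appears. Continuity of [f2] at [a] supplies the
    local bound for that remainder. *)
Lemma exp2_sq (f0 f1 f2 : R -> R) (a b d : R) : 0 < d ->
  (forall x : R, `|x - a| < d -> is_derive x 1 f0 (f1 x)) ->
  (forall x : R, `|x - a| < d -> is_derive x 1 f1 (f2 x)) ->
  {for a, continuous f2} ->
  exp2 (fun e => f0 (quadratic_in_eps a b e)) (f0 a) 0 (b * f1 a).
Proof.
move=> d0 df0 df1 cf2.
have [d' d'0 bf2] : exists2 d' : R, 0 < d' & forall x, `|x - a| < d' -> `|f2 x| <= `|f2 a| + 1.
  move/cvgrPdist_le : cf2 => /(_ 1 ltr01) [d' /= d'0 H]; exists d' => // x xa.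
  rewrite -(subrK (f2 a) (f2 x)) addrC; apply: le_trans (ler_normD _ _) _.
  by rewrite lerD2l distrC; apply: H; rewrite /= distrC.
pose r := Num.min d d'; have r0 : 0 < r by rewrite lt_min d0.
pose phi k := match k with 0%N => fun h => f0 (h + a) | 1%N => fun h => f1 (h + a)
  | _ => fun h => f2 (h + a) end.
have sh (f f' : R -> R) (h : R) : is_derive (h + a) 1 f (f' (h + a)) ->
    is_derive h 1 (fun h => f (h + a)) (f' (h + a)).
  move=> H; have := is_derive_shift h 1 a; rewrite /= => _.
  have [df fE] := H.
  have := @is_derive_line _ _ _ f a 1 h.
  rewrite [h *: 1]mulr1 => /(_ _)[|df' E].
    by apply/derivable1_diffP.
  have EE : (fun t : R => f (t *: 1 + a)) = (fun h => f (h + a)).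
    by apply/funext => t; rewrite [t *: 1]mulr1.
  by rewrite EE in df' E; split; rewrite ?E.
have T h : `|h| < r -> `|f0 (h + a) - (f0 a + h * f1 a)| <= (`|f2 a| + 1) * `|h| ^+ 2.
  move=> hr.
  have := @taylor_bound _ phi 2 r (`|f2 a| + 1) _ _ h hr.
  rewrite horner_poly big_ord_recr big_ord1/= !add0r !divr1 mulr1 [f1 a * _]mulrC; apply.
    move=> [|[|//]] x _; rewrite lt_min => /andP[xd _]; apply: sh.
      by apply: df0; rewrite addrK.
    by apply: df1; rewrite addrK.
  by move=> x; rewrite lt_min => /andP[_ xd]; apply: bf2; rewrite addrK.
pose rho e := (f0 (quadratic_in_eps a b e) - (f0 a + e ^+ 2 * b * f1 a)) / e ^+ 3.
have b1 : 0 < `|b| + 1 by rewrite ltr_wpDl.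
have dd0 : 0 < Num.min 1 (r / (`|b| + 1)) by rewrite lt_min ltr01 divr_gt0.
have rem : exp2 (fun e => e ^+ 3 * rho e) 0 0 0.
  apply: (exp2_rem (C := (`|f2 a| + 1) * `|b| ^+ 2) dd0) => e /andP[e0].
  rewrite lt_min ltr_pdivlMr// => /andP[e1 er].
  have hr : `|e ^+ 2 * b| < r.
    apply: le_lt_trans er; rewrite normrM normrX mulrDr mulr1 expr2 -mulrA.
    rewrite (le_trans _ (_ : `|e| * `|b| <= _)) ?lerDl//.
    by rewrite ler_wpM2l// ler_piMl// ltW.
  have := T _ hr; rewrite [_ + a]addrC -/(quadratic_in_eps a b e) => H.
  rewrite /rho normrM normfV normrX ler_pdivrMr ?exprn_gt0//.
  apply: le_trans H _; rewrite -[leRHS]mulrA ler_wpM2l// normrM normrX exprMn mulrC.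
  by rewrite ler_wpM2l ?exprn_ge0// -exprM (exprSr _ 3) ler_piMr ?exprn_ge0// ltW.
apply: (exp2_eq (exp2_add (exp2_poly (f0 a) 0 (b * f1 a)) rem)); rewrite ?addr0//.
move=> e e0; rewrite /rho [e ^+ 3 * _]mulrC divfK ?expf_neq0//; ring.
Qed.

End PointwiseExpansion.

Lemma taylor_bound3 {R : realType} (phi : nat -> R -> R) (r M x : R) :
  (forall k (x : R), (k < 4)%N -> `|x| < r -> is_derive x 1 (phi k) (phi k.+1 x)) ->
  (forall x : R, `|x| < r -> `|phi 4 x| <= M) -> phi 0%N 0 = 0 -> `|x| < r ->
  `|phi 0%N x - (x * phi 1%N 0 + x ^+ 2 * (2^-1 * phi 2 0) + x ^+ 3 * (6^-1 * phi 3 0))|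
    <= M * `|x| ^+ 4.
Proof.
move=> dphi bphi phi0 xr; have := taylor_bound dphi bphi xr.
rewrite horner_poly !big_ord_recl big_ord0 /= phi0 !mul0r add0r addr0.
rewrite /bump/= !factS fact0 /= expr1; congr (`|_ - _| <= _).
move: (phi 1%N 0) (phi 2 0) (phi 3 0) => t1 t2 t3.
by field.
Qed.

Lemma exp2_idmul {R : realType} (r : R -> R) c0 c1 c2 : exp2 r c0 c1 c2 ->
  exp2 (fun e => e * r e) 0 c0 c1.
Proof.
have eid : exp2 (fun e : R => e) 0 1 0.
  by apply: (exp2_eq (exp2_poly 0 1 0)) => // e _; rewrite add0r mulr1 mulr0 addr0.
move=> er; apply: (exp2_eq (exp2_mul eid er)) => //.
- by rewrite mul0r.
- by rewrite mul0r mul1r add0r.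
- by rewrite !mul0r mul1r add0r addr0.
Qed.

Lemma exp2_scale {R : realType} (k : R) (r : R -> R) c0 c1 c2 : exp2 r c0 c1 c2 ->
  exp2 (fun e => k * r e) (k * c0) (k * c1) (k * c2).
Proof.
move=> er; apply: (exp2_eq (exp2_mul (exp2_cst k) er)) => //.
- by rewrite mul0r addr0.
- by rewrite !mul0r !addr0.
Qed.

(** * Third-order Taylor expansion of the field along the ansatz *)

Section FieldTaylor.
Context {R : realType} {m : nat}.
Local Notation vec := 'cV[R]_(2 + m).
Variables (lams delta : R).
Local Notation tube := (@tube R m lams delta).
Implicit Types (f h : vec * R * R -> R) (p : vec * R * R) (z y : vec).

Definition dvar (j : 'I_(2 + m)) f : vec * R * R -> R := 'D_(delta_mx j 0, 0, 0) f.
Definition dlam f : vec * R * R -> R := 'D_(0, 0, 1) f.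
(** The derivative of [f] along the vector [z], expanded in coordinate directions so that [z] enters
    through scalar coefficients only: bounds can then be uniform in [z], which varies with eps in
    the application. *)
Definition ray z f p : R := \sum_j z j 0 * dvar j f p.

Lemma smooth_dvar j f : smooth_on tube f -> smooth_on tube (dvar j f).
Proof. exact: smooth_onD1. Qed.

Lemma smooth_lincomb z (h : 'I_(2 + m) -> vec * R * R -> R) :
  (forall j, smooth_on tube (h j)) -> smooth_on tube (fun p => \sum_j z j 0 * h j p).
Proof.
have oU := @open_tube R m lams delta.
move=> sh k; apply: Ck_on_sum => // j.
by apply: Ck_onM => //; [exact: Ck_on_cst|exact: sh].
Qed.

Lemma smooth_ray z f : smooth_on tube f -> smooth_on tube (ray z f).
Proof. by move=> sf; apply: smooth_lincomb => j; exact: smooth_dvar. Qed.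

Lemma smooth_iter_ray k z f : smooth_on tube f -> smooth_on tube (iter k (ray z) f).
Proof. by move=> sf; elim: k => [//|k IH]; exact: smooth_ray. Qed.

Lemma is_derive_ray z f (s theta lambda : R) : smooth_on tube f -> `|lambda - lams| < delta ->
  is_derive s 1 (fun s => f (s *: z, theta, lambda)) (ray z f (s *: z, theta, lambda)).
Proof.
move=> sf ld.
have lineE t : t *: (z, 0, 0) + (0, theta, lambda) = (t *: z, theta, lambda) :> vec * R * R.
  by congr (_, _, _); rewrite /= ?scaler0 ?add0r ?addr0.
have df : differentiable f (s *: z, theta, lambda) by apply: smooth_on_diff sf _.
have -> : (fun s => f (s *: z, theta, lambda)) =
    (fun s => f (s *: (z, 0, 0) + (0, theta, lambda))).
  by apply/funext => t; rewrite lineE.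
have -> : ray z f (s *: z, theta, lambda) = 'D_(z, 0, 0) f (s *: (z, 0, 0) + (0, theta, lambda)).
  rewrite lineE deriveE//.
  have -> : (z, 0, 0) = \sum_j z j 0 *: (delta_mx j 0, 0, 0) :> vec * R * R.
    set S := RHS.
    have S11 : S.1.1 = \sum_j z j 0 *: delta_mx j 0.
      by rewrite -[LHS]/((fst_lin _ _ \o fst_lin _ _) S) linear_sum.
    have S12 : S.1.2 = 0.
      rewrite -[LHS]/((snd_lin _ _ \o fst_lin _ _) S) linear_sum/=.
      by rewrite big1// => j _; exact: mulr0.
    have S2 : S.2 = 0.
      rewrite -[LHS]/(snd_lin _ _ S) linear_sum/=.
      by rewrite big1// => j _; exact: mulr0.
    rewrite [S]surjective_pairing [S.1]surjective_pairing S11 S12 S2.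
    congr (_, _, _); rewrite {1}[z]matrix_sum_delta.
    by apply: eq_bigr => j _; rewrite big_ord1.
  by rewrite linear_sum; apply: eq_bigr => j _; rewrite linearZ/= /dvar deriveE.
by apply: is_derive_line; rewrite lineE.
Qed.

Lemma derive_lincomb u z (h : 'I_(2 + m) -> vec * R * R -> R) p :
  (forall j, smooth_on tube (h j)) -> tube p ->
  'D_u (fun p => \sum_j z j 0 * h j p) p = \sum_j z j 0 * 'D_u (h j) p.
Proof.
move=> sh Up.
have dh j : derivable (h j) p u.
  by apply: diff_derivable; exact: smooth_on_diff (sh j) Up.
have -> : (fun p => \sum_j z j 0 * h j p) = \sum_j (z j 0 *: h j).
  by apply/funext => q; rewrite fct_sumE.
rewrite derive_sum; last by move=> j; exact: derivableZ.
by apply: eq_bigr => j _; rewrite deriveZ.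
Qed.

(** The weights [w] are constants and pass through every derivative; for [w = z] this unfolds
    iterated rays into sums of iterated partial derivatives. *)
Lemma iter_ray_sum k z (w : vec) (h : 'I_(2 + m) -> vec * R * R -> R) p :
  (forall j, smooth_on tube (h j)) -> tube p ->
  iter k (ray z) (fun p => \sum_j w j 0 * h j p) p
  = \sum_j w j 0 * iter k (ray z) (h j) p.
Proof.
move=> sh; elim: k p => [//|k IH] p Up; rewrite iterS /ray.
transitivity (\sum_l z l 0 * \sum_j w j 0 * dvar l (iter k (ray z) (h j)) p).
  apply: eq_bigr => l _; congr (_ * _); rewrite /dvar.
  rewrite -derive_lincomb//; last by move=> j; exact: smooth_iter_ray.
  apply: near_eq_derive; near=> q; apply: IH; near: q.
  by apply: open_nbhs_nbhs; split=> //; exact: open_tube.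
under eq_bigr do rewrite mulr_sumr.
rewrite exchange_big/=; apply: eq_bigr => j _; rewrite mulr_sumr.
by apply: eq_bigr => l _; rewrite mulrCA.
Unshelve. all: by end_near. Qed.

Definition locally_bounded f theta := exists C d : R, 0 < d /\
  forall y lambda, (forall j, `|y j 0| < d) -> `|lambda - lams| < d ->
    `|f (y, theta, lambda)| <= C.

Lemma smooth_locally_bounded f theta : 0 < delta ->
  smooth_on tube f -> locally_bounded f theta.
Proof.
move=> d0 sf; set p0 : vec * R * R := (0, theta, lams).
have cf : {for p0, continuous f}.
  by apply: (smooth_on_cont sf); rewrite /tube/= subrr normr0.
move/cvgrPdist_le : cf => /(_ 1 ltr01).
rewrite near_simpl => /nbhs_normP[d /= dp H].
exists (`|f p0| + 1), d; split=> // y lambda yd ld.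
rewrite -(subrK (f p0) (f _)) addrC; apply: le_trans (ler_normD _ _) _.
rewrite lerD2l distrC; apply: H; rewrite /= /ball_/=.
rewrite !prod_normE/= !gt_max sub0r normrN subrr normr0 dp distrC ld !andbT.
rewrite {1}/Num.Def.normr/= mx_normrE; apply/bigmax_ltP; split=> // -[i j] _.
by rewrite (ord1 j).
Qed.

(** The innermost derivative is expanded first: its coefficients are at most [Z], and the induction
    hypothesis applies to each [dvar j f], so the constants do not depend on [z]. *)
Lemma iter_ray_bounded k f theta Z : 0 < delta -> smooth_on tube f ->
  exists C d : R, 0 < d /\ forall z y lambda, (forall j, `|z j 0| <= Z) ->
    (forall j, `|y j 0| < d) -> `|lambda - lams| < d ->
    `|iter k (ray z) f (y, theta, lambda)| <= C.
Proof.
move=> d0; elim: k f => [|k IH] f sf.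
  by have [C [d [dp H]]] := smooth_locally_bounded theta d0 sf; exists C, d;
    split=> // z y lambda _; exact: H.
have /choice[C /choice[d Cd]] := fun j => IH _ (smooth_dvar j sf).
exists (\sum_j Z * C j), (Num.min delta (\big[Num.min/1]_j d j)); split.
  rewrite lt_min d0; apply/bigmin_gtP; split=> // j _.
  by have [] := Cd j.
move=> z y lambda zZ yd; rewrite lt_min => /andP[ld ld'].
rewrite iterSr iter_ray_sum//; last by move=> j; exact: smooth_dvar.
apply: le_trans (ler_norm_sum _ _ _) _; apply: ler_sum => j _.
rewrite normrM ler_pM//; have [_ H] := Cd j; apply: H => //.
  move=> i; apply: lt_le_trans (yd i) _; rewrite ge_min; apply/orP; right.
  exact: bigmin_le.
by apply: lt_le_trans ld' _; exact: bigmin_le.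
Qed.

Lemma ray2E z f p : smooth_on tube f -> tube p ->
  ray z (ray z f) p = \sum_j z j 0 * \sum_k z k 0 * dvar k (dvar j f) p.
Proof.
move=> sf Up; rewrite -[LHS]/(iter 1 (ray z) (ray z f) p) iter_ray_sum//.
by move=> j; exact: smooth_dvar.
Qed.

Lemma ray3E z f p : smooth_on tube f -> tube p ->
  ray z (ray z (ray z f)) p = \sum_j z j 0 * \sum_k z k 0 *
    \sum_l z l 0 * dvar l (dvar k (dvar j f)) p.
Proof.
move=> sf Up; rewrite -[LHS]/(iter 2 (ray z) (ray z f) p) iter_ray_sum//.
  by apply: eq_bigr => j _; rewrite /= ray2E//; exact: smooth_dvar.
by move=> j; exact: smooth_dvar.
Qed.

Lemma exp2_lambda f theta lam2 : 0 < delta -> smooth_on tube f ->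
  exp2 (fun e => f (0, theta, quadratic_in_eps lams lam2 e))
    (f (0, theta, lams)) 0 (lam2 * dlam f (0, theta, lams)).
Proof.
move=> d0 sf.
have dl h x : smooth_on tube h -> `|x - lams| < delta ->
    is_derive x 1 (fun x => h (0, theta, x)) (dlam h (0, theta, x)).
  move=> sh xd.
  have lineE (t : R) : t *: (0, 0, 1) + (0, theta, 0) = (0, theta, t) :> vec * R * R.
    by congr (_, _, _); rewrite /= ?scaler0 ?add0r ?addr0// [_ *: _]mulr1.
  have -> : (fun x => h (0, theta, x)) = (fun x : R => h (x *: (0, 0, 1) + (0, theta, 0))).
    by apply/funext => t; rewrite lineE.
  rewrite /dlam -[(0, theta, x)]lineE; apply: is_derive_line; rewrite lineE.
  exact: smooth_on_diff sh _.
have s1 : smooth_on tube (dlam f) by exact: smooth_onD1.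
apply: (@exp2_sq _ (fun x => f (0, theta, x)) (fun x => dlam f (0, theta, x)) (fun x => dlam (dlam f) (0, theta, x)) lams lam2 delta d0).
- by move=> x; exact: dl.
- by move=> x; exact: (dl (dlam f)).
- have cD : {for (0, theta, lams), continuous (dlam (dlam f))}.
    apply: (@smooth_on_cont _ _ _ tube); first exact: smooth_onD1.
    by rewrite /tube/= subrr normr0.
  apply: (@continuous_comp _ _ _ (fun x : R => (0, theta, x) : vec * R * R) (dlam (dlam f)) lams _ cD).
  by apply: differentiable_continuous; apply: differentiable_pair.
Qed.

(** Taylor's formula along [s z(e)] at [s = e], followed by an expansion in [lambda] of the
    derivatives at 0. After division by [e] the linear, quadratic and cubic terms start at orders 0,
    1 and 2, so the shift of [lambda] is felt up to order 2 in the linear term only. *)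
Lemma exp2_field f theta lam2 (z : R -> vec) (a b c : 'I_(2 + m) -> R) :
  0 < delta -> smooth_on tube f ->
  (forall lambda, `|lambda - lams| < delta -> f (0, theta, lambda) = 0) ->
  (forall j, exp2 (fun e => z e j 0) (a j) (b j) (c j)) ->
  let f1 j := dvar j f (0, theta, lams) in
  let f1' j := dlam (dvar j f) (0, theta, lams) in
  let f2 j k := dvar k (dvar j f) (0, theta, lams) in
  let f3 j k l := dvar l (dvar k (dvar j f)) (0, theta, lams) in
  exp2 (fun e => e^-1 * f (e *: z e, theta, quadratic_in_eps lams lam2 e))
    (\sum_j a j * f1 j)
    (\sum_j b j * f1 j + 2^-1 * \sum_j a j * \sum_k a k * f2 j k)
    (\sum_j c j * f1 j + lam2 * \sum_j a j * f1' j
     + 2^-1 * (\sum_j a j * (\sum_k b k * f2 j k) + \sum_j b j * (\sum_k a k * f2 j k))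
     + 6^-1 * \sum_j a j * \sum_k a k * \sum_l a l * f3 j k l).
Proof.
move=> d0 sf f0 ez f1 f1' f2 f3.
pose lam := quadratic_in_eps lams lam2.
have eid : exp2 (fun e : R => e) 0 1 0.
  by apply: (exp2_eq (exp2_poly 0 1 0)) => // e _; rewrite add0r mulr1 mulr0 addr0.
have e1 j : exp2 (fun e => dvar j f (0, theta, lam e)) (f1 j) 0 (lam2 * f1' j).
  by apply: exp2_lambda => //; exact: smooth_dvar.
have e2 j k : exp2 (fun e => dvar k (dvar j f) (0, theta, lam e)) (f2 j k) 0
    (lam2 * dlam (dvar k (dvar j f)) (0, theta, lams)).
  by apply: exp2_lambda => //; do 2!apply: smooth_dvar.
have e3 j k l : exp2 (fun e => dvar l (dvar k (dvar j f)) (0, theta, lam e)) (f3 j k l) 0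
    (lam2 * dlam (dvar l (dvar k (dvar j f))) (0, theta, lams)).
  by apply: exp2_lambda => //; do 3!apply: smooth_dvar.
pose t1 e := \sum_j z e j 0 * dvar j f (0, theta, lam e).
pose t2 e := \sum_j z e j 0 * \sum_k z e k 0 * dvar k (dvar j f) (0, theta, lam e).
pose t3 e := \sum_j z e j 0 * \sum_k z e k 0 * \sum_l z e l 0 *
   dvar l (dvar k (dvar j f)) (0, theta, lam e).
(* The fourth-order remainder of the field, scaled so that [e ^+ 3 * rho e] is what is left after
   division by [e]. *)
pose rho e := (f (e *: z e, theta, lam e)
  - (e * t1 e + e ^+ 2 * (2^-1 * t2 e) + e ^+ 3 * (6^-1 * t3 e))) / e ^+ 4.
have rem : exp2 (fun e => e ^+ 3 * rho e) 0 0 0.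
  have /choice[B /choice[bd Bbd]] := fun j => exp2_bounded (ez j).
  pose Z := \sum_j `|B j|.
  have [C [d [dp Cd]]] := iter_ray_bounded 4 theta Z d0 sf.
  have dm0 : 0 < Num.min delta d by rewrite lt_min d0.
  have [r0 r0_gt0 r0P] := radius_exists lams dm0 lam2.
  have Z0 : 0 <= Z by apply: sumr_ge0.
  have Z1 : 0 < 2 * (Z + 1) by rewrite mulr_gt0// ltr_wpDl.
  (* [r0] keeps [lam e] in range, [d / (2 * (Z + 1))] keeps the points [s z(e)] with [|s| < 2 |e|]
     where the derivative bound holds, and [bd] makes the bounds on the entries of [z e] valid. *)
  apply: (@exp2_rem _ _ C (Num.min (Num.min r0 (d / (2 * (Z + 1)))) (\big[Num.min/1]_j bd j))).
    rewrite !lt_min r0_gt0 divr_gt0//=; apply/bigmin_gtP; split=> // j _.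
    by have [] := Bbd j.
  move=> e /andP[ep]; rewrite !lt_min => /andP[/andP[er ed] eb].
  have zZ j : `|z e j 0| <= Z.
    have [_ /(_ e)] := Bbd j; rewrite ep /= => H.
    apply: le_trans (H _) _; first by apply: lt_le_trans eb _; exact: bigmin_le.
    by rewrite /Z (bigD1 j)//= (le_trans (ler_norm _))// lerDl sumr_ge0.
  have /andP[ld ld'] : (`|lam e - lams| < delta) && (`|lam e - lams| < d).
    by rewrite -lt_min; exact: r0P.
  (* With [z e] and [lam e] frozen, Taylor's formula in [s] is used on an open interval of radius
     [2 |e|], which contains [s = e]. *)
  have ee2 : `|e| < 2 * `|e| by rewrite ltr_pMl// ltr1n.
  pose phi k s := iter k (ray (z e)) f (s *: z e, theta, lam e).
  have dphi k (x : R) : (k < 4)%N -> `|x| < 2 * `|e| -> is_derive x 1 (phi k) (phi k.+1 x).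
    by move=> _ _; apply: is_derive_ray => //; exact: smooth_iter_ray.
  have bphi (x : R) : `|x| < 2 * `|e| -> `|phi 4 x| <= C.
    move=> xe; apply: Cd => // j; rewrite mxE normrM.
    apply: le_lt_trans (_ : 2 * `|e| * Z < _); first by rewrite ler_pM// ltW.
    move: ed; rewrite ltr_pdivlMr// => /(le_lt_trans _); apply.
    by rewrite mulrCA mulrA ler_wpM2l ?mulr_ge0// lerDl.
  have phi0 : phi 0%N 0 = 0 by rewrite /phi/= scale0r f0.
  have H := taylor_bound3 dphi bphi phi0 ee2.
  have r1 : phi 1%N 0 = t1 e by rewrite /phi scale0r.
  have r2 : phi 2%N 0 = t2 e by rewrite /phi scale0r; exact: ray2E.
  have r3 : phi 3%N 0 = t3 e by rewrite /phi scale0r; exact: ray3E.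
  rewrite r1 r2 r3 in H.
  rewrite /rho normrM normfV [`|e ^+ 4|]normrX ler_pdivrMr ?exprn_gt0//.
have E1 : exp2 t1 _ _ _ := exp2_sum (index_enum _) (fun j => exp2_mul (ez j) (e1 j)).
have E2 : exp2 t2 _ _ _ := exp2_sum (index_enum _) (fun j => exp2_mul (ez j)
  (exp2_sum (index_enum _) (fun k => exp2_mul (ez k) (e2 j k)))).
have E3 : exp2 t3 _ _ _ := exp2_sum (index_enum _) (fun j => exp2_mul (ez j)
  (exp2_sum (index_enum _) (fun k => exp2_mul (ez k)
    (exp2_sum (index_enum _) (fun l => exp2_mul (ez l) (e3 j k l)))))).
have E23 := exp2_add (exp2_idmul (exp2_scale 2^-1 E2))
  (exp2_idmul (exp2_idmul (exp2_scale 6^-1 E3))).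
apply: (exp2_eq (exp2_add (exp2_add E1 E23) rem)).
- move=> e e0; rewrite /rho.
  move: (t1 e) (t2 e) (t3 e) (f _) => T1 T2 T3 X.
  by field.
- by rewrite !addr0.
- rewrite !addr0; congr (_ + _).
  by apply: eq_bigr => j _; rewrite mulr0 add0r.
- rewrite addr0.
  have -> : \sum_j (a j * (lam2 * f1' j) + b j * 0 + c j * f1 j) =
      \sum_j c j * f1 j + lam2 * \sum_j a j * f1' j.
    rewrite mulr_sumr -big_split; apply: eq_bigr => j _ /=.
    by rewrite mulr0 addr0 addrC mulrCA.
  have -> : \sum_j (a j * \sum_k (a k * 0 + b k * f2 j k) + b j * \sum_k a k * f2 j k) =
      \sum_j a j * (\sum_k b k * f2 j k) + \sum_j b j * (\sum_k a k * f2 j k).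
    rewrite -big_split; apply: eq_bigr => j _ /=; congr (_ * _ + _).
    by apply: eq_bigr => k _; rewrite mulr0 add0r.
  by rewrite !addrA.
Qed.

End FieldTaylor.

(** * Periodic solutions of linear equations *)

Section PeriodicODE.
Context {R : realType}.
Implicit Types f g h : R -> R.

(** The integral from [- M] is a primitive only for [x > - M]. Two such primitives differ by a
    constant, so subtracting the value at 0 removes the dependence on [M], which may then be
    [|x| + 1]. *)
Lemma antiderivative_exists h : continuous h ->
  exists H, forall x : R, is_derive x 1 H (h x).
Proof.
move=> ch; pose mu := @lebesgue_measure R.
have ih (a b : R) : mu.-integrable `[a, b] (EFin \o h).
  apply: continuous_compact_integrable; first exact: segment_compact.
  exact: continuous_subspaceT.
pose G (M x : R) := \int[mu]_(t in `[- M, x]) h t.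
have dG (M x : R) : - M < x -> is_derive x 1 (G M) (h x).
  move=> Mx; have x1 : x < x + 1 by rewrite ltrDl.
  have [dG EG] := continuous_FTC1_closed x1 (ih (- M) (x + 1)) Mx (ch x).
  by split; [exact: dG|rewrite -derive1E; exact: EG].
have GG (M M' x : R) : M' <= M -> - M' <= x -> G M x = \int[mu]_(t in `[- M, - M']) h t + G M' x.
  move=> MM Mx; rewrite /G -(@Rintegral_itv_obnd_cbnd _ (- M')); last first.
    by apply: integrableS (ih (- M') x) => //; apply: subset_itvr; rewrite bnd_simp.
  rewrite -(@Rintegral_itvB _ _ (BLeft (- M))) ?bnd_simp ?lerN2//.
  by rewrite addrC subrK.
have GGd (M M' x : R) : 0 <= M -> 0 <= M' -> `|x| <= M -> `|x| <= M' ->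
    G M x - G M 0 = G M' x - G M' 0.
  wlog MM : M M' / M' <= M.
    move=> W M0 M'0 xM xM'; have [/W->//|/ltW MM] := leP M' M.
    by rewrite (W M' M).
  move=> M0 M'0 xM xM'; rewrite (GG M M' x)// ?(GG M M' 0)//.
  - by rewrite opprD addrACA subrr add0r.
  - by rewrite oppr_le0.
  - by have := ler_norm (- x); rewrite normrN => /le_trans/(_ xM'); rewrite lerNl.
exists (fun x => G (`|x| + 1) x - G (`|x| + 1) 0) => x.
pose M := `|x| + 1; have xM : `|x| < M by rewrite ltrDl.
have M0 : 0 <= M by rewrite addr_ge0.
apply: (@near_eq_is_derive _ _ _ (fun y => G M y - G M 0)).
  have : \forall y \near x, `|y| < M.
    have : {for x, continuous (@Num.norm R R)} by exact: norm_continuous.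
    by move=> /(_ [set y | y < M]); apply; exact: lt_nbhsl.
  by apply: filterS => y yM; apply: GGd; rewrite ?addr_ge0// ?lerDl// ltW.
have Mx : - M < x by have := ler_norm (- x); rewrite normrN => /le_lt_trans/(_ xM); rewrite ltrNl.
have := is_deriveB (dG M x Mx) (is_derive_cst (G M 0) x 1).
by rewrite subr0.
Qed.

Lemma is_derive_mulf f g (x df dg : R) : is_derive x 1 f df -> is_derive x 1 g dg ->
  is_derive x 1 (fun y => f y * g y) (df * g x + f x * dg).
Proof.
move=> hf hg; have := is_deriveM hf hg.
by rewrite addrC [g x *: df]mulrC.
Qed.

Lemma is_derive_addf f g (x df dg : R) : is_derive x 1 f df -> is_derive x 1 g dg ->
  is_derive x 1 (fun y => f y + g y) (df + dg).
Proof. by move=> hf hg; exact: is_deriveD. Qed.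

Lemma is_derive_subf f g (x df dg : R) : is_derive x 1 f df -> is_derive x 1 g dg ->
  is_derive x 1 (fun y => f y - g y) (df - dg).
Proof. by move=> hf hg; exact: is_deriveB. Qed.

Lemma is_derive_scalef f (k x df : R) : is_derive x 1 f df ->
  is_derive x 1 (fun y => k * f y) (k * df).
Proof. by move=> hf; exact: is_deriveZ. Qed.

Lemma is_derive_scale_arg f (k x df : R) : is_derive (k * x) 1 f df ->
  is_derive x 1 (fun y => f (k * y)) (k * df).
Proof.
move=> hf; have hk : is_derive x 1 (fun y : R => k * y) (k * 1).
  exact: (is_derive_scalef k (is_derive_id x 1)).
by have := @is_derive1_comp _ f (fun y => k * y) x _ _ hf hk; rewrite mulr1 mulrC.
Qed.

Lemma is_derive_translate f (x a df : R) : is_derive (x + a) 1 f df ->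
  is_derive x 1 (fun y => f (y + a)) df.
Proof.
move=> hf; have hk : is_derive x 1 (fun y : R => y + a) (1 + 0).
  exact: (is_derive_addf (is_derive_id x 1) (is_derive_cst a x 1)).
by have := @is_derive1_comp _ f (fun y => y + a) x _ _ hf hk; rewrite addr0 mulr1.
Qed.

(** Double-angle formula on the fractional part [r]: the hypothesis gives [sin (pi r) = 0], which is
    impossible for [0 < r < 1]. *)
Lemma cos_eq1_int (b : R) : cos (2 * pi * b) = 1 -> exists n : int, b = n%:~R.
Proof.
move=> cb; exists (Num.floor b); pose r := b - (Num.floor b)%:~R.
have /andP[r1 r2] := floor_itv b.
have r01 : 0 <= r < 1 by rewrite intrD in r2; rewrite subr_ge0 r1 ltrBlDl.
have pn (k : int) (s : R) : cos (2 * pi * (s + k%:~R)) = cos (2 * pi * s).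
  have pnat (n : nat) (s' : R) : cos (2 * pi * (s' + n%:R)) = cos (2 * pi * s').
    rewrite mulrDr mulr_natr mulr_natl -mulrnA.
    by have := periodicn (@cosD2pi R) n (pi *+ 2 * s'); rewrite mulrnA.
  case: k => n; first exact: pnat.
  by rewrite NegzE mulrNz -(pnat n.+1) subrK.
have cr : cos (2 * pi * r) = 1 by rewrite -[RHS]cb -(pn (Num.floor b) r) subrK.
have : sin (pi * r) = 0.
  have := cr; rewrite -mulrA mulr_natl cos_mulr2n cos2sin2.
  by move=> H; apply/eqP; rewrite -sqrf_eq0; apply/eqP; move: H; lra.
move=> s0; have [r0|r0] := eqVneq r 0; first by apply/eqP; rewrite -subr_eq0 -/r r0.
have : 0 < sin (pi * r); last by rewrite s0 ltxx.
have /andP[ra rb] := r01; apply: sin_gt0_pi; apply/andP; split.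
  by rewrite mulr_gt0 ?pi_gt0// lt0r r0.
by rewrite gtr_pMr// pi_gt0.
Qed.

(** In complex form: translating the variation-of-constants integrand [e^(- mu x) f] by one period
    divides it by the multiplier [p (c + i s)]. Here [e, C, S] are the values at the point and
    [p, c, s] those over a period. *)
Lemma rotation_shift (e p c s C S f g : R) : e != 0 -> p != 0 -> c ^+ 2 + s ^+ 2 = 1 ->
  p * (c * ((e * p)^-1 * ((C * c - S * s) * f + (S * c + C * s) * g))
     - s * ((e * p)^-1 * ((C * c - S * s) * g - (S * c + C * s) * f)))
    - e^-1 * (C * f + S * g) = 0 /\
  p * (s * ((e * p)^-1 * ((C * c - S * s) * f + (S * c + C * s) * g))
     + c * ((e * p)^-1 * ((C * c - S * s) * g - (S * c + C * s) * f)))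
    - e^-1 * (C * g - S * f) = 0.
Proof.
move=> e0 p0 cs; split.
  transitivity ((c ^+ 2 + s ^+ 2 - 1) * (e^-1 * (C * f + S * g))).
    by field; rewrite p0 e0.
  by rewrite cs subrr mul0r.
transitivity ((c ^+ 2 + s ^+ 2 - 1) * (e^-1 * (C * g - S * f))).
  by field; rewrite p0 e0.
by rewrite cs subrr mul0r.
Qed.

(** This is y' = mu y + F with mu = a + i b and F = f + i g, in real coordinates. Variation of
    constants gives y = e^(mu x) (c + H) with H' = e^(- mu x) F. For T = 2 pi the quantity e^(mu T)
    H(x + T) - H(x) is a constant k, and periodicity of y amounts to (e^(mu T) - 1) c + k = 0,
    solvable unless a = 0 and b is an integer. *)
Lemma periodic_ode_exists (a b : R) f g :
  (a != 0 \/ forall n : int, b != n%:~R) -> continuous f -> continuous g ->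
  periodic2pi f -> periodic2pi g ->
  exists u w : R -> R, [/\ forall x : R, is_derive x 1 u (a * u x - b * w x + f x),
    forall x : R, is_derive x 1 w (b * u x + a * w x + g x), periodic2pi u & periodic2pi w].
Proof.
move=> nonres cf cg pf pg.
pose E x := expR (a * x); pose C x := cos (b * x); pose S x := sin (b * x).
have dE (x : R) : is_derive x 1 E (a * E x) by exact: is_derive_scale_arg.
have dC (x : R) : is_derive x 1 C (b * - S x) by exact: is_derive_scale_arg.
have dS (x : R) : is_derive x 1 S (b * C x) by exact: is_derive_scale_arg.
have cont (h dh : R -> R) : (forall x : R, is_derive x 1 h (dh x)) -> continuous h.
  by move=> H x; apply/differentiable_continuous/derivable1_diffP; have [] := H x.
have E0 x : E x != 0 by rewrite gt_eqF// expR_gt0.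
have CS x : C x ^+ 2 + S x ^+ 2 = 1 by exact: cos2Dsin2.
have ED x y : E (x + y) = E x * E y by rewrite /E mulrDr expRD.
have CD x y : C (x + y) = C x * C y - S x * S y by rewrite /C mulrDr cosD.
have SD x y : S (x + y) = S x * C y + C x * S y by rewrite /S mulrDr sinD.
pose h1 x := (E x)^-1 * (C x * f x + S x * g x).
pose h2 x := (E x)^-1 * (C x * g x - S x * f x).
have cE1 : continuous (fun x => (E x)^-1).
  by move=> x; apply: cvgV => //; exact: cont.
have cC := cont _ _ dC; have cS := cont _ _ dS.
have [H1 dH1] : exists H1, forall x : R, is_derive x 1 H1 (h1 x).
  apply: antiderivative_exists => x; apply: (cvgM (cE1 x)).
  by apply: cvgD; [exact: (cvgM (cC x) (cf x))|exact: (cvgM (cS x) (cg x))].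
have [H2 dH2] : exists H2, forall x : R, is_derive x 1 H2 (h2 x).
  apply: antiderivative_exists => x; apply: (cvgM (cE1 x)).
  by apply: cvgB; [exact: (cvgM (cC x) (cg x))|exact: (cvgM (cS x) (cf x))].
pose T : R := 2 * pi; pose p := E T; pose c := C T; pose s := S T.
have cs : c ^+ 2 + s ^+ 2 = 1 by exact: CS.
(* Real part of the constant k: its derivative in [x] vanishes by [rotation_shift]. *)
have per1 x : p * (c * H1 (x + T) - s * H2 (x + T)) - H1 x =
    p * (c * H1 (0 + T) - s * H2 (0 + T)) - H1 0.
  apply: (is_derive_0_is_cst (f := fun x => p * (c * H1 (x + T) - s * H2 (x + T)) - H1 x)) => y.
  have := is_derive_subf (is_derive_scalef p (is_derive_subf
    (is_derive_scalef c (is_derive_translate (dH1 (y + T))))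
    (is_derive_scalef s (is_derive_translate (dH2 (y + T)))))) (dH1 y).
  suff -> : p * (c * h1 (y + T) - s * h2 (y + T)) - h1 y = 0 by [].
  rewrite /h1 /h2 pf pg ED CD SD -/p -/c -/s.
  have p0 : p != 0 by exact: E0.
  exact: (rotation_shift _ _ _ _ (E0 y) p0 cs).1.
have per2 x : p * (s * H1 (x + T) + c * H2 (x + T)) - H2 x =
    p * (s * H1 (0 + T) + c * H2 (0 + T)) - H2 0.
  apply: (is_derive_0_is_cst (f := fun x => p * (s * H1 (x + T) + c * H2 (x + T)) - H2 x)) => y.
  have := is_derive_subf (is_derive_scalef p (is_derive_addf
    (is_derive_scalef s (is_derive_translate (dH1 (y + T))))
    (is_derive_scalef c (is_derive_translate (dH2 (y + T)))))) (dH2 y).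
  suff -> : p * (s * h1 (y + T) + c * h2 (y + T)) - h2 y = 0 by [].
  rewrite /h1 /h2 pf pg ED CD SD -/p -/c -/s.
  have p0 : p != 0 by exact: E0.
  exact: (rotation_shift _ _ _ _ (E0 y) p0 cs).2.
set k1 := _ - H1 0 in per1; set k2 := _ - H2 0 in per2.
(* [A + i B] is e^(mu T) - 1. *)
pose A := p * c - 1; pose B := p * s.
have AB : A ^+ 2 + B ^+ 2 != 0.
  have p0 : 0 < p by exact: expR_gt0.
  have c_le1 : c <= 1 by exact: cos_le1.
  (* As a sum of two nonnegative terms the squared modulus vanishes only if [p = 1] and [c = 1],
     that is, if [a = 0] and [b] is an integer. *)
  have -> : A ^+ 2 + B ^+ 2 = (p - 1) ^+ 2 + 2 * p * (1 - c).
    by rewrite /A /B; transitivity (p ^+ 2 * (c ^+ 2 + s ^+ 2) - 2 * p * c + 1);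
      [ring|rewrite cs; ring].
  have q0 : 0 <= 2 * p * (1 - c) by apply: mulr_ge0; rewrite ?subr_ge0// mulr_ge0// ltW.
  rewrite paddr_eq0 ?sqr_ge0// sqrf_eq0 subr_eq0; apply/negP => /andP[/eqP p1].
  rewrite mulf_eq0 gt_eqF ?mulr_gt0//= subr_eq0 => /eqP c1.
  case: nonres => [a0|bn].
    have : expR (a * T) = expR 0 by rewrite expR0 -p1.
    move=> /expR_inj/eqP; rewrite mulf_eq0 (negbTE a0)/= /T gt_eqF//.
    by rewrite mulr_gt0// pi_gt0.
  have [n bE] : exists n : int, b = n%:~R.
    by apply: cos_eq1_int; rewrite -/T mulrC -[LHS]/c.
  by have := bn n; rewrite bE eqxx.
(* [c1 + i c2] is the complex quotient [- (k1 + i k2) / (A + i B)]. *)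
pose c1 := - (A * k1 + B * k2) / (A ^+ 2 + B ^+ 2).
pose c2 := - (A * k2 - B * k1) / (A ^+ 2 + B ^+ 2).
have c1E : p * (c * c1 - s * c2) - c1 + k1 = 0.
  rewrite (_ : _ + k1 = A * c1 - B * c2 + k1); last by rewrite /A /B; ring.
  by rewrite /c1 /c2; field.
have c2E : p * (s * c1 + c * c2) - c2 + k2 = 0.
  rewrite (_ : _ + k2 = B * c1 + A * c2 + k2); last by rewrite /A /B; ring.
  by rewrite /c1 /c2; field.
exists (fun x => E x * (C x * (c1 + H1 x) - S x * (c2 + H2 x))).
exists (fun x => E x * (S x * (c1 + H1 x) + C x * (c2 + H2 x))).
have dc1 (x : R) : is_derive x 1 (fun x => c1 + H1 x) (0 + h1 x).
  exact: (is_derive_addf (is_derive_cst c1 x 1) (dH1 x)).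
have dc2 (x : R) : is_derive x 1 (fun x => c2 + H2 x) (0 + h2 x).
  exact: (is_derive_addf (is_derive_cst c2 x 1) (dH2 x)).
have shift1 x : p * (c * (c1 + H1 (x + T)) - s * (c2 + H2 (x + T))) = c1 + H1 x.
  by move: (per1 x) c1E; lra.
have shift2 x : p * (s * (c1 + H1 (x + T)) + c * (c2 + H2 (x + T))) = c2 + H2 x.
  by move: (per2 x) c2E; lra.
split.
- move=> x; apply: is_derive_eq (is_derive_mulf (dE x) (is_derive_subf
    (is_derive_mulf (dC x) (dc1 x)) (is_derive_mulf (dS x) (dc2 x)))) _.
  rewrite -[f x]mul1r -(CS x) /h1 /h2.
  move: (E x) (E0 x) (C x) (S x) (H1 x) (H2 x) => Ex Ex0 Cx Sx H1x H2x.
  by field.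
- move=> x; apply: is_derive_eq (is_derive_mulf (dE x) (is_derive_addf
    (is_derive_mulf (dS x) (dc1 x)) (is_derive_mulf (dC x) (dc2 x)))) _.
  rewrite -[g x]mul1r -(CS x) /h1 /h2.
  move: (E x) (E0 x) (C x) (S x) (H1 x) (H2 x) => Ex Ex0 Cx Sx H1x H2x.
  by field.
- move=> x; rewrite -/T ED CD SD -/p -/c -/s -(shift1 x) -(shift2 x); ring.
- move=> x; rewrite -/T ED CD SD -/p -/c -/s -(shift1 x) -(shift2 x); ring.
Qed.

End PeriodicODE.

(** * Smooth periodic complex-valued functions *)

Section ComplexFunctions.
Context {R : realType}.
Local Notation C := R[i].
Implicit Types f g : R -> C.
Local Notation Re := (@complex.Re R).
Local Notation Im := (@complex.Im R).

Lemma derive1_smooth (u du : R -> R) k : (forall x : R, is_derive x 1 u (du x)) ->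
  Ck_on k setT du -> Ck_on k.+1 setT u.
Proof.
move=> hu Cdu; split=> [x _|v].
  by apply/derivable1_diffP; have [] := hu x.
apply: (@Ck_on_ext _ _ _ _ _ (fun x => v * du x)) => //; first exact: openT.
  move=> x _; have dx : differentiable u x by apply/derivable1_diffP; have [] := hu x.
  by rewrite deriveE// diff1E//= derive1E; have [_ ->] := hu x.
by apply: Ck_onM => //; [exact: openT|exact: Ck_on_cst].
Qed.

Definition smooth_periodic (u : R -> R) := smooth_on setT u /\ periodic2pi u.

(** Real and imaginary parts are kept apart so that the real calculus applies to each of them. *)
Definition csmooth f := smooth_periodic (fun x => Re (f x)) /\ smooth_periodic (fun x => Im (f x)).

Definition cderive f g := forall x : R,
  is_derive x 1 (fun x => Re (f x)) (Re (g x)) /\ is_derive x 1 (fun x => Im (f x)) (Im (g x)).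

Lemma smooth_periodicD (u v : R -> R) : smooth_periodic u -> smooth_periodic v ->
  smooth_periodic (fun x => u x + v x).
Proof.
move=> [su pu] [sv pv]; split=> [k|t]; last by rewrite pu pv.
by apply: Ck_onD; [exact: openT|exact: su|exact: sv].
Qed.

Lemma smooth_periodicZ (c : R) (u : R -> R) : smooth_periodic u ->
  smooth_periodic (fun x => c * u x).
Proof.
move=> [su pu]; split=> [k|t]; last by rewrite pu.
by apply: Ck_onM; [exact: openT|exact: Ck_on_cst|exact: su].
Qed.

Lemma smooth_periodic_eq (u v : R -> R) : (forall x, u x = v x) ->
  smooth_periodic u -> smooth_periodic v.
Proof. by move=> /funext ->. Qed.

Lemma complexReD (z w : C) : Re (z + w) = Re z + Re w. Proof. by case: z w => [? ?] []. Qed.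
Lemma complexImD (z w : C) : Im (z + w) = Im z + Im w. Proof. by case: z w => [? ?] []. Qed.
Lemma complexReM (z w : C) : Re (z * w) = Re z * Re w - Im z * Im w.
Proof. by case: z w => [? ?] []. Qed.
Lemma complexImM (z w : C) : Im (z * w) = Re z * Im w + Im z * Re w.
Proof. by case: z w => [? ?] []. Qed.

Lemma csmoothD f g : csmooth f -> csmooth g -> csmooth (fun x => f x + g x).
Proof.
move=> [rf jf] [rg jg]; split.
  by apply: smooth_periodic_eq (smooth_periodicD rf rg) => x; rewrite complexReD.
by apply: smooth_periodic_eq (smooth_periodicD jf jg) => x; rewrite complexImD.
Qed.

Lemma csmoothZ (c : C) f : csmooth f -> csmooth (fun x => c * f x).
Proof.
move=> [rf jf]; split.
  apply: smooth_periodic_eq (smooth_periodicD (smooth_periodicZ (Re c) rf)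
    (smooth_periodicZ (- Im c) jf)) => x; by rewrite complexReM mulNr.
apply: smooth_periodic_eq (smooth_periodicD (smooth_periodicZ (Re c) jf)
    (smooth_periodicZ (Im c) rf)) => x; by rewrite complexImM.
Qed.

Lemma smooth_periodic0 : smooth_periodic (fun=> 0 : R).
Proof. by split=> // k; exact: Ck_on_cst. Qed.

Lemma csmooth0 : csmooth (fun=> 0).
Proof. by split; exact: smooth_periodic0. Qed.

Lemma csmooth_sum (I : Type) (s : seq I) (f : I -> R -> C) :
  (forall i, csmooth (f i)) -> csmooth (fun x => \sum_(i <- s) f i x).
Proof.
move=> sf; elim: s => [|i s IH].
  by rewrite (_ : (fun _ => _) = fun=> 0); [exact: csmooth0|apply/funext => x; rewrite big_nil].
rewrite (_ : (fun _ => _) = fun x => f i x + \sum_(j <- s) f j x); first exact: csmoothD.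
by apply/funext => x; rewrite big_cons.
Qed.

Lemma cderiveD f g df dg : cderive f df -> cderive g dg ->
  cderive (fun x => f x + g x) (fun x => df x + dg x).
Proof.
move=> hf hg x; have [rf jf] := hf x; have [rg jg] := hg x; split.
  have -> : (fun x => Re (f x + g x)) = (fun x => Re (f x) + Re (g x)).
    by apply/funext => y; rewrite complexReD.
  by rewrite complexReD; exact: is_derive_addf.
have -> : (fun x => Im (f x + g x)) = (fun x => Im (f x) + Im (g x)).
  by apply/funext => y; rewrite complexImD.
by rewrite complexImD; exact: is_derive_addf.
Qed.

Lemma cderiveZ c f df : cderive f df -> cderive (fun x => c * f x) (fun x => c * df x).
Proof.
move=> hf x; have [rf jf] := hf x; split.
  have -> : (fun x => Re (c * f x)) = (fun x => Re c * Re (f x) - Im c * Im (f x)).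
    by apply/funext => y; rewrite complexReM.
  by rewrite complexReM; apply: is_derive_subf; exact: is_derive_scalef.
have -> : (fun x => Im (c * f x)) = (fun x => Re c * Im (f x) + Im c * Re (f x)).
  by apply/funext => y; rewrite complexImM.
by rewrite complexImM; apply: is_derive_addf; exact: is_derive_scalef.
Qed.

Lemma cderive0 : cderive (fun=> 0) (fun=> 0).
Proof. by move=> x; split; exact: is_derive_cst. Qed.

Lemma cderive_sum (I : Type) (s : seq I) (f df : I -> R -> C) :
  (forall i, cderive (f i) (df i)) ->
  cderive (fun x => \sum_(i <- s) f i x) (fun x => \sum_(i <- s) df i x).
Proof.
move=> hf; elim: s => [|i s IH].
  rewrite (_ : (fun _ => _) = fun=> 0); last by apply/funext => x; rewrite big_nil.
  rewrite (_ : (fun _ => _) = fun=> 0); first exact: cderive0.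
  by apply/funext => x; rewrite big_nil.
rewrite (_ : (fun _ => _) = fun x => f i x + \sum_(j <- s) f j x); last first.
  by apply/funext => x; rewrite big_cons.
rewrite [X in cderive _ X](_ : _ = fun x => df i x + \sum_(j <- s) df j x); last first.
  by apply/funext => x; rewrite big_cons.
exact: cderiveD.
Qed.

(** Smoothness is bootstrapped: the equation expresses the derivatives of [u] and [w] through [u],
    [w] and the smooth [f], so each degree of smoothness yields the next. *)
Lemma csolve (mu : C) f : (Re mu != 0 \/ forall n : int, Im mu != n%:~R) ->
  csmooth f -> exists2 y, csmooth y & cderive y (fun x => mu * y x + f x).
Proof.
move=> nr [[sr pr] [si pi_]].
have cont (u : R -> R) : smooth_on setT u -> continuous u.
  by move=> su x; exact: (smooth_on_cont su).
have [u [w [hu hw pu pw]]] := periodic_ode_exists nr (cont _ sr) (cont _ si) pr pi_.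
have smooth k : Ck_on k setT u /\ Ck_on k setT w.
  have oT := @openT R; elim: k => [|k [Cu Cw]].
    split=> x _; apply/differentiable_continuous/derivable1_diffP.
      by have [] := hu x.
    by have [] := hw x.
  have lin c (h : R -> R) : Ck_on k setT h -> Ck_on k setT (fun x => c * h x).
    by move=> Ch; apply: Ck_onM => //; exact: Ck_on_cst.
  split.
    apply: (derive1_smooth hu); apply: (Ck_onD oT _ (sr k)).
    by apply: Ck_onB => //; exact: lin.
  apply: (derive1_smooth hw); apply: (Ck_onD oT _ (si k)).
  by apply: Ck_onD => //; exact: lin.
exists (fun x => u x +i* w x)%C.
  by split; split=> //= k; [exact: (smooth k).1|exact: (smooth k).2].
move=> x; split; rewrite ?complexReD ?complexImD ?complexReM ?complexImM/=; first exact: hu.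
by rewrite [_ * w x + _]addrC; exact: hw.
Qed.

End ComplexFunctions.

(** * The hyperbolic block and the rotation block *)

Section Blocks.
Context {R : realType}.
Local Notation C := R[i].
Local Notation Re := (@complex.Re R).
Local Notation Im := (@complex.Im R).

Definition vsmooth n (x : R -> 'cV[C]_n) := forall i, csmooth (fun t => x t i 0).
Definition vderive n (x dx : R -> 'cV[C]_n) :=
  forall i, cderive (fun t => x t i 0) (fun t => dx t i 0).

Lemma vsmooth_mul n p (M : 'M[C]_(n, p)) x : vsmooth x -> vsmooth (fun t => M *m x t).
Proof.
move=> sx i; have -> : (fun t => (M *m x t) i 0) = (fun t => \sum_j M i j * x t j 0).
  by apply/funext => t; rewrite mxE.
by apply: csmooth_sum => j; exact: csmoothZ.
Qed.

Lemma vderive_mul n p (M : 'M[C]_(n, p)) x dx : vderive x dx ->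
  vderive (fun t => M *m x t) (fun t => M *m dx t).
Proof.
move=> hx i; have -> : (fun t => (M *m x t) i 0) = (fun t => \sum_j M i j * x t j 0).
  by apply/funext => t; rewrite mxE.
have -> : (fun t => (M *m dx t) i 0) = (fun t => \sum_j M i j * dx t j 0).
  by apply/funext => t; rewrite mxE.
by apply: cderive_sum => j; exact: cderiveZ.
Qed.

Lemma vsmoothB n (x y : R -> 'cV[C]_n) : vsmooth x -> vsmooth y -> vsmooth (fun t => x t - y t).
Proof.
move=> sx sy i.
have -> : (fun t => (x t - y t) i 0) = (fun t => x t i 0 + -1 * y t i 0).
  by apply/funext => t; rewrite !mxE mulN1r.
by apply: csmoothD => //; exact: csmoothZ.
Qed.

Lemma vderiveB n (x y dx dy : R -> 'cV[C]_n) : vderive x dx -> vderive y dy ->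
  vderive (fun t => x t - y t) (fun t => dx t - dy t).
Proof.
move=> sx sy i.
have -> : (fun t => (x t - y t) i 0) = (fun t => x t i 0 + -1 * y t i 0).
  by apply/funext => t; rewrite !mxE mulN1r.
have -> : (fun t => (dx t - dy t) i 0) = (fun t => dx t i 0 + -1 * dy t i 0).
  by apply/funext => t; rewrite !mxE mulN1r.
by apply: cderiveD => //; exact: cderiveZ.
Qed.

(** The product of the factors [A - mu], kept as a fold so that the solver can treat one eigenvalue
    at a time. *)
Definition annihilator n (A : 'M[C]_n) (s : seq C) : 'M[C]_n :=
  foldr (fun mu M => (A - mu%:M) *m M) 1%:M s.

Lemma annihilator_char_poly n (A : 'M[C]_n) : exists2 s : seq C,
  annihilator A s = 0 & forall mu, mu \in s -> eigenvalue A mu.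
Proof.
case: n A => [|n] A; first by exists [::] => //; exact: flatmx0.
have [s sE] := closed_field_poly_normal (char_poly A).
rewrite (monicP (char_poly_monic A)) scale1r in sE.
exists s => [|mu mus]; last first.
  by rewrite eigenvalue_root_char sE root_prod_XsubC.
rewrite -(Cayley_Hamilton A) sE; elim: {sE} s => [|mu s IH] /=.
  by rewrite big_nil [RHS]rmorph1.
rewrite big_cons IH.
have hM p q : horner_mx A (p * q) = horner_mx A p *m horner_mx A q by exact: rmorphM.
by rewrite hM rmorphB /= horner_mx_X horner_mx_C.
Qed.

(* If y = (L - mu) y', with L = d/dt + c, then
   M y = M (L - mu) y' = (A - mu) M y' - (A - L) M y' for M commuting with A:
   each root mu of the characteristic polynomial of A pushes one factor A - mu
   onto the defect, which vanishes in the end by Cayley-Hamilton. *)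
Lemma hyperbolic_solve n (A : 'M[C]_n) (c : C) f :
  (forall mu, eigenvalue A mu -> Re (mu - c) != 0) -> vsmooth f ->
  exists x dx, [/\ vsmooth x, vderive x dx &
    forall t, A *m x t - dx t - c *: x t = f t].
Proof.
move=> hA sf; have [s As0 eigs] := annihilator_char_poly A.
suff [x [dx [y [sx hx _ E]]]] : exists x dx y, [/\ vsmooth x, vderive x dx, vsmooth y &
    forall t, A *m x t - dx t - c *: x t = f t - annihilator A s *m y t].
  by exists x, dx; split=> // t; rewrite E As0 mul0mx subr0.
elim: s eigs {As0} => [|mu s IH] eigs.
  exists (fun=> 0), (fun=> 0), f; split=> //.
  - by move=> i; rewrite (_ : (fun _ => _) = fun=> 0); [exact: csmooth0|apply/funext => t; rewrite mxE].
  - by move=> i; rewrite (_ : (fun _ => _) = fun=> 0); [exact: cderive0|apply/funext => t; rewrite mxE].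
  - by move=> t; rewrite /= mulmx0 scaler0 mul1mx !subrr.
have [|x [dx [y [sx hx sy E]]]] := IH; first by move=> nu nus; apply: eigs; rewrite inE nus orbT.
have /choice[y' y'P] : forall i, exists y' : R -> C, csmooth y' /\
    cderive y' (fun t => (mu - c) * y' t + y t i 0).
  move=> i; have [|y' sy' hy'] := @csolve R (mu - c) _ _ (sy i); last by exists y'.
  by left; apply/hA/eigs; rewrite inE eqxx.
pose Y t : 'cV[C]_n := \col_i y' i t.
pose dY t : 'cV[C]_n := (mu - c) *: Y t + y t.
have sY : vsmooth Y.
  move=> i; rewrite (_ : (fun _ => _) = y' i); first by have [] := y'P i.
  by apply/funext => t; rewrite mxE.
have hY : vderive Y dY.
  move=> i; rewrite (_ : (fun t => Y t i 0) = y' i); last by apply/funext => t; rewrite mxE.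
  rewrite (_ : (fun t => dY t i 0) = fun t => (mu - c) * y' i t + y t i 0).
    by have [] := y'P i.
  by apply/funext => t; rewrite !mxE.
pose M := annihilator A s.
exists (fun t => x t - M *m Y t), (fun t => dx t - M *m dY t), Y; split=> //.
- by apply: vsmoothB => //; exact: vsmooth_mul.
- by apply: vderiveB => //; exact: vderive_mul.
move=> t.
have -> : A *m (x t - M *m Y t) - (dx t - M *m dY t) - c *: (x t - M *m Y t) =
    (A *m x t - dx t - c *: x t) - (A *m M *m Y t - M *m dY t - c *: (M *m Y t)).
  rewrite mulmxBr scalerBr mulmxA.
  by apply/matrixP => i j; rewrite !mxE; ring.
rewrite E /= /dY mulmxDr -scalemxAr -/M -!mulmxA mulmxBl mul_scalar_mx.
move: (A *m (M *m Y t)) (M *m Y t) (M *m y t) => V1 V2 V3.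
by apply/matrixP => i j; rewrite !mxE; ring.
Qed.

Definition cI : C := (0 +i* 1)%C.

Lemma cI_sqr : cI * cI = -1.
Proof. by apply/eqP; rewrite eq_complex /=; apply/andP; split; apply/eqP; ring. Qed.

(** [x0 + i x1] and [x0 - i x1] diagonalise the rotation block, with eigenvalues [i om] and
    [- i om]. The identity for [xp] is exported because this component becomes resonant in mode 1,
    where its mean must be controlled. *)
Lemma rotation_solve (om c : C) (xp xm f0 f1 : R -> C) :
  csmooth xp -> csmooth xm ->
  cderive xp (fun t => (cI * om - c) * xp t - (f0 t + cI * f1 t)) ->
  cderive xm (fun t => (- (cI * om) - c) * xm t - (f0 t - cI * f1 t)) ->
  exists x0 x1 dx0 dx1, [/\ csmooth x0 /\ csmooth x1, cderive x0 dx0, cderive x1 dx1,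
    forall t, - om * x1 t - dx0 t - c * x0 t = f0 t /\
      om * x0 t - dx1 t - c * x1 t = f1 t
    & forall t, x0 t + cI * x1 t = xp t].
Proof.
move=> sp sm hp hm.
pose dp t := (cI * om - c) * xp t - (f0 t + cI * f1 t).
pose dm t := (- (cI * om) - c) * xm t - (f0 t - cI * f1 t).
exists (fun t => 2^-1 * xp t + 2^-1 * xm t), (fun t => (- cI / 2) * xp t + (cI / 2) * xm t).
exists (fun t => 2^-1 * dp t + 2^-1 * dm t), (fun t => (- cI / 2) * dp t + (cI / 2) * dm t).
have JJ := cI_sqr; split.
- by split; apply: csmoothD; exact: csmoothZ.
- by apply: cderiveD; exact: cderiveZ.
- by apply: cderiveD; exact: cderiveZ.
- move=> t; rewrite /dp /dm; split; first by field.
  transitivity (om * (1 + cI * cI) / 2 * (xp t + xm t) - cI * cI * f1 t); first by field.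
  by rewrite JJ; ring.
- move=> t; transitivity ((1 - cI * cI) / 2 * xp t + (1 + cI * cI) / 2 * xm t); first by field.
  by rewrite JJ; field.
Qed.

Lemma rot_blockE (a b : R) : [/\ rot_block a b 0 0 = a, rot_block a b 0 1 = - b,
  rot_block a b 1 0 = b & rot_block a b 1 1 = a].
Proof.
have e0 : 0 = lshift 1 0 :> 'I_(1 + 1) by apply: val_inj.
have e1 : 1 = rshift 1 0 :> 'I_(1 + 1) by apply: val_inj.
rewrite /rot_block; split; rewrite ?e0 ?e1.
- by apply: etrans (block_mxEul _ _ _ _ _ _) _; rewrite mxE eqxx mulr1n.
- by apply: etrans (block_mxEur _ _ _ _ _ _) _; rewrite mxE eqxx mulr1n.
- by apply: etrans (block_mxEdl _ _ _ _ _ _) _; rewrite mxE eqxx mulr1n.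
- by apply: etrans (block_mxEdr _ _ _ _ _ _) _; rewrite mxE eqxx mulr1n.
Qed.

Lemma floquet_block_solve m (om : R) (Et : 'M[R]_m) (c : C) f (xp xm : R -> C) :
  (forall mu, ceigenvalue Et mu -> Re (mu - c) != 0) -> vsmooth f ->
  csmooth xp -> csmooth xm ->
  cderive xp (fun t => (cI * (om%:C)%C - c) * xp t
    - (f t (lshift m 0) 0 + cI * f t (lshift m 1) 0)) ->
  cderive xm (fun t => (- (cI * (om%:C)%C) - c) * xm t
    - (f t (lshift m 0) 0 - cI * f t (lshift m 1) 0)) ->
  exists x dx, [/\ vsmooth x, vderive x dx,
    forall t, map_mx (real_complex R) (Emat 0 om Et) *m x t - dx t - c *: x t = f t
    & forall t, x t (lshift m 0) 0 + cI * x t (lshift m 1) 0 = xp t].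
Proof.
move=> hE sf sp sm hp hm.
have [x0 [x1 [dx0 [dx1 [[s0 s1] h0 h1 E01 Exp]]]]] := rotation_solve sp sm hp hm.
have sd : vsmooth (fun t => dsubmx (f t) : 'cV[C]_m).
  move=> i; have -> : (fun t => (dsubmx (f t)) i 0) = (fun t => f t (rshift 2 i) 0).
    by apply/funext => t; rewrite mxE.
  exact: sf.
have [y [dy [sy hy Ey]]] := hyperbolic_solve hE sd.
pose pr (u0 u1 : R -> C) t : 'cV[C]_2 := \col_i (if i == 0 then u0 t else u1 t).
exists (fun t => col_mx (pr x0 x1 t) (y t)), (fun t => col_mx (pr dx0 dx1 t) (dy t)).
have colE (u0 u1 : R -> C) (z : R -> 'cV[C]_m) i :
    (exists2 j, i = rshift 2 j & (fun t => col_mx (pr u0 u1 t) (z t) i 0) = (fun t => z t j 0))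
    \/ (exists2 j : 'I_2, i = lshift m j & (fun t => col_mx (pr u0 u1 t) (z t) i 0) =
       if j == 0 then u0 else u1).
  case: (split_ordP i) => j ->; last first.
    by left; exists j => //; apply/funext => t; rewrite col_mxEd.
  by right; exists j => //; apply/funext => t; rewrite col_mxEu mxE; case: (j == 0).
split.
- by move=> i; case: (colE x0 x1 y i) => -[j _ ->] //; case: (j == 0).
- move=> i; case: (split_ordP i) => j ->.
    rewrite (_ : (fun t => col_mx (pr x0 x1 t) (y t) _ _) = if j == 0 then x0 else x1); last first.
      by apply/funext => t; rewrite col_mxEu mxE; case: (j == 0).
    rewrite (_ : (fun t => col_mx (pr dx0 dx1 t) (dy t) _ _) = if j == 0 then dx0 else dx1); last first.
      by apply/funext => t; rewrite col_mxEu mxE; case: (j == 0).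
    by case: (j == 0).
  rewrite (_ : (fun t => col_mx (pr x0 x1 t) (y t) _ _) = fun t => y t j 0); last first.
    by apply/funext => t; rewrite col_mxEd.
  rewrite (_ : (fun t => col_mx (pr dx0 dx1 t) (dy t) _ _) = fun t => dy t j 0)//.
  by apply/funext => t; rewrite col_mxEd.
- move=> t; rewrite /Emat map_block_mx !map_mx0 mul_block_col !mul0mx addr0 add0r.
  rewrite opp_col_mx add_col_mx scale_col_mx opp_col_mx add_col_mx Ey.
  rewrite -[RHS]vsubmxK; congr col_mx.
  have [r00 r01 r10 r11] := rot_blockE 0 om; have [E0 E1] := E01 t.
  move: (rot_block 0 om) r00 r01 r10 r11 => B r00 r01 r10 r11.
  have l01 : lift ord0 ord0 = 1 :> 'I_2 by apply: val_inj.
  apply/colP => -[[|[|//]] lti].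
    have -> : Ordinal lti = 0 by apply: val_inj.
    rewrite !mxE big_ord_recl big_ord1 !mxE l01 r00 r01 /= -E0.
    by rewrite mul0r add0r rmorphN.
  have -> : Ordinal lti = 1 by apply: val_inj.
  rewrite !mxE big_ord_recl big_ord1 !mxE l01 r10 r11 /= -E1.
  by rewrite mul0r addr0.
- move=> t; rewrite !col_mxEu !mxE/=; exact: Exp.
Qed.

End Blocks.

(** * The equation of a single phi-mode *)

Section Modes.
Context {R : realType}.
Local Notation C := R[i].
Local Notation Re := (@complex.Re R).
Local Notation Im := (@complex.Im R).
Local Notation mean u := (\int[lebesgue_measure]_(t in `[0, 2 * pi]) u t : R).

Lemma tpi_gt0 : 0 < 2 * pi :> R.
Proof. by rewrite mulr_gt0// pi_gt0. Qed.

Lemma is_derive_continuous (f df : R -> R) :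
  (forall x : R, is_derive x 1 f (df x)) -> continuous f.
Proof.
by move=> hf x; apply/differentiable_continuous/derivable1_diffP; have [] := hf x.
Qed.

Lemma smooth_continuous (f : R -> R) : smooth_on setT f -> continuous f.
Proof. by move=> sf x; exact: (smooth_on_cont sf). Qed.

Lemma Rintegral_derive (F f : R -> R) (a b : R) : a < b ->
  (forall x : R, is_derive x 1 F (f x)) -> continuous f ->
  \int[lebesgue_measure]_(t in `[a, b]) f t = F b - F a.
Proof.
move=> ab dF cf; have cF := is_derive_continuous dF.
rewrite /Rintegral (continuous_FTC2 ab (F := F))//.
- exact: continuous_subspaceT.
- split=> [x _||]; first by have [] := dF x.
    exact: (cvg_at_right_filter (cF a)).
  exact: (cvg_at_left_filter (cF b)).
- by move=> x _; rewrite derive1E; have [_] := dF x.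
Qed.

Lemma integrable_continuous (f : R -> R) (a b : R) : continuous f ->
  lebesgue_measure.-integrable `[a, b] (EFin \o f).
Proof.
move=> cf; apply: continuous_compact_integrable; first exact: segment_compact.
exact: continuous_subspaceT.
Qed.

Lemma mean_cst (c : R) : mean (fun=> c) = c * (2 * pi).
Proof.
have dc (x : R) : is_derive x 1 (fun x => c * x) c.
  by have := is_derive_scalef c (is_derive_id x 1); rewrite mulr1.
by rewrite (Rintegral_derive tpi_gt0 dc (@cst_continuous _ _ c)) mulr0 subr0.
Qed.

Lemma meanB (f g : R -> R) : continuous f -> continuous g ->
  mean (fun t => f t - g t) = mean f - mean g.
Proof. by move=> cf cg; rewrite RintegralB//; exact: integrable_continuous. Qed.

Lemma meanD (f g : R -> R) : continuous f -> continuous g ->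
  mean (fun t => f t + g t) = mean f + mean g.
Proof. by move=> cf cg; rewrite RintegralD//; exact: integrable_continuous. Qed.

Lemma meanZ (k : R) (f : R -> R) : continuous f -> mean (fun t => k * f t) = k * mean f.
Proof. by move=> cf; rewrite RintegralZl//; exact: integrable_continuous. Qed.

(** The vanishing mean makes antiderivatives periodic, and subtracting the mean of one of them uses
    up the free constant. *)
Lemma zero_mean_antiderivative (u : R -> R) : smooth_periodic u -> mean u = 0 ->
  exists y, [/\ smooth_periodic y, forall x : R, is_derive x 1 y (u x) & mean y = 0].
Proof.
move=> [su pu] u0; have cu := smooth_continuous su.
have [H dH] := antiderivative_exists cu; have cH := is_derive_continuous dH.
have HT : H (2 * pi) = H 0.
  by apply/eqP; rewrite -subr_eq0 -(Rintegral_derive tpi_gt0 dH cu) u0.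
pose c := (2 * pi)^-1 * mean H.
have dy (x : R) : is_derive x 1 (fun x => H x - c) (u x).
  by have := is_derive_subf (dH x) (is_derive_cst c x 1); rewrite subr0.
exists (fun x => H x - c); split=> //; last first.
  rewrite meanB//; last exact: cst_continuous.
  by rewrite mean_cst /c mulrAC mulVf ?mul1r ?subrr// gt_eqF// tpi_gt0.
split=> [[|k]|t].
- by move=> x _; exact: (is_derive_continuous dy).
- by apply: (derive1_smooth dy); exact: su.
have : H (t + 2 * pi) - H t = H (0 + 2 * pi) - H 0.
  apply: (is_derive_0_is_cst (f := fun x => H (x + 2 * pi) - H x)) => x.
  have := is_derive_subf (is_derive_translate (dH (x + 2 * pi))) (dH x).
  by rewrite pu subrr.
by rewrite add0r HT subrr => /eqP; rewrite subr_eq0 => /eqP ->.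
Qed.

Definition rsmooth n (x : R -> 'cV[R]_n) := forall i, smooth_periodic (fun t => x t i 0).
Definition rderive n (x dx : R -> 'cV[R]_n) :=
  forall i (t : R), is_derive t 1 (fun t => x t i 0) (dx t i 0).

Section ModeSolve.
Variables (m : nat) (om kappa : R) (Et : 'M[R]_m) (fc fs : R -> 'cV[R]_(2 + m)).
Hypothesis Et_hyperbolic : forall mu, ceigenvalue Et mu -> Re mu != 0.
Hypotheses (fc_smooth : rsmooth fc) (fs_smooth : rsmooth fs).

Let i0 : 'I_(2 + m) := lshift m 0.
Let i1 : 'I_(2 + m) := lshift m 1.
(** [fp] and [fm] are [f_0 + i f_1] and [f_0 - i f_1] for the first two entries of [f = fc - i fs],
    the coordinates in which the rotation block is diagonal. *)
Let fp t : C := ((fc t i0 0 + fs t i1 0) +i* (fc t i1 0 - fs t i0 0))%C.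
Let fm t : C := ((fc t i0 0 - fs t i1 0) +i* (- fs t i0 0 - fc t i1 0))%C.

(* With Z = a - i b the two real equations become one complex equation
   (E - D - i kappa) Z = fc - i fs. *)
Lemma mode_solve_from (xp xm : R -> C) : csmooth xp -> csmooth xm ->
  cderive xp (fun t => (0 +i* (om - kappa))%C * xp t - fp t) ->
  cderive xm (fun t => (0 +i* (- om - kappa))%C * xm t - fm t) ->
  exists a b da db, [/\ rsmooth a /\ rsmooth b, rderive a da /\ rderive b db,
    forall t, Emat 0 om Et *m a t - da t - kappa *: b t = fc t,
    forall t, Emat 0 om Et *m b t - db t + kappa *: a t = fs t
    & forall t, a t i0 0 + b t i1 0 = Re (xp t) /\ a t i1 0 - b t i0 0 = Im (xp t)].
Proof.
move=> sp sm hp hm.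
pose f t : 'cV[C]_(2 + m) := \col_i (fc t i 0 +i* - fs t i 0)%C.
pose c : C := (0 +i* kappa)%C.
have sf : vsmooth f.
  move=> i; have -> : (fun t => f t i 0) = (fun t => fc t i 0 +i* - fs t i 0)%C.
    by apply/funext => t; rewrite mxE.
  split=> //=; apply: smooth_periodic_eq (smooth_periodicZ (-1) (fs_smooth i)) => t.
  by rewrite mulN1r.
have hE mu : ceigenvalue Et mu -> Re (mu - c) != 0.
  by move=> /Et_hyperbolic; case: mu => mr mi /=; rewrite subr0.
have ceq (z w : C) : Re z = Re w -> Im z = Im w -> z = w.
  by case: z w => [? ?] [? ?] /= -> ->.
have Ep : (cI * om%:C - c)%C = (0 +i* (om - kappa))%C by apply: ceq => /=; ring.
have Em : (- (cI * om%:C) - c)%C = (0 +i* (- om - kappa))%C by apply: ceq => /=; ring.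
have Fp t : f t i0 0 + cI * f t i1 0 = fp t by rewrite !mxE; apply: ceq => /=; ring.
have Fm t : f t i0 0 - cI * f t i1 0 = fm t by rewrite !mxE; apply: ceq => /=; ring.
have [||x [dx [sx hx Ex Exp]]] := floquet_block_solve (om := om) hE sf sp sm.
- by move=> t; rewrite Ep Fp; exact: hp.
- by move=> t; rewrite Em Fm; exact: hm.
move: (Emat 0 om Et) Ex => EE Ex.
exists (fun t => \col_i Re (x t i 0)), (fun t => \col_i (- Im (x t i 0))).
exists (fun t => \col_i Re (dx t i 0)), (fun t => \col_i (- Im (dx t i 0))).
have colE (u : R -> 'I_(2 + m) -> R) i : (fun t => (\col_i u t i) i 0) = u^~ i.
  by apply/funext => t; rewrite mxE.
have ReE t i : Re (\sum_j (EE i j)%:C%C * x t j 0) = \sum_j EE i j * Re (x t j 0).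
  elim/big_rec2: _ => [//|j r z _ <-]; by rewrite complexReD complexReM /= mul0r subr0.
have ImE t i : Im (\sum_j (EE i j)%:C%C * x t j 0) = \sum_j EE i j * Im (x t j 0).
  elim/big_rec2: _ => [//|j r z _ <-]; by rewrite complexImD complexImM /= mul0r addr0.
have entry t i : \sum_j (EE i j)%:C%C * x t j 0 =
    f t i 0 + dx t i 0 + c * x t i 0.
  have := congr1 (fun v : 'cV[C]_(2 + m) => v i 0) (Ex t).
  rewrite !mxE => <-; rewrite [RHS](_ : _ = \sum_j map_mx (real_complex R) (EE) i j * x t j 0).
    by apply: eq_bigr => j _; rewrite [in RHS]mxE.
  by ring.
have fE t i : f t i 0 = (fc t i 0 +i* - fs t i 0)%C by rewrite mxE.
split.
- by split=> i; rewrite colE; have [] := sx i => // _ si;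
    apply: smooth_periodic_eq (smooth_periodicZ (-1) si) => t; rewrite mulN1r.
- split=> i t; rewrite colE mxE; have [] := hx i t => // _ hi.
  by have := is_derive_scalef (-1) hi; rewrite mulN1r; under eq_fun do rewrite mulN1r.
- move=> t; apply/colP => i; have := ReE t i; rewrite entry fE !complexReD complexReM /= mul0r sub0r => H.
  rewrite !mxE; under eq_bigr do rewrite mxE; rewrite -H; ring.
- move=> t; apply/colP => i; have := ImE t i; rewrite entry fE !complexImD complexImM /= mul0r add0r => H.
  rewrite !mxE; under eq_bigr do rewrite mxE mulrN; rewrite sumrN -H; ring.
- by move=> t; rewrite !mxE -Exp complexReD complexImD complexReM complexImM /=; split; ring.
Qed.

Hypothesis nonres_m : forall n : int, - om - kappa != n%:~R.

Let sfm : csmooth (fun t => -1 * fm t).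
Proof.
apply: csmoothZ; split=> /=.
  apply: smooth_periodic_eq (smooth_periodicD (fc_smooth i0) (smooth_periodicZ (-1) (fs_smooth i1))) => t.
  by rewrite mulN1r.
apply: smooth_periodic_eq (smooth_periodicD (smooth_periodicZ (-1) (fs_smooth i0)) (smooth_periodicZ (-1) (fc_smooth i1))) => t.
by rewrite !mulN1r.
Qed.

Let sfp : csmooth (fun t => -1 * fp t).
Proof.
apply: csmoothZ; split=> /=.
  exact: smooth_periodicD.
apply: smooth_periodic_eq (smooth_periodicD (fc_smooth i1) (smooth_periodicZ (-1) (fs_smooth i0))) => t.
by rewrite !mulN1r.
Qed.

Lemma mode_solve_nonresonant : (forall n : int, om - kappa != n%:~R) ->
  exists a b da db, [/\ rsmooth a /\ rsmooth b, rderive a da /\ rderive b db,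
    forall t, Emat 0 om Et *m a t - da t - kappa *: b t = fc t
    & forall t, Emat 0 om Et *m b t - db t + kappa *: a t = fs t].
Proof.
move=> nonres_p.
have [xp sp hp] := csolve (mu := (0 +i* (om - kappa))%C) (or_intror nonres_p) sfp.
have [xm sm hm] := csolve (mu := (0 +i* (- om - kappa))%C) (or_intror nonres_m) sfm.
have [||a [b [da [db [ab dab Ec Es _]]]]] := mode_solve_from sp sm.
- by move=> t; have := hp t; rewrite mulN1r.
- by move=> t; have := hm t; rewrite mulN1r.
by exists a, b, da, db.
Qed.

(** The factor [i (om - kappa)] vanishes, so the resonant component obeys [xp' = - fp], which has
    periodic solutions because the two hypotheses say that [fp] has mean zero. The constant of
    integration is chosen to give [xp] mean zero; this will be the amplitude and phase condition on
    mode 1. *)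
Lemma mode_solve_resonant : kappa = om ->
  mean (fun t => fc t i0 0 + fs t i1 0) = 0 ->
  mean (fun t => fc t i1 0 - fs t i0 0) = 0 ->
  exists a b da db, [/\ rsmooth a /\ rsmooth b, rderive a da /\ rderive b db,
    forall t, Emat 0 om Et *m a t - da t - kappa *: b t = fc t,
    forall t, Emat 0 om Et *m b t - db t + kappa *: a t = fs t
    & mean (fun t => a t i0 0 + b t i1 0) = 0 /\ mean (fun t => a t i1 0 - b t i0 0) = 0].
Proof.
move=> kE mp mq.
have [xm sm hm] := csolve (mu := (0 +i* (- om - kappa))%C) (or_intror nonres_m) sfm.
have neg (u : R -> R) : smooth_periodic u -> mean u = 0 ->
    exists y, [/\ smooth_periodic y, forall x : R, is_derive x 1 y (- u x) & mean y = 0].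
  move=> su u0; have [y [sy hy y0]] := zero_mean_antiderivative su u0.
  exists (fun x => -1 * y x); split; first exact: smooth_periodicZ.
    by move=> x; have := is_derive_scalef (-1) (hy x); rewrite mulN1r.
  by rewrite meanZ ?y0 ?mulr0//; exact: (is_derive_continuous hy).
have sq : smooth_periodic (fun t => fc t i1 0 - fs t i0 0).
  apply: smooth_periodic_eq (smooth_periodicD (fc_smooth i1) (smooth_periodicZ (-1) (fs_smooth i0))) => t.
  by rewrite !mulN1r.
have [yr [sr hr r0]] := neg _ (smooth_periodicD (fc_smooth i0) (fs_smooth i1)) mp.
have [yi [si hi j0]] := neg _ sq mq.
have [|||a [b [da [db [ab dab Ec Es Exp]]]]] := @mode_solve_from (fun t => yr t +i* yi t)%C xm _ sm.
- by split.
- move=> t; rewrite kE subrr; split=> /=.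
    by have := hr t; rewrite !mul0r subr0 add0r.
  by have := hi t; rewrite !mul0r addr0 add0r.
- by move=> t; have := hm t; rewrite mulN1r.
exists a, b, da, db; split=> //; split.
  by rewrite (_ : (fun _ => _) = yr)//; apply/funext => t; have [] := Exp t.
by rewrite (_ : (fun _ => _) = yi)//; apply/funext => t; have [] := Exp t.
Qed.

End ModeSolve.
End Modes.

(** * Fourier modes in phi *)

Section Modal.
Context {R : realType}.
Implicit Types (f g : R -> R -> R) (ks : seq nat).

(** Unlike in [only_phi_modes], the coefficients must be smooth and periodic: they become right-hand
    sides of the mode equations. *)
Definition modal ks f := exists a b : nat -> R -> R,
  (forall k, smooth_periodic (a k) /\ smooth_periodic (b k)) /\
  forall theta phi, f theta phi = \sum_(k <- ks)
    (cos (k%:R * phi) * a k theta + sin (k%:R * phi) * b k theta).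

Lemma modal_eq ks f g : (forall th ph, g th ph = f th ph) -> modal ks f -> modal ks g.
Proof.
by move=> fg [a [b [ab fE]]]; exists a, b; split=> // th ph; rewrite fg.
Qed.

Lemma smooth_periodicM (u v : R -> R) : smooth_periodic u -> smooth_periodic v ->
  smooth_periodic (fun x => u x * v x).
Proof.
move=> [su pu] [sv pv]; split=> [k|t]; last by rewrite pu pv.
by apply: Ck_onM; [exact: openT|exact: su|exact: sv].
Qed.

Lemma modalD ks f g : modal ks f -> modal ks g -> modal ks (fun th ph => f th ph + g th ph).
Proof.
move=> [a [b [ab fE]]] [a' [b' [ab' gE]]].
exists (fun k th => a k th + a' k th), (fun k th => b k th + b' k th); split.
  by move=> k; have [? ?] := ab k; have [? ?] := ab' k; split; exact: smooth_periodicD.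
move=> th ph; rewrite fE gE -big_split; apply: eq_bigr => k _ /=; ring.
Qed.

Lemma modalM ks f u : smooth_periodic u -> modal ks f -> modal ks (fun th ph => u th * f th ph).
Proof.
move=> su [a [b [ab fE]]].
exists (fun k th => u th * a k th), (fun k th => u th * b k th); split.
  by move=> k; have [? ?] := ab k; split; exact: smooth_periodicM.
move=> th ph; rewrite fE mulr_sumr; apply: eq_bigr => k _ /=; ring.
Qed.

Lemma smooth_periodic_cst (c : R) : smooth_periodic (fun=> c).
Proof. by split=> // k; exact: Ck_on_cst. Qed.

Lemma modalZ ks f c : modal ks f -> modal ks (fun th ph => c * f th ph).
Proof. by apply: modalM; exact: smooth_periodic_cst. Qed.

Lemma modal0 ks : modal ks (fun _ _ => 0).
Proof.
exists (fun _ _ => 0), (fun _ _ => 0); split; first by move=> k; split; exact: smooth_periodic0.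
by move=> th ph; rewrite big1// => k _; rewrite !mulr0 addr0.
Qed.

Lemma modal_sum ks (I : Type) (s : seq I) (f : I -> R -> R -> R) :
  (forall i, modal ks (f i)) -> modal ks (fun th ph => \sum_(i <- s) f i th ph).
Proof.
move=> mf; elim: s => [|i s IH].
  by apply: modal_eq (modal0 ks) => th ph; rewrite big_nil.
by apply: modal_eq (modalD (mf i) IH) => th ph; rewrite big_cons.
Qed.

Lemma modal_of_theta u : smooth_periodic u -> modal [:: 0%N] (fun th _ => u th).
Proof.
move=> su; exists (fun=> u), (fun=> u); split=> // th ph.
by rewrite big_seq1 mul0r cos0 sin0 mul1r mul0r addr0.
Qed.

Lemma cos_sin_cos_sin (x y : R) : [/\ cos x * cos y = 2^-1 * (cos (y + x) + cos (y - x)),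
  cos x * sin y = 2^-1 * (sin (y + x) + sin (y - x)),
  sin x * cos y = 2^-1 * (sin (y + x) - sin (y - x))
  & sin x * sin y = 2^-1 * (cos (y - x) - cos (y + x))].
Proof. by rewrite cosD sinD cosB sinB; split; field. Qed.

(** Multiplication by [cos ph] or [sin ph] moves a mode one step up or down. The passages from 0 to
    1, from 1 to 0 and 2, and from 0 and 2 to 1 and 3 are those that the quadratic and cubic terms
    require. *)
Lemma modal_cos_sin0 f : modal [:: 0%N] f ->
  modal [:: 1%N] (fun th ph => cos ph * f th ph) /\ modal [:: 1%N] (fun th ph => sin ph * f th ph).
Proof.
move=> [a [b [ab fE]]]; have [sa sb] := ab 0%N; split.
  exists (fun=> a 0%N), (fun _ _ => 0); split; first by move=> k; split=> //; exact: smooth_periodic0.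
  by move=> th ph; rewrite fE !big_seq1 mul0r mul1r cos0 sin0; ring.
exists (fun _ _ => 0), (fun=> a 0%N); split; first by move=> k; split=> //; exact: smooth_periodic0.
by move=> th ph; rewrite fE !big_seq1 mul0r mul1r cos0 sin0; ring.
Qed.

Lemma modal_cos_sin1 f : modal [:: 1%N] f ->
  modal [:: 0; 2]%N (fun th ph => cos ph * f th ph) /\ modal [:: 0; 2]%N (fun th ph => sin ph * f th ph).
Proof.
move=> [a [b [ab fE]]]; have [sa sb] := ab 1%N.
have arg (ph : R) : ph + ph = 2%:R * ph by ring.
split.
  exists (fun k th => 2^-1 * a 1%N th), (fun k th => 2^-1 * b 1%N th); split.
    by move=> k; split; exact: smooth_periodicZ.
  move=> th ph; rewrite fE big_seq1 !big_cons big_nil mulrDr !mulrA mul1r.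
  have [-> -> _ _] := cos_sin_cos_sin ph ph.
  by rewrite arg subrr mul0r cos0 sin0; ring.
exists (fun k th => if k == 0%N then 2^-1 * b 1%N th else - 2^-1 * b 1%N th),
  (fun k th => 2^-1 * a 1%N th); split.
  by move=> k; split; [case: (k == 0%N)|]; exact: smooth_periodicZ.
move=> th ph; rewrite fE big_seq1 !big_cons big_nil mulrDr !mulrA mul1r /=.
have [_ _ -> ->] := cos_sin_cos_sin ph ph.
by rewrite arg subrr mul0r cos0 sin0; ring.
Qed.

Lemma modal_cos_sin02 f : modal [:: 0; 2]%N f ->
  modal [:: 1; 3]%N (fun th ph => cos ph * f th ph) /\ modal [:: 1; 3]%N (fun th ph => sin ph * f th ph).
Proof.
move=> [a [b [ab fE]]]; have [s0 _] := ab 0%N; have [sa sb] := ab 2%N.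
have arg3 (ph : R) : 2%:R * ph + ph = 3%:R * ph by ring.
have arg1 (ph : R) : 2%:R * ph - ph = ph by ring.
have sz := smooth_periodicZ.
split.
  exists (fun k th => if k == 1%N then a 0%N th + 2^-1 * a 2%N th else 2^-1 * a 2%N th),
    (fun k th => 2^-1 * b 2%N th); split.
    by move=> k; split; [case: (k == 1%N)|]; [apply: smooth_periodicD|..]; rewrite //; exact: sz.
  move=> th ph; rewrite fE !big_cons !big_nil mul0r cos0 sin0 /= !mul1r.
  have [E1 E2 _ _] := cos_sin_cos_sin ph (2 * ph); rewrite arg3 arg1 in E1 E2.
  transitivity (cos ph * a 0%N th + (cos ph * cos (2 * ph)) * a 2%N th + (cos ph * sin (2 * ph)) * b 2%N th).
    by ring.
  by rewrite E1 E2; ring.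
exists (fun k th => if k == 1%N then 2^-1 * b 2%N th else - 2^-1 * b 2%N th),
  (fun k th => if k == 1%N then a 0%N th - 2^-1 * a 2%N th else 2^-1 * a 2%N th); split.
  move=> k; split; case: (k == 1%N); try exact: sz.
  by apply: smooth_periodic_eq (smooth_periodicD s0 (sz _ (- 2^-1) _ sa)) => x; rewrite mulNr.
move=> th ph; rewrite fE !big_cons !big_nil mul0r cos0 sin0 /= !mul1r.
have [_ _ E1 E2] := cos_sin_cos_sin ph (2 * ph); rewrite arg3 arg1 in E1 E2.
transitivity (sin ph * a 0%N th + (sin ph * cos (2 * ph)) * a 2%N th + (sin ph * sin (2 * ph)) * b 2%N th).
  by ring.
by rewrite E1 E2; ring.
Qed.

End Modal.

(** * Vector functions with finitely many phi-modes *)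

Section TorusModes.
Context {R : realType} {m : nat}.
Local Notation vec := 'cV[R]_(2 + m).
Implicit Types (A B dA dB : nat -> R -> vec) (ks : seq nat).

Definition modes_vec ks A B (theta phi : R) : vec := \sum_(k <- ks)
  (cos (k%:R * phi) *: A k theta + sin (k%:R * phi) *: B k theta).

Lemma modes_vecE ks A B th ph i : modes_vec ks A B th ph i 0 =
  \sum_(k <- ks) (cos (k%:R * ph) * A k th i 0 + sin (k%:R * ph) * B k th i 0).
Proof. by rewrite /modes_vec summxE; apply: eq_bigr => k _; rewrite !mxE. Qed.

Lemma cos_sin_nat_periodic (k : nat) (t : R) :
  cos (k%:R * (t + 2 * pi)) = cos (k%:R * t) /\ sin (k%:R * (t + 2 * pi)) = sin (k%:R * t).
Proof.
have -> : k%:R * (t + 2 * pi) = k%:R * t + (pi *+ 2) *+ k.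
  by rewrite mulrDr mulr_natl [2 * pi]mulr_natl mulr_natl.
by rewrite (periodicn (@cosD2pi R)) (periodicn (@sinD2pi R)).
Qed.

Lemma modes_vec_smooth ks A B : (forall k, rsmooth (A k) /\ rsmooth (B k)) ->
  smooth_torus (modes_vec ks A B).
Proof.
move=> sAB; split.
- have oT := @openT (R * R)%type.
  move=> n; apply: Ck_on_mx => // i j; rewrite (ord1 j).
  apply: (@Ck_on_ext R (R * R)%type R n setT (fun p => \sum_(k <- ks)
    (cos (k%:R * p.2) * A k p.1 i 0 + sin (k%:R * p.2) * B k p.1 i 0))) => //.
    by move=> p _; rewrite modes_vecE.
  apply: Ck_on_sum => // k.
  have Carg : Ck_on n setT (fun p : R * R => k%:R * p.2).
    by apply: Ck_onM => //; [exact: Ck_on_cst|exact: Ck_on_snd].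
  have [Cs Cc] := Ck_on_sin_cos oT Carg.
  have pull (f : R -> R) : smooth_on setT f -> Ck_on n setT (fun p : R * R => f p.1).
    move=> Cf; have [I [w [l wl]]] := @framed_real R.
    apply: (Ck_on_comp (f := fst) wl oT (@openT R)) => //; exact: Ck_on_fst.
  have [sA sB] := sAB k.
  apply: Ck_onD => //; apply: Ck_onM => //.
    by apply: (pull (fun t => A k t i 0)); have [] := sA i.
  by apply: (pull (fun t => B k t i 0)); have [] := sB i.
- move=> ph th; apply/colP => i; rewrite !modes_vecE; apply: eq_bigr => k _.
  have [sA sB] := sAB k; have [_ pA] := sA i; have [_ pB] := sB i.
  by rewrite pA pB.
- move=> th ph; apply/colP => i; rewrite !modes_vecE; apply: eq_bigr => k _.
  by have [-> ->] := cos_sin_nat_periodic k ph.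
Qed.

Lemma is_derive_big (ks : seq nat) (f : nat -> R -> R) (df : nat -> R) (x : R) :
  (forall k, is_derive x 1 (f k) (df k)) ->
  is_derive x 1 (fun y => \sum_(k <- ks) f k y) (\sum_(k <- ks) df k).
Proof.
move=> hf; elim: ks => [|k ks IH].
  rewrite big_nil (_ : (fun _ => _) = cst 0); first exact: is_derive_cst.
  by apply/funext => y; rewrite big_nil.
rewrite big_cons (_ : (fun _ => _) = fun y => f k y + \sum_(j <- ks) f j y).
  exact: is_derive_addf.
by apply/funext => y; rewrite big_cons.
Qed.

Lemma modes_vec_derive ks A B dA dB i th ph :
  (forall k, rsmooth (A k) /\ rsmooth (B k)) ->
  (forall k, rderive (A k) (dA k) /\ rderive (B k) (dB k)) ->
  'D_(1, 0) (fun q => modes_vec ks A B q.1 q.2 i 0) (th, ph) =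
    \sum_(k <- ks) (cos (k%:R * ph) * dA k th i 0 + sin (k%:R * ph) * dB k th i 0) /\
  'D_(0, 1) (fun q => modes_vec ks A B q.1 q.2 i 0) (th, ph) =
    \sum_(k <- ks) k%:R * (cos (k%:R * ph) * B k th i 0 - sin (k%:R * ph) * A k th i 0).
Proof.
move=> sAB dAB.
have [sz _ _] := smooth_torus_coord i 0 (modes_vec_smooth ks sAB).
have dz : differentiable (fun q => modes_vec ks A B q.1 q.2 i 0) (th, ph).
  exact: (smooth_on_diff sz).
split.
  have [_ <-] := is_derive_fst dz; rewrite (_ : (fun _ => _) = fun x => \sum_(k <- ks)
    (cos (k%:R * ph) * A k x i 0 + sin (k%:R * ph) * B k x i 0)); last first.
    by apply/funext => x; rewrite modes_vecE.
  have hf k : is_derive th 1 (fun x => cos (k%:R * ph) * A k x i 0 + sin (k%:R * ph) * B k x i 0)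
      (cos (k%:R * ph) * dA k th i 0 + sin (k%:R * ph) * dB k th i 0).
    by have [hA hB] := dAB k; apply: is_derive_addf; apply: is_derive_scalef.
  by have [_ ->] := is_derive_big ks hf.
have [_ <-] := is_derive_snd dz; rewrite (_ : (fun _ => _) = fun x => \sum_(k <- ks)
  (cos (k%:R * x) * A k th i 0 + sin (k%:R * x) * B k th i 0)); last first.
  by apply/funext => x; rewrite modes_vecE.
have hf k : is_derive ph 1 (fun x => cos (k%:R * x) * A k th i 0 + sin (k%:R * x) * B k th i 0)
    (k%:R * (cos (k%:R * ph) * B k th i 0 - sin (k%:R * ph) * A k th i 0)).
  have dc : is_derive ph 1 (fun x => cos (k%:R * x)) (k%:R * - sin (k%:R * ph)).
    exact: is_derive_scale_arg.
  have ds : is_derive ph 1 (fun x => sin (k%:R * x)) (k%:R * cos (k%:R * ph)).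
    exact: is_derive_scale_arg.
  apply: is_derive_eq (is_derive_addf (is_derive_mulf dc (is_derive_cst (A k th i 0) ph 1))
    (is_derive_mulf ds (is_derive_cst (B k th i 0) ph 1))) _.
  rewrite /cst; ring.
by have [_ ->] := is_derive_big ks hf.
Qed.

(** The phi-derivative sends the coefficients [(A k, B k)] of mode [k] to [k (B k, - A k)], so the
    equation on the torus splits into one coupled pair of equations in [theta] for each mode. *)
Lemma modes_vec_equation ks (E : 'M[R]_(2 + m)) (om : R) A B dA dB (fc fs : nat -> R -> vec) i th ph :
  (forall k, rsmooth (A k) /\ rsmooth (B k)) ->
  (forall k, rderive (A k) (dA k) /\ rderive (B k) (dB k)) ->
  (forall k, k \in ks -> forall t, E *m A k t - dA k t - (k%:R * om) *: B k t = fc k t) ->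
  (forall k, k \in ks -> forall t, E *m B k t - dB k t + (k%:R * om) *: A k t = fs k t) ->
  let z := modes_vec ks A B in
  \sum_j z th ph j 0 * E i j - 'D_(1, 0) (fun q => z q.1 q.2 i 0) (th, ph)
    - om * 'D_(0, 1) (fun q => z q.1 q.2 i 0) (th, ph)
  = \sum_(k <- ks) (cos (k%:R * ph) * fc k th i 0 + sin (k%:R * ph) * fs k th i 0).
Proof.
move=> sAB dAB hA hB z; have [-> ->] := modes_vec_derive ks i th ph sAB dAB.
under eq_bigr do rewrite modes_vecE mulr_suml.
rewrite exchange_big mulr_sumr -!sumrB; apply: eq_big_seq => k kks.
rewrite -(hA k kks) -(hB k kks) !mxE /= !(mulrDr, mulrN) !mulr_sumr.
rewrite [X in X - _ - _](_ : _ = \sum_j cos (k%:R * ph) * (E i j * A k th j 0) +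
  \sum_j sin (k%:R * ph) * (E i j * B k th j 0)); last first.
  by rewrite -big_split; apply: eq_bigr => j _ /=; ring.
by ring.
Qed.

End TorusModes.

(** * The equations for the second and third terms of the ansatz *)

Section TorusSolutions.
Context {R : realType} {m : nat}.
Local Notation vec := 'cV[R]_(2 + m).
Local Notation mean u := (\int[lebesgue_measure]_(t in `[0, 2 * pi]) u t : R).
Let i0 : 'I_(2 + m) := lshift m 0.
Let i1 : 'I_(2 + m) := lshift m 1.
Local Notation a j ph := (@astar R m ph j 0).

Lemma astarE j ph : a j ph = cos ph * (@e1 R m) j 0 + sin ph * (@e2 R m) j 0.
Proof. by rewrite !mxE. Qed.

Lemma nonint_lt2 (x : R) (n : int) : 0 < `|x| < 2 -> `|x| != 1 -> x != n%:~R.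
Proof.
move=> /andP[x0 x2] x1; apply/eqP => xn.
have xE : `|x| = (`|n|)%:~R by rewrite xn intr_norm.
have n0 : (0 < `|n|)%R by rewrite -(ltr_int R) -xE.
have n2 : (`|n| < 2)%R by rewrite -(ltr_int R) -xE.
have n1 : `|n|%R = 1 by move: n0 n2; case: (`|n|%R) => [[|[|k]]|k].
by move: x1; rewrite xE n1 eqxx.
Qed.

Lemma modal_coef_vec ks (f : 'I_(2 + m) -> R -> R -> R) : (forall i, modal ks (f i)) ->
  exists A B : nat -> R -> vec, (forall k, rsmooth (A k) /\ rsmooth (B k)) /\
   forall i th ph, f i th ph = \sum_(k <- ks)
     (cos (k%:R * ph) * A k th i 0 + sin (k%:R * ph) * B k th i 0).
Proof.
move=> /choice[A /choice[B ABP]].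
exists (fun k th => \col_i A i k th), (fun k th => \col_i B i k th); split.
  move=> k; split=> i; [rewrite (_ : (fun _ => _) = A i k)|rewrite (_ : (fun _ => _) = B i k)];
    try by apply/funext => t; rewrite mxE.
    by have [/(_ k)[]] := ABP i.
  by have [/(_ k)[]] := ABP i.
move=> i th ph; have [_ ->] := ABP i; apply: eq_bigr => k _.
by rewrite !mxE.
Qed.

Lemma modal_astar ks ks' (f : R -> R -> R) j :
  (modal ks f -> modal ks' (fun th ph => cos ph * f th ph) /\ modal ks' (fun th ph => sin ph * f th ph)) ->
  modal ks f -> modal ks' (fun th ph => a j ph * f th ph).
Proof.
move=> H /H[Hc Hs].
apply: modal_eq (modalD (modalZ ((@e1 R m) j 0) Hc) (modalZ ((@e2 R m) j 0) Hs)) => th ph.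
by rewrite astarE; ring.
Qed.

Section Data.
Variables (om : R) (Et : 'M[R]_m) (Ep : 'M[R]_(2 + m)).
Variables (G2 : 'I_(2 + m) -> 'I_(2 + m) -> 'I_(2 + m) -> R -> R).
Variables (G3 : 'I_(2 + m) -> 'I_(2 + m) -> 'I_(2 + m) -> 'I_(2 + m) -> R -> R).
Hypothesis Et_hyperbolic : forall mu, ceigenvalue Et mu -> complex.Re mu != 0.
Hypothesis om_range : 0 < om < 2^-1.
Hypotheses (om_13 : om != 3^-1) (om_14 : om != 4^-1).
Hypothesis G2_smooth : forall i j k, smooth_periodic (G2 i j k).
Hypothesis G3_smooth : forall i j k l, smooth_periodic (G3 i j k l).
Hypotheses (Ep00 : Ep i0 i0 != 0) (Ep11 : Ep i1 i1 = Ep i0 i0) (Ep01 : Ep i0 i1 = - Ep i1 i0).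

Definition torus_op (z : R -> R -> vec) i th ph : R :=
  \sum_j z th ph j 0 * Emat 0 om Et i j - 'D_(1, 0) (fun q => z q.1 q.2 i 0) (th, ph)
    - om * 'D_(0, 1) (fun q => z q.1 q.2 i 0) (th, ph).

(** Up to sign the combinations are [om], [2 om], [3 om] and [4 om], all strictly between 0 and 2,
    so only the value 1 has to be avoided. For [om] and [2 om] this follows from [om < 1/2]; for
    [3 om] and [4 om] it is the absence of strong resonance. *)
Lemma nonresonance k : k \in [:: 0; 2; 3]%N ->
  (forall n : int, om - k%:R * om != n%:~R) /\ (forall n : int, - om - k%:R * om != n%:~R).
Proof.
have /andP[w0 w2] := om_range.
have key (x : R) (n : int) : 0 < x < 2 -> x != 1 -> x != n%:~R /\ - x != n%:~R.
  move=> /andP[x0 x2] x1; split; apply: nonint_lt2; rewrite ?normrN gtr0_norm//; exact/andP.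
have o1 : om != 1 by apply/eqP => H; move: w2; rewrite H; lra.
have t1 : 2 * om != 1 by apply/eqP => H; move: w2; lra.
have t3 : 3 * om != 1 by apply: contraNneq om_13 => H; apply/eqP; lra.
have t4 : 4 * om != 1 by apply: contraNneq om_14 => H; apply/eqP; lra.
have r1 : 0 < om < 2 by apply/andP; split; lra.
have r2 : 0 < 2 * om < 2 by apply/andP; split; lra.
have r3 : 0 < 3 * om < 2 by apply/andP; split; lra.
have r4 : 0 < 4 * om < 2 by apply/andP; split; lra.
rewrite !inE => /or3P[] /eqP ->.
- split=> n; first by rewrite mul0r subr0; have [] := key _ n r1 o1.
  by rewrite mul0r subr0; have [] := key _ n r1 o1.
- split=> n.
    by rewrite (_ : _ - _ = - om); [have [] := key _ n r1 o1|ring].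
  by rewrite (_ : _ - _ = - (3 * om)); [have [] := key _ n r3 t3|ring].
- split=> n.
    by rewrite (_ : _ - _ = - (2 * om)); [have [] := key _ n r2 t1|ring].
  by rewrite (_ : _ - _ = - (4 * om)); [have [] := key _ n r4 t4|ring].
Qed.

(** [Q] carries a side condition from the solver of each mode to the assembled solution; it serves
    for the vanishing means in mode 1. *)
Lemma torus_solve_from (ks : seq nat) (fc fs : nat -> R -> vec)
    (Q : nat -> (R -> vec) -> (R -> vec) -> Prop) :
  (forall k, k \in ks -> exists a b da db, [/\ rsmooth a /\ rsmooth b, rderive a da /\ rderive b db,
    forall t, Emat 0 om Et *m a t - da t - (k%:R * om) *: b t = fc k t,
    forall t, Emat 0 om Et *m b t - db t + (k%:R * om) *: a t = fs k t & Q k a b]) ->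
  exists A B : nat -> R -> vec, [/\ forall k, rsmooth (A k) /\ rsmooth (B k),
    forall k, k \in ks -> Q k (A k) (B k) &
    forall i th ph, torus_op (modes_vec ks A B) i th ph =
      \sum_(k <- ks) (cos (k%:R * ph) * fc k th i 0 + sin (k%:R * ph) * fs k th i 0)].
Proof.
move=> sol.
have /choice[X XP] : forall k, exists X : ((R -> vec) * (R -> vec)) * ((R -> vec) * (R -> vec)),
   [/\ rsmooth X.1.1 /\ rsmooth X.1.2, rderive X.1.1 X.2.1 /\ rderive X.1.2 X.2.2 &
     k \in ks -> [/\ forall t, Emat 0 om Et *m X.1.1 t - X.2.1 t - (k%:R * om) *: X.1.2 t = fc k t,
    forall t, Emat 0 om Et *m X.1.2 t - X.2.2 t + (k%:R * om) *: X.1.1 t = fs k t & Q k X.1.1 X.1.2]].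
  move=> k; have [kks|_] := boolP (k \in ks).
    by have [A [B [dA [dB [sAB dAB EA EB QAB]]]]] := sol k kks; exists ((A, B), (dA, dB)).
  (* Modes outside [ks] receive the zero function, which makes the coefficient families total and
     smooth. *)
  have s0 : rsmooth (fun=> 0 : vec).
    by move=> i; rewrite (_ : (fun _ => _) = fun=> 0); [exact: smooth_periodic0|apply/funext => t; rewrite mxE].
  have d0 : rderive (fun=> 0 : vec) (fun=> 0 : vec).
    move=> i t; rewrite [X in is_derive _ _ _ X](_ : _ = 0); last by rewrite mxE.
    rewrite (_ : (fun _ => _) = cst 0); first exact: is_derive_cst.
    by apply/funext => s; rewrite mxE.
  by exists ((fun=> 0, fun=> 0), (fun=> 0, fun=> 0)).
exists (fun k => (X k).1.1), (fun k => (X k).1.2).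
have sX k : rsmooth (X k).1.1 /\ rsmooth (X k).1.2 by have [] := XP k.
split=> // [k kks|i th ph]; first by have [_ _ /(_ kks)[]] := XP k.
apply: (@modes_vec_equation _ _ ks _ om (fun k => (X k).1.1) (fun k => (X k).1.2)
  (fun k => (X k).2.1) (fun k => (X k).2.2)) => //.
- by move=> k; have [] := XP k.
- by move=> k kks t; have [_ _ /(_ kks)[]] := XP k.
- by move=> k kks t; have [_ _ /(_ kks)[]] := XP k.
Qed.

Lemma nonresonance1 (n : int) : - om - 1%:R * om != n%:~R.
Proof.
have /andP[w0 w2] := om_range.
rewrite (_ : _ - _ = - (2 * om)); last by ring.
apply: nonint_lt2; rewrite normrN gtr0_norm; last by lra.
  by apply/andP; split; lra.
by lra.
by apply/eqP => H; move: w2; lra.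
Qed.

Lemma sum_astar (X : 'I_(2 + m) -> R) ph :
  \sum_j a j ph * X j = cos ph * X i0 + sin ph * X i1.
Proof.
have e1E j : (@e1 R m) j 0 = (j == i0)%:R by rewrite mxE eqxx andbT.
have e2E j : (@e2 R m) j 0 = (j == i1)%:R by rewrite mxE eqxx andbT.
rewrite (bigD1 i0)//= (bigD1 i1)//= big1 ?addr0 => [|j /andP[j0 j1]].
  rewrite !astarE !e1E !e2E !eqxx; have -> : (i0 == i1) = false by [].
  have -> : (i1 == i0) = false by [].
  by rewrite !mulr1 !mulr0 addr0 add0r.
by rewrite astarE e1E e2E (negbTE j0) (negbTE j1) !mulr0 addr0 mul0r.
Qed.

Definition quadratic_forcing i th ph : R := 2^-1 * \sum_j a j ph * \sum_k a k ph * G2 i j k th.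

(** What the nonlinearity contributes at order eps^2: the polarised quadratic term between [astar]
    and [z2], and the cubic term at [astar]. *)
Definition cubic_forcing (z2 : R -> R -> vec) i th ph : R :=
  2^-1 * (\sum_j a j ph * (\sum_k z2 th ph k 0 * G2 i j k th)
    + \sum_j z2 th ph j 0 * (\sum_k a k ph * G2 i j k th))
  + 6^-1 * \sum_j a j ph * \sum_k a k ph * \sum_l a l ph * G3 i j k l th.

Lemma quadratic_forcing_modal i : modal [:: 0; 2]%N (quadratic_forcing i).
Proof.
apply: modalZ; apply: modal_sum => j; apply: (modal_astar _ (@modal_cos_sin1 _ _)).
apply: modal_sum => k; apply: (modal_astar _ (@modal_cos_sin0 _ _)).
exact: modal_of_theta.
Qed.

Lemma cubic_forcing_modal (z2 : R -> R -> vec) i : (forall j, modal [:: 0; 2]%N (fun th ph => z2 th ph j 0)) ->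
  modal [:: 1; 3]%N (cubic_forcing z2 i).
Proof.
move=> mz.
apply: modalD; last first.
  apply: modalZ; apply: modal_sum => j; apply: (modal_astar _ (@modal_cos_sin02 _ _)).
  apply: modal_sum => k; apply: (modal_astar _ (@modal_cos_sin1 _ _)).
  apply: modal_sum => l; apply: (modal_astar _ (@modal_cos_sin0 _ _)).
  exact: modal_of_theta.
apply: modalZ; apply: modalD; apply: modal_sum => j.
  apply: (modal_astar _ (@modal_cos_sin02 _ _)).
  apply: modal_sum => k.
  by apply: modal_eq (modalM (G2_smooth i j k) (mz k)) => th ph; rewrite mulrC.
have H : modal [:: 1; 3]%N (fun th ph => \sum_k a k ph * (G2 i j k th * z2 th ph j 0)).
  apply: modal_sum => k; apply: (modal_astar _ (@modal_cos_sin02 _ _)).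
  exact: modalM.
apply: modal_eq H => th ph; rewrite mulr_sumr; apply: eq_bigr => k _; ring.
Qed.

Lemma torus_solutions : exists (lam2 om2 : R) (A2 B2 A3 B3 : nat -> R -> vec),
  let z2 := modes_vec [:: 0; 2]%N A2 B2 in let z3 := modes_vec [:: 1; 3]%N A3 B3 in
  [/\ (forall k, rsmooth (A2 k) /\ rsmooth (B2 k)) /\ (forall k, rsmooth (A3 k) /\ rsmooth (B3 k)),
    forall i th ph, torus_op z2 i th ph + quadratic_forcing i th ph = 0,
    forall i th ph, torus_op z3 i th ph + cubic_forcing z2 i th ph
      + lam2 * \sum_j a j ph * Ep i j - om2 * (@dastar R m ph i 0) = 0
    & mean (fun t => A3 1%N t i0 0 + B3 1%N t i1 0) = 0 /\
      mean (fun t => A3 1%N t i1 0 - B3 1%N t i0 0) = 0].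
Proof.
have hneg (fc : R -> vec) : rsmooth fc -> rsmooth (fun t => - fc t).
  move=> sf i; apply: smooth_periodic_eq (smooth_periodicZ (-1) (sf i)) => t.
  by rewrite mxE mulN1r.
have [F2 [H2 [sFH2 E2]]] := modal_coef_vec quadratic_forcing_modal.
have [|A2 [B2 [sAB2 _ op2]]] := @torus_solve_from [:: 0; 2]%N (fun k t => - F2 k t)
   (fun k t => - H2 k t) (fun _ _ _ => True).
  move=> k k02; have [sF sH] := sFH2 k.
  have [n1 n2] : (forall n : int, om - k%:R * om != n%:~R) /\ (forall n : int, - om - k%:R * om != n%:~R).
    by apply: nonresonance; move: k02; rewrite !inE => /orP[->|->//]; rewrite ?orbT.
  have [A [B [dA [dB [sAB dAB EA EB]]]]] := mode_solve_nonresonant Et_hyperbolic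
     (hneg _ sF) (hneg _ sH) n2 n1.
  by exists A, B, dA, dB.
pose z2 := modes_vec [:: 0; 2]%N A2 B2.
have mz2 j : modal [:: 0; 2]%N (fun th ph => z2 th ph j 0).
  exists (fun k t => A2 k t j 0), (fun k t => B2 k t j 0); split.
    by move=> k; have [sA sB] := sAB2 k; split; [exact: sA|exact: sB].
  by move=> th ph; rewrite modes_vecE.
have [F3 [H3 [sFH3 E3]]] := modal_coef_vec (fun i => cubic_forcing_modal i mz2).
have [sF1 sH1] := sFH3 1%N.
(* Integrals of the real and imaginary parts of the resonant component of the cubic forcing in mode
   1. *)
pose mp := mean (fun t => F3 1%N t i0 0 + H3 1%N t i1 0).
pose mq := mean (fun t => F3 1%N t i1 0 - H3 1%N t i0 0).
(* Solvability in mode 1 reads [mp / (2 pi) + 2 lam2 Ep00 = 0] and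
   [mq / (2 pi) + 2 lam2 Ep10 - 2 om2 = 0], by the rotational symmetry of [Ep]. The system is
   triangular: [Ep00], which will be the derivative of [alphaR], determines [lam2], and then [om2]
   follows. *)
pose lam2 := - mp / (2 * pi) / (2 * Ep i0 i0).
pose om2 := (mq / (2 * pi) + lam2 * (2 * Ep i1 i0)) / 2.
(* [Ep astar] and [dastar] are pure mode 1 and alter only its right-hand side: the first brings the
   two leading columns of [Ep], while [- om2 dastar] has cosine part [- om2 e2] and sine part
   [om2 e1]. *)
pose fc k t : vec := if k == 1%N then - (F3 1%N t + \col_i (lam2 * Ep i i0 - om2 * (@e2 R m) i 0)) else - F3 k t.
pose fs k t : vec := if k == 1%N then - (H3 1%N t + \col_i (lam2 * Ep i i1 + om2 * (@e1 R m) i 0)) else - H3 k t.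
pose Q k (A B : R -> vec) := k = 1%N ->
  mean (fun t => A t i0 0 + B t i1 0) = 0 /\ mean (fun t => A t i1 0 - B t i0 0) = 0.
have [|A3 [B3 [sAB3 Q3 op3]]] := @torus_solve_from [:: 1; 3]%N fc fs Q.
  have sc (c : 'I_(2 + m) -> R) (G : R -> vec) : rsmooth G ->
      rsmooth (fun t => - (G t + \col_i c i)).
    move=> sG; apply: hneg => i.
    apply: smooth_periodic_eq (smooth_periodicD (sG i) (smooth_periodic_cst (c i))) => t.
    by rewrite !mxE.
  have cF i : continuous (fun t => F3 1%N t i 0) by have [] := sF1 i => /smooth_continuous.
  have cH i : continuous (fun t => H3 1%N t i 0) by have [] := sH1 i => /smooth_continuous.
  have pi0 : pi != 0 :> R by rewrite gt_eqF// pi_gt0.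
  have alg1 (M P E : R) : P != 0 -> E != 0 ->
      -1 * M - (- M / (2 * P) / (2 * E)) * (2 * E) * (2 * P) = 0.
    by move=> P0 EE0; field; rewrite EE0 P0.
  have alg2 (M P E : R) : P != 0 -> -1 * M - (E - 2 * ((M / (2 * P) + E) / 2)) * (2 * P) = 0.
    by move=> P0; field.
  have ccst (c : R) : continuous (fun _ : R => c) by exact: cst_continuous.
  have [e100 e101 e200 e201] : [/\ (@e1 R m) i0 0 = 1, (@e1 R m) i1 0 = 0,
     (@e2 R m) i0 0 = 0 & (@e2 R m) i1 0 = 1] by split; rewrite mxE.
  move=> k; rewrite !inE => /orP[] /eqP ->.
    have [||A [B [dA [dB [sAB dAB EA EB QAB]]]]] := mode_solve_resonant Et_hyperbolic
      (sc (fun i => lam2 * Ep i i0 - om2 * (@e2 R m) i 0) _ sF1)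
      (sc (fun i => lam2 * Ep i i1 + om2 * (@e1 R m) i 0) _ sH1) nonresonance1 (mul1r om).
    - rewrite [X in Rintegral _ _ X](_ : _ = fun t => -1 * (F3 1%N t i0 0 + H3 1%N t i1 0) - lam2 * (2 * Ep i0 i0)); last first.
        apply/funext => t; rewrite [X in X + _]mxE [X in _ + X]mxE [X in - X + _]mxE [X in _ - X]mxE.
        rewrite [X in - (_ + X) + _]mxE [X in _ - (_ + X)]mxE e200 e101 Ep11; ring.
      rewrite meanB//; last by move=> t; apply: (cvgM (ccst _ t)); apply: cvgD; [exact: cF|exact: cH].
      rewrite meanZ; last by move=> t; apply: cvgD; [exact: cF|exact: cH].
      by rewrite mean_cst; exact: alg1.
    - rewrite [X in Rintegral _ _ X](_ : _ = fun t => -1 * (F3 1%N t i1 0 - H3 1%N t i0 0) - (lam2 * (2 * Ep i1 i0) - 2 * om2)); last first.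
        apply/funext => t; rewrite [X in X - _]mxE [X in _ - X]mxE [X in - X - _]mxE [X in _ - (- X)]mxE.
        rewrite [X in - (_ + X) - _]mxE [X in _ - (- (_ + X))]mxE e100 e201 Ep01; ring.
      rewrite meanB//; last by move=> t; apply: (cvgM (ccst _ t)); apply: cvgB; [exact: cF|exact: cH].
      rewrite meanZ; last by move=> t; apply: cvgB; [exact: cF|exact: cH].
      by rewrite mean_cst; exact: alg2.
    by exists A, B, dA, dB; split=> // _.
  have [sF sH] := sFH3 3%N; have [|n1 n2] := @nonresonance 3%N; first by [].
  have [A [B [dA [dB [sAB dAB EA EB]]]]] := mode_solve_nonresonant Et_hyperbolic
     (hneg _ sF) (hneg _ sH) n2 n1.
  by exists A, B, dA, dB.
exists lam2, om2, A2, B2, A3, B3; split=> //.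
- move=> i th ph; rewrite op2 E2 -big_split big1_seq//= => k _.
  by rewrite !mxE; ring.
- move=> i th ph; rewrite op3 E3 sum_astar !big_cons !big_nil /fc /fs /= !mul1r.
  have -> : @dastar R m ph i 0 = - sin ph * (@e1 R m) i 0 + cos ph * (@e2 R m) i 0.
    by rewrite !mxE.
  by rewrite ![(- _ : vec) _ _]mxE ![(_ + _ : vec) _ _]mxE ![(\col_j _ : vec) _ _]mxE; ring.
- exact: Q3.
Qed.

End Data.
End TorusSolutions.

(** * Amplitude and phase conditions *)

Section Constraints.
Context {R : realType}.
Local Notation mean u := (\int[lebesgue_measure]_(t in `[0, 2 * pi]) u t : R).
Implicit Types (h g : R -> R -> R).

Definition dmean h : R := mean (fun ph => mean (h ^~ ph)).

Lemma smooth_torusD h g : smooth_torus h -> smooth_torus g ->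
  smooth_torus (fun th ph => h th ph + g th ph).
Proof.
move=> [sh h1 h2] [sg g1 g2]; split=> [k|ph th|th ph]; last by rewrite h2 g2.
  by apply: Ck_onD; [exact: openT|exact: sh|exact: sg].
by rewrite h1 g1.
Qed.

Lemma smooth_torusM h g : smooth_torus h -> smooth_torus g ->
  smooth_torus (fun th ph => h th ph * g th ph).
Proof.
move=> [sh h1 h2] [sg g1 g2]; split=> [k|ph th|th ph]; last by rewrite h2 g2.
  by apply: Ck_onM; [exact: openT|exact: sh|exact: sg].
by rewrite h1 g1.
Qed.

Lemma smooth_torus_cst (c : R) : smooth_torus (fun _ _ => c).
Proof. by split=> // k; exact: Ck_on_cst. Qed.

Lemma smooth_torus_sum (I : Type) (s : seq I) (h : I -> R -> R -> R) :
  (forall i, smooth_torus (h i)) -> smooth_torus (fun th ph => \sum_(i <- s) h i th ph).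
Proof.
move=> sh; elim: s => [|i s IH].
  rewrite (_ : (fun _ => _) = fun _ _ => 0); first exact: smooth_torus_cst.
  by apply/funext => th; apply/funext => ph; rewrite big_nil.
rewrite (_ : (fun _ => _) = fun th ph => h i th ph + \sum_(j <- s) h j th ph).
  exact: smooth_torusD.
by apply/funext => th; apply/funext => ph; rewrite big_cons.
Qed.

Lemma smooth_torus_slice h ph : smooth_torus h -> smooth_periodic (h ^~ ph).
Proof.
move=> [sh h1 _]; split=> [k|]; last exact: h1.
have [I [w [l wl]]] := framed_pair (@framed_real R) (@framed_real R).
apply: (Ck_on_comp (f := fun th : R => (th, ph)) (g := fun q => h q.1 q.2) wl openT openT) => //.
  apply: Ck_on_pair; [exact: openT| |exact: Ck_on_cst].
  exact: (@Ck_on_linT _ _ _ k setT (idfun : {linear R -> R}) (fun x => cvg_id)).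
Qed.

Lemma slice_continuous h ph : smooth_torus h -> continuous (h ^~ ph).
Proof. by move=> /(smooth_torus_slice ph)[/smooth_continuous]. Qed.

Lemma torus_bounded h : smooth_torus h -> exists M, forall th ph, `|h th ph| <= M.
Proof.
move=> [sh h1 h2].
have [||M HM] := @slab_bounded R 1 ltr01 (fun p => h p.2.1 p.2.2).
- by move=> e th ph _ /=; rewrite h1 h2.
- move=> p _; apply: (@continuous_comp _ _ _ snd (fun q : R * R => h q.1 q.2)).
    exact: cvg_snd.
  exact: (smooth_on_cont sh).
exists M => th ph; apply: (HM 0 (th, ph)).
by rewrite normr0 divr_gt0.
Qed.

(** Continuity under the integral sign, dominated by the constant that bounds [h] on the torus. It
    makes the inner mean integrable, hence the outer integral linear. *)
Lemma inner_mean_continuous h : smooth_torus h -> continuous (fun ph => mean (h ^~ ph)).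
Proof.
move=> sth ph; have [M HM] := torus_bounded sth.
have [sh h1 h2] := sth.
have key := @continuity_under_integral R _ _ (lebesgue_measure : {measure set (measurableTypeR R) -> \bar R})
  (fun ph th => h th ph) `[0, 2 * pi] (measurable_itv _) (ph - 1) (ph + 1) _ _ (fun=> M) _ _ ph.
apply: key.
- by move=> x _; apply: integrable_continuous; exact: slice_continuous.
- apply: aeW => th _ x _.
  have sl : continuous (fun x : R => h th x).
    move=> y; apply: (@continuous_comp _ _ _ (fun y : R => (th, y)) (fun q : R * R => h q.1 q.2)).
      by apply: differentiable_continuous; apply: differentiable_pair.
    exact: (smooth_on_cont sh).
  exact: sl.
- by apply: integrable_continuous; exact: cst_continuous.
- by move=> x _; apply: aeW => th _; exact: HM.
- by rewrite inE/= in_itv/= ltrBlDr !ltrDl ltr01.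
Qed.

Lemma dmeanD h g : smooth_torus h -> smooth_torus g ->
  dmean (fun th ph => h th ph + g th ph) = dmean h + dmean g.
Proof.
move=> sh sg; rewrite /dmean -meanD; [|exact: inner_mean_continuous..].
by apply: eq_Rintegral => ph _; rewrite meanD//; exact: slice_continuous.
Qed.

Lemma dmeanZ c h : smooth_torus h -> dmean (fun th ph => c * h th ph) = c * dmean h.
Proof.
move=> sh; rewrite /dmean -meanZ; last exact: inner_mean_continuous.
by apply: eq_Rintegral => ph _; rewrite meanZ//; exact: slice_continuous.
Qed.

Lemma dmean_prod (c u : R -> R) : continuous c -> continuous u ->
  dmean (fun th ph => c ph * u th) = mean c * mean u.
Proof.
move=> cc cu; rewrite mulrC -meanZ//.
by apply: eq_Rintegral => ph _; rewrite meanZ// mulrC.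
Qed.

Lemma mean_cos_sin (k : nat) : (0 < k)%N ->
  mean (fun t => cos (k%:R * t)) = 0 /\ mean (fun t => sin (k%:R * t)) = 0.
Proof.
move=> k0; have kn0 : k%:R != 0 :> R by rewrite pnatr_eq0 -lt0n.
have dc (t : R) : is_derive t 1 (fun x => cos (k%:R * x)) (k%:R * - sin (k%:R * t)).
  exact: is_derive_scale_arg.
have ds (t : R) : is_derive t 1 (fun x => sin (k%:R * x)) (k%:R * cos (k%:R * t)).
  exact: is_derive_scale_arg.
have cc := is_derive_continuous dc; have cs := is_derive_continuous ds.
have [c0 s0] := cos_sin_nat_periodic k (0 : R); rewrite add0r in c0 s0.
split.
  have d (t : R) : is_derive t 1 (fun x => k%:R^-1 * sin (k%:R * x)) (cos (k%:R * t)).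
    by apply: is_derive_eq (is_derive_scalef (k%:R^-1) (ds t)) _; rewrite mulKf.
  by rewrite (Rintegral_derive tpi_gt0 d cc) s0 subrr.
have d (t : R) : is_derive t 1 (fun x => - k%:R^-1 * cos (k%:R * x)) (sin (k%:R * t)).
  by apply: is_derive_eq (is_derive_scalef (- k%:R^-1) (dc t)) _; rewrite mulNr mulrN mulrN opprK mulKf.
by rewrite (Rintegral_derive tpi_gt0 d cs) c0 subrr.
Qed.

Lemma cos_sin_scale_continuous (k : nat) :
  continuous (fun t : R => cos (k%:R * t)) /\ continuous (fun t : R => sin (k%:R * t)).
Proof.
split; apply: (@is_derive_continuous R) => x; exact: is_derive_scale_arg.
Qed.

Lemma phi_smooth_torus (c u : R -> R) : smooth_periodic c -> smooth_periodic u ->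
  smooth_torus (fun th ph => c ph * u th).
Proof.
move=> [sc pc] [su pu]; split=> [k|ph th|th ph]; rewrite ?pu ?pc//.
have [I [w [l wl]]] := @framed_real R; have oT := @openT (R * R)%type.
apply: Ck_onM => //.
  by apply: (Ck_on_comp (f := snd) (g := c) wl oT (@openT R)) => //; exact: Ck_on_snd.
by apply: (Ck_on_comp (f := fst) (g := u) wl oT (@openT R)) => //; exact: Ck_on_fst.
Qed.

Lemma smooth_periodic_cos_sin (k : nat) :
  smooth_periodic (fun t : R => cos (k%:R * t)) /\ smooth_periodic (fun t : R => sin (k%:R * t)).
Proof.
have C n : Ck_on n setT (fun t : R => k%:R * t).
  apply: Ck_onM; [exact: openT|exact: Ck_on_cst|].
  exact: (@Ck_on_linT _ _ _ n setT (idfun : {linear R -> R}) (fun x => cvg_id)).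
split; split=> [n|t].
- by have [] := Ck_on_sin_cos openT (C n).
- by have [] := cos_sin_nat_periodic k t.
- by have [] := Ck_on_sin_cos openT (C n).
- by have [] := cos_sin_nat_periodic k t.
Qed.

Lemma modal_smooth_torus ks h : modal ks h -> smooth_torus h.
Proof.
move=> [a [b [ab hE]]].
rewrite (_ : h = fun th ph => \sum_(k <- ks) (cos (k%:R * ph) * a k th + sin (k%:R * ph) * b k th)).
  apply: smooth_torus_sum => k; have [sa sb] := ab k; have [sc ss] := smooth_periodic_cos_sin k.
  by apply: smooth_torusD; exact: phi_smooth_torus.
by apply/funext => th; apply/funext => ph; rewrite hE.
Qed.

(** All modes present are positive, and their sines and cosines have mean zero over a period. *)
Lemma dmean_modal ks h : 0%N \notin ks -> modal ks h -> dmean h = 0.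
Proof.
move=> k0 [a [b [ab hE]]].
have -> : h = fun th ph => \sum_(k <- ks) (cos (k%:R * ph) * a k th + sin (k%:R * ph) * b k th).
  by apply/funext => th; apply/funext => ph; rewrite hE.
elim: ks k0 {hE} => [|k ks IH].
  move=> _; rewrite (_ : (fun _ => _) = fun th ph => (fun=> 0) ph * (fun=> 0) th); last first.
    by apply/funext => th; apply/funext => ph; rewrite big_nil mulr0.
  by rewrite dmean_prod ?mean_cst ?mul0r//; exact: cst_continuous.
rewrite inE negb_or eq_sym -lt0n => /andP[k0 /IH {}IH].
have [sa sb] := ab k; have [sc ss] := smooth_periodic_cos_sin k.
have [cc cs] := cos_sin_scale_continuous k; have [mc ms] := mean_cos_sin k0.
rewrite (_ : (fun _ => _) = fun th ph => (cos (k%:R * ph) * a k th + sin (k%:R * ph) * b k th)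
  + \sum_(k <- ks) (cos (k%:R * ph) * a k th + sin (k%:R * ph) * b k th)); last first.
  by apply/funext => th; apply/funext => ph; rewrite big_cons.
rewrite dmeanD; last 2 first.
- by apply: smooth_torusD; exact: phi_smooth_torus.
- by apply: (@modal_smooth_torus ks); exists a, b.
rewrite IH addr0 dmeanD; [|exact: phi_smooth_torus..].
have ca : continuous (a k) by have [/smooth_continuous] := sa.
have cb : continuous (b k) by have [/smooth_continuous] := sb.
by rewrite !dmean_prod// mc ms !mul0r addr0.
Qed.

End Constraints.

Section Brackets.
Context {R : realType} {m : nat}.
Local Notation vec := 'cV[R]_(2 + m).
Local Notation mean u := (\int[lebesgue_measure]_(t in `[0, 2 * pi]) u t : R).
Let i0 : 'I_(2 + m) := lshift m 0.
Let i1 : 'I_(2 + m) := lshift m 1.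
Implicit Types z : R -> R -> vec.

(** [amp] and [phs] are the integrands of the brackets with [astar] and [dastar], in which only the
    first two entries of [z] survive. *)
Definition amp z th ph : R := cos ph * z th ph i0 0 + sin ph * z th ph i1 0.
Definition phs z th ph : R := - sin ph * z th ph i0 0 + cos ph * z th ph i1 0.

Lemma sum_dastar (X : 'I_(2 + m) -> R) ph :
  \sum_j (@dastar R m ph) j 0 * X j = - sin ph * X i0 + cos ph * X i1.
Proof.
have e1E j : (@e1 R m) j 0 = (j == i0)%:R by rewrite mxE eqxx andbT.
have e2E j : (@e2 R m) j 0 = (j == i1)%:R by rewrite mxE eqxx andbT.
have dE j : (@dastar R m ph) j 0 = - sin ph * (@e1 R m) j 0 + cos ph * (@e2 R m) j 0.
  by rewrite !mxE.
rewrite (bigD1 i0)//= (bigD1 i1)//= big1 ?addr0 => [|j /andP[j0 j1]].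
  rewrite !dE !e1E !e2E !eqxx; have -> : (i0 == i1) = false by [].
  have -> : (i1 == i0) = false by [].
  by rewrite !mulr1 !mulr0 addr0 add0r.
by rewrite dE e1E e2E (negbTE j0) (negbTE j1) !mulr0 addr0 mul0r.
Qed.

Lemma dbracketE z : dbracket z (fun _ => astar) = ((2 * pi) ^+ 2)^-1 * dmean (amp z) /\
  dbracket z (fun _ => dastar) = ((2 * pi) ^+ 2)^-1 * dmean (phs z).
Proof.
rewrite /dbracket /dmean; split; congr (_ * _); apply: eq_Rintegral => ph _;
  apply: eq_Rintegral => th _.
  by rewrite /dotv /amp -(sum_astar (fun j => z th ph j 0)); apply: eq_bigr => j _; rewrite mulrC.
by rewrite /dotv /phs -(sum_dastar (fun j => z th ph j 0)); apply: eq_bigr => j _; rewrite mulrC.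
Qed.

Lemma coord_bracketE (u : R -> vec) : bracket u (fun=> e1) = (2 * pi)^-1 * mean (fun t => u t i0 0) /\
  bracket u (fun=> e2) = (2 * pi)^-1 * mean (fun t => u t i1 0).
Proof.
have e1E j : (@e1 R m) j 0 = (j == i0)%:R by rewrite mxE eqxx andbT.
have e2E j : (@e2 R m) j 0 = (j == i1)%:R by rewrite mxE eqxx andbT.
rewrite /bracket; split; congr (_ * _); apply: eq_Rintegral => t _; rewrite /dotv.
  rewrite (bigD1 i0)//= e1E eqxx mulr1 big1 ?addr0// => j j0.
  by rewrite e1E (negbTE j0) mulr0.
rewrite (bigD1 i1)//= e2E eqxx mulr1 big1 ?addr0// => j j0.
by rewrite e2E (negbTE j0) mulr0.
Qed.

Lemma amp_phs_smooth z : smooth_torus z -> smooth_torus (amp z) /\ smooth_torus (phs z).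
Proof.
move=> sz; have s0 := smooth_torus_coord i0 0 sz; have s1 := smooth_torus_coord i1 0 sz.
have [sc ss] := @smooth_periodic_cos_sin R 1.
have c1 := smooth_periodic_cst (1 : R).
have sc' : smooth_torus (fun _ ph : R => cos ph).
  have := phi_smooth_torus sc c1; congr smooth_torus.
  by apply/funext => th; apply/funext => ph; rewrite mul1r mulr1.
have ss' : smooth_torus (fun _ ph : R => sin ph).
  have := phi_smooth_torus ss c1; congr smooth_torus.
  by apply/funext => th; apply/funext => ph; rewrite mul1r mulr1.
have sn : smooth_torus (fun _ ph : R => - sin ph).
  have := smooth_torusM (smooth_torus_cst (-1)) ss'; congr smooth_torus.
  by apply/funext => th; apply/funext => ph; rewrite mulN1r.
by split; apply: smooth_torusD; exact: smooth_torusM.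
Qed.

(** [astar] contributes cos^2 + sin^2 = 1 to the amplitude and nothing to the phase; after
    normalisation the term [(2 pi)^2] is what the right-hand side of the constraint cancels. *)
Lemma dmean_ansatz z2 z3 (e : R) : smooth_torus z2 -> smooth_torus z3 ->
  let z := fun th ph => z_ansatz z2 z3 th ph e in
  dmean (amp z) = (2 * pi) ^+ 2 + e * dmean (amp z2) + e ^+ 2 * dmean (amp z3) /\
  dmean (phs z) = e * dmean (phs z2) + e ^+ 2 * dmean (phs z3).
Proof.
move=> s2 s3 z; have [a2 p2] := amp_phs_smooth s2; have [a3 p3] := amp_phs_smooth s3.
have [as1 as2] : [/\ forall ph : R, (@astar R m ph) i0 0 = cos ph &
    forall ph : R, (@astar R m ph) i1 0 = sin ph].
  by split=> ph; rewrite !mxE /= ?mulr1 ?mulr0 ?addr0 ?add0r.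
have zc i th ph : z th ph i 0 = astar ph i 0 + e * z2 th ph i 0 + e ^+ 2 * z3 th ph i 0.
  have -> : z th ph = astar ph + e *: z2 th ph + e ^+ 2 *: z3 th ph by [].
  move: (astar ph) (z2 th ph) (z3 th ph) => u v w; by rewrite !mxE.
have sZ (c : R) (h : R -> R -> R) : smooth_torus h -> smooth_torus (fun th ph => c * h th ph).
  by move=> sh; apply: smooth_torusM => //; exact: smooth_torus_cst.
have s1 := smooth_torus_cst (1 : R); have s0 := smooth_torus_cst (0 : R).
have dcst (c : R) : dmean (fun _ _ => c) = c * (2 * pi) ^+ 2.
  rewrite /dmean expr2 mulrA -mean_cst; apply: eq_Rintegral => ph _.
  exact: mean_cst.
split.
  have -> : amp z = fun th ph => (1 + e * amp z2 th ph) + e ^+ 2 * amp z3 th ph.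
    apply/funext => th; apply/funext => ph; rewrite /amp !zc as1 as2.
    by rewrite -(cos2Dsin2 ph); ring.
  rewrite dmeanD; [|by apply: smooth_torusD => //; exact: sZ|exact: sZ].
  rewrite dmeanD//; last exact: sZ.
  by rewrite !dmeanZ// dcst mul1r.
have -> : phs z = fun th ph => e * phs z2 th ph + e ^+ 2 * phs z3 th ph.
  apply/funext => th; apply/funext => ph; rewrite /phs !zc as1 as2; ring.
by rewrite dmeanD ?dmeanZ//; exact: sZ.
Qed.

Lemma modes_vec_modal ks (A B : nat -> R -> vec) i : (forall k, rsmooth (A k) /\ rsmooth (B k)) ->
  modal ks (fun th ph => modes_vec ks A B th ph i 0).
Proof.
move=> sAB; exists (fun k t => A k t i 0), (fun k t => B k t i 0); split.
  by move=> k; have [sA sB] := sAB k; split; [exact: sA|exact: sB].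
by move=> th ph; rewrite modes_vecE.
Qed.

(** Tested against mode 1, the modes 0 and 2 yield modes 1 and 3 only, of mean zero: the constraints
    hold automatically at order eps. *)
Lemma dmean_modes02 (A B : nat -> R -> vec) : (forall k, rsmooth (A k) /\ rsmooth (B k)) ->
  let z := modes_vec [:: 0; 2]%N A B in dmean (amp z) = 0 /\ dmean (phs z) = 0.
Proof.
move=> sAB z.
have [c0 s0] := modal_cos_sin02 (modes_vec_modal [:: 0; 2]%N i0 sAB).
have [c1 s1] := modal_cos_sin02 (modes_vec_modal [:: 0; 2]%N i1 sAB).
split; apply: (@dmean_modal _ [:: 1; 3]%N) => //; first exact: modalD.
by apply: modal_eq (modalD (modalZ (-1) s0) c1) => th ph; rewrite /phs; ring.
Qed.

(* Mode 1 tested against mode 1 leaves half of the mean of a_1 . e_1 + b_1 . e_2;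
   all the other products are pure modes 2 and 4. *)
Lemma dmean_pair13 (a b a' b' : nat -> R -> R) :
  (forall k, smooth_periodic (a k) /\ smooth_periodic (b k)) ->
  (forall k, smooth_periodic (a' k) /\ smooth_periodic (b' k)) ->
  dmean (fun th ph =>
    cos ph * (\sum_(k <- [:: 1; 3]%N) (cos (k%:R * ph) * a k th + sin (k%:R * ph) * b k th))
    + sin ph * (\sum_(k <- [:: 1; 3]%N) (cos (k%:R * ph) * a' k th + sin (k%:R * ph) * b' k th)))
  = pi * mean (fun t => a 1%N t + b' 1%N t).
Proof.
move=> sab sab'.
have arg2 (ph : R) : ph + ph = 2%:R * ph by ring.
have arg4 (ph : R) : 3%:R * ph + ph = 4%:R * ph by ring.
have arg2' (ph : R) : 3%:R * ph - ph = 2%:R * ph by ring.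
have [sa1 sb1] := sab 1%N; have [sa3 sb3] := sab 3%N.
have [sa1' sb1'] := sab' 1%N; have [sa3' sb3'] := sab' 3%N.
pose u t := 2^-1 * (a 1%N t + b' 1%N t).
pose c2 t := 2^-1 * (a 1%N t - b' 1%N t + a 3%N t + b' 3%N t).
pose s2 t := 2^-1 * (b 1%N t + a' 1%N t + b 3%N t - a' 3%N t).
pose c4 t := 2^-1 * (a 3%N t - b' 3%N t).
pose s4 t := 2^-1 * (b 3%N t + a' 3%N t).
pose w th ph := \sum_(k <- [:: 2; 4]%N) (cos (k%:R * ph) * (if k == 2%N then c2 th else c4 th)
  + sin (k%:R * ph) * (if k == 2%N then s2 th else s4 th)).
have sN f : smooth_periodic f -> smooth_periodic (fun t => - f t).
  by move=> sf; apply: smooth_periodic_eq (smooth_periodicZ (-1) sf) => t; rewrite mulN1r.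
have sD := smooth_periodicD; have sZ := smooth_periodicZ.
have su : smooth_periodic u by apply: (sZ); exact: sD.
have sc2 : smooth_periodic c2.
  by apply: (sZ); apply: (sD) => //; apply: (sD) => //; apply: (sD) => //; exact: sN.
have ss2 : smooth_periodic s2.
  by apply: (sZ); apply: (sD) => //; [apply: (sD) => //; exact: sD|exact: sN].
have sc4 : smooth_periodic c4 by apply: (sZ); apply: (sD) => //; exact: sN.
have ss4 : smooth_periodic s4 by apply: (sZ); exact: sD.
have mw : modal [:: 2; 4]%N w.
  exists (fun k th => if k == 2%N then c2 th else c4 th), (fun k th => if k == 2%N then s2 th else s4 th).
  by split=> // k; case: (k == 2%N).
rewrite (_ : (fun _ => _) = fun th ph => (fun=> 1) ph * u th + w th ph); last first.
  apply/funext => th; apply/funext => ph; rewrite /w !big_cons !big_nil /= mul1r.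
  have [E1 E2 E3 E4] := cos_sin_cos_sin ph ph; rewrite arg2 subrr cos0 sin0 in E1 E2 E3 E4.
  have [E5 E6 E7 E8] := cos_sin_cos_sin ph (3%:R * ph); rewrite arg4 arg2' in E5 E6 E7 E8.
  rewrite !mul1r /u /c2 /s2 /c4 /s4.
  transitivity ((cos ph * cos ph) * a 1%N th + (cos ph * sin ph) * b 1%N th
    + (cos ph * cos (3%:R * ph)) * a 3%N th + (cos ph * sin (3%:R * ph)) * b 3%N th
    + (sin ph * cos ph) * a' 1%N th + (sin ph * sin ph) * b' 1%N th
    + (sin ph * cos (3%:R * ph)) * a' 3%N th + (sin ph * sin (3%:R * ph)) * b' 3%N th).
    by ring.
  rewrite E1 E2 E3 E4 E5 E6 E7 E8; ring.
rewrite dmeanD; last 2 first.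
- by apply: phi_smooth_torus => //; exact: smooth_periodic_cst.
- exact: modal_smooth_torus mw.
have cu : continuous u by have [/smooth_continuous] := su.
rewrite (dmean_modal _ mw)// addr0 dmean_prod//; last exact: cst_continuous.
have cab : continuous (fun t => a 1%N t + b' 1%N t).
  by have [/smooth_continuous] := smooth_periodicD sa1 sb1'.
by rewrite mean_cst mul1r /u meanZ//; field.
Qed.

Lemma dmean_modes13 (A B : nat -> R -> vec) : (forall k, rsmooth (A k) /\ rsmooth (B k)) ->
  let z := modes_vec [:: 1; 3]%N A B in
  dmean (amp z) = pi * mean (fun t => A 1%N t i0 0 + B 1%N t i1 0) /\
  dmean (phs z) = pi * mean (fun t => A 1%N t i1 0 - B 1%N t i0 0).
Proof.
move=> sAB z.
have sC i k : smooth_periodic (fun t => A k t i 0) /\ smooth_periodic (fun t => B k t i 0).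
  by have [sA sB] := sAB k; split; [exact: sA|exact: sB].
have sN i k : smooth_periodic (fun t => - A k t i 0) /\ smooth_periodic (fun t => - B k t i 0).
  have [sA sB] := sC i k; split.
    by apply: smooth_periodic_eq (smooth_periodicZ (-1) sA) => t; rewrite mulN1r.
  by apply: smooth_periodic_eq (smooth_periodicZ (-1) sB) => t; rewrite mulN1r.
split.
  rewrite -(dmean_pair13 (sC i0) (sC i1)); congr dmean.
  by apply/funext => th; apply/funext => ph; rewrite /amp !modes_vecE.
rewrite -(dmean_pair13 (sC i1) (sN i0)); congr dmean.
apply/funext => th; apply/funext => ph; rewrite /phs !modes_vecE !big_cons !big_nil; ring.
Qed.

End Brackets.

(** * Regularity of the Fourier coefficients *)

Section Recover.
Context {R : realType} {m : nat}.
Local Notation vec := 'cV[R]_(2 + m).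

(** The coefficients given by [only_phi_modes] carry no regularity. Sampling [z] at the phases 0,
    pi/2, pi/4 and 3 pi/4 gives an invertible linear system for the four of them, which exhibits
    them as combinations of smooth slices of [z]. *)
Lemma modes13_recover (z : R -> R -> vec) : smooth_torus z -> only_phi_modes [:: 1; 3]%N z ->
  exists A B : nat -> R -> vec, (forall k, rsmooth (A k) /\ rsmooth (B k)) /\
    z = modes_vec [:: 1; 3]%N A B.
Proof.
move=> sz [a [b zE]].
pose q : R := pi / 4; pose c : R := cos q.
have c0 : c != 0.
  have p0 := @pi_gt0 R.
  by rewrite gt_eqF// cos_gt0_pihalf//; apply/andP; split; rewrite /q; lra.
have sq : sin q = c.
  rewrite -cosBpihalf /c -[RHS]cosN; congr cos; rewrite /q.
  by move: (pi : R) => p; field.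
have q3 : 3%:R * q = q + pi / 2 by rewrite /q; move: (pi : R) => p; field.
have q9 : 3%:R * (3%:R * q) = q + pi *+ 2.
  by rewrite /q -mulr_natl; move: (pi : R) => p; field.
have h3 : 3%:R * (pi / 2) = pi / 2 + pi :> R by move: (pi : R) => p; field.
pose comb x y u v th : vec := x *: z th 0 + y *: z th (pi / 2) + u *: z th q + v *: z th (3%:R * q).
have scomb x y u v : rsmooth (comb x y u v).
  have sl ph i : smooth_periodic (fun th => z th ph i 0).
    exact: (smooth_torus_slice ph (smooth_torus_coord i 0 sz)).
  move=> i; apply: smooth_periodic_eq (smooth_periodicD (smooth_periodicD (smooth_periodicD
    (smooth_periodicZ x (sl 0 i)) (smooth_periodicZ y (sl (pi / 2) i)))
    (smooth_periodicZ u (sl q i))) (smooth_periodicZ v (sl (3%:R * q) i))) => t.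
  by rewrite !mxE.
(* The samples are [a1 + a3], [b1 - b3], [c (a1 + b1 - a3 + b3)] and [c (- a1 + b1 + a3 + b3)].
   Difference and sum of the last two are [2 c (a1 - a3)] and [2 c (b1 + b3)]; halving once more to
   separate modes 1 and 3 gives [d]. *)
pose d := (4 * c)^-1.
exists (fun k => if k == 1%N then comb 2^-1 0 d (- d) else comb 2^-1 0 (- d) d),
  (fun k => if k == 1%N then comb 0 2^-1 d d else comb 0 (- 2^-1) d d); split.
  by move=> k; split; case: (k == 1%N); exact: scomb.
apply/funext => th; apply/funext => ph; apply/colP => i.
have zi psi : z th psi i 0 = cos psi * a 1%N th i 0 + sin psi * b 1%N th i 0
    + (cos (3%:R * psi) * a 3%N th i 0 + sin (3%:R * psi) * b 3%N th i 0).
  rewrite zE !big_cons big_nil addr0 !mul1r.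
  move: (a 1%N th) (b 1%N th) (a 3%N th) (b 3%N th) => x y u v; by rewrite !mxE.
have combE x y u v : comb x y u v th i 0 = x * z th 0 i 0 + y * z th (pi / 2) i 0
    + u * z th q i 0 + v * z th (3%:R * q) i 0 by rewrite !mxE.
have z0 : z th 0 i 0 = a 1%N th i 0 + a 3%N th i 0.
  by rewrite zi mulr0 cos0 sin0; ring.
have zh : z th (pi / 2) i 0 = b 1%N th i 0 - b 3%N th i 0.
  by rewrite zi h3 cosDpi sinDpi cos_pihalf sin_pihalf; ring.
have zq : z th q i 0 = c * (a 1%N th i 0 + b 1%N th i 0 - a 3%N th i 0 + b 3%N th i 0).
  by rewrite zi q3 cosDpihalf sinDpihalf sq -/c; ring.
have zq3 : z th (3%:R * q) i 0 = c * (- a 1%N th i 0 + b 1%N th i 0 + a 3%N th i 0 + b 3%N th i 0).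
  by rewrite zi q9 cosD2pi sinD2pi q3 cosDpihalf sinDpihalf sq -/c; ring.
rewrite modes_vecE !big_cons big_nil addr0 /= !combE z0 zh zq zq3 zi !mul1r /d.
move: (cos ph) (sin ph) (cos (3%:R * ph)) (sin (3%:R * ph)) => C1 S1 C3 S3.
move: (a 1%N th i 0) (b 1%N th i 0) (a 3%N th i 0) (b 3%N th i 0) => x y u v.
by field.
Qed.

End Recover.

Section FinalPieces.
Context {R : realType} {m : nat}.
Local Notation vec := 'cV[R]_(2 + m).
Let i0 : 'I_(2 + m) := lshift m 0.
Let i1 : 'I_(2 + m) := lshift m 1.

Lemma astar_modes : (fun _ => @astar R m) = modes_vec [:: 1%N] (fun _ _ => e1) (fun _ _ => e2).
Proof.
apply/funext => th; apply/funext => ph.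
by rewrite /modes_vec big_seq1 mul1r.
Qed.

Lemma astar_derive i th ph :
  'D_(1, 0) (fun q : R * R => (@astar R m q.2) i 0) (th, ph) = 0 /\
  'D_(0, 1) (fun q : R * R => (@astar R m q.2) i 0) (th, ph) = (@dastar R m ph) i 0.
Proof.
have scst (w : vec) : rsmooth (fun=> w) by move=> j; exact: smooth_periodic_cst.
have dcst (w : vec) : rderive (fun=> w) (fun=> 0).
  move=> j t; rewrite [X in is_derive _ _ _ X](_ : _ = 0); last by rewrite mxE.
  exact: is_derive_cst.
have := @modes_vec_derive R m [:: 1%N] (fun _ _ => e1) (fun _ _ => e2) (fun _ _ => 0) (fun _ _ => 0)
  i th ph (fun k => conj (scst _) (scst _)) (fun k => conj (dcst _) (dcst _)).
rewrite -astar_modes => -[-> ->]; rewrite !big_seq1 !mul1r; split.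
  by rewrite mxE !mulr0 addr0.
have -> : (@dastar R m ph) i 0 = - sin ph * (@e1 R m) i 0 + cos ph * (@e2 R m) i 0.
  by rewrite !mxE.
by rewrite mulNr addrC.
Qed.

Lemma Emat_entries (al be : R) (Et : 'M[R]_m) :
  [/\ forall i, Emat al be Et i i0 = al * (@e1 R m) i 0 + be * (@e2 R m) i 0 &
      forall i, Emat al be Et i i1 = - be * (@e1 R m) i 0 + al * (@e2 R m) i 0].
Proof.
have e1E j : (@e1 R m) j 0 = (j == i0)%:R by rewrite mxE eqxx andbT.
have e2E j : (@e2 R m) j 0 = (j == i1)%:R by rewrite mxE eqxx andbT.
have [r00 r01 r10 r11] := rot_blockE al be.
have two (k : 'I_2) : k = 0 \/ k = 1.
  by case: k => [[|[|//]] kl]; [left|right]; apply: val_inj.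
split=> i; rewrite e1E e2E /i0 /i1; case: (split_ordP i) => k ->.
- rewrite block_mxEul; case: (two k) => ->; rewrite ?r00 ?r10 !eq_lshift /=;
    by rewrite ?mulr1 ?mulr0 ?addr0 ?add0r.
- by rewrite block_mxEdl mxE !eq_rlshift !mulr0 addr0.
- rewrite block_mxEul; case: (two k) => ->; rewrite ?r01 ?r11 !eq_lshift /=;
    by rewrite ?mulr1 ?mulr0 ?addr0 ?add0r.
- by rewrite block_mxEdl mxE !eq_rlshift !mulr0 addr0.
Qed.

(** [(1, i)] is a left eigenvector of the rotation block. Through it the bound on the imaginary
    parts of the Floquet exponents becomes [oms < 1/2]. *)
Lemma Emat_eigenvalue (om : R) (Et : 'M[R]_m) : ceigenvalue (Emat 0 om Et) (0 +i* om)%C.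
Proof.
pose w : 'rV[R[i]]_2 := \row_j (if j == 0 then 1 else cI).
apply/eigenvalueP; exists (row_mx w 0); last first.
  apply/eqP => /rowP/(_ (lshift m 0)); rewrite row_mxEl !mxE /= => /eqP.
  by rewrite oner_eq0.
rewrite /Emat map_block_mx !map_mx0 mul_row_block !mulmx0 !mul0mx !addr0 scale_row_mx scaler0.
congr row_mx; have [r00 r01 r10 r11] := rot_blockE 0 om.
move: (rot_block 0 om) r00 r01 r10 r11 => B r00 r01 r10 r11.
have l01 : lift ord0 ord0 = 1 :> 'I_2 by apply: val_inj.
have JJ := @cI_sqr R.
have omE : (0 +i* om)%C = om%:C%C * cI :> R[i].
  by apply/eqP; rewrite eq_complex /=; apply/andP; split; apply/eqP; ring.
apply/rowP => -[[|[|//]] lti].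
  have -> : Ordinal lti = 0 by apply: val_inj.
  rewrite !mxE big_ord_recl big_ord1 !mxE l01 r00 r10 /= omE.
  by rewrite rmorph0 mulr0 add0r mulr1 mulrC.
have -> : Ordinal lti = 1 by apply: val_inj.
rewrite !mxE big_ord_recl big_ord1 !mxE l01 r01 r11 /= omE.
by rewrite rmorph0 mulr0 addr0 mul1r rmorphN -mulrA JJ mulrN1.
Qed.

Lemma expands_quadratic (T : Type) (W : normedModType R) (c1 c2 : W) :
  expands_in_powers (fun (e : R) (_ : T) => e *: c1 + e ^+ 2 *: c2).
Proof.
pose c k := match k with 1%N => c1 | 2%N => c2 | _ => 0 end.
exists (fun k _ => c k) => -[|[|N]].
- exists (`|c1| + `|c2|), 1; split=> // e _ /andP[_ e1].
  rewrite big_ord1 scaler0 subr0 expr1 mulrDl.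
  apply: le_trans (ler_normD _ _) _; rewrite !normrZ; apply: lerD; first by rewrite mulrC.
  by rewrite mulrC ler_wpM2l// ler_piMl// ltW.
- exists `|c2|, 1; split=> // e _ _.
  rewrite big_ord_recl big_ord1 expr0 scaler0 add0r expr1 addrAC subrr add0r.
  by rewrite normrZ normrX mulrC.
- exists 0, 1; split=> // e _ _.
  rewrite !big_ord_recl /= scaler0 add0r expr1 big1 ?addr0 ?subrr ?normr0 ?mul0r// => k _.
  by rewrite scaler0.
Qed.

End FinalPieces.

(** * Construction of the asymptotic solution *)

Section TubeSlices.
Context {R : realType} {m : nat}.
Local Notation vec := 'cV[R]_(2 + m).
Variables (lams delta : R).
Hypothesis delta_gt0 : 0 < delta.
Local Notation tube := (@tube R m lams delta).
Implicit Type h : vec * R * R -> R.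

(** Phrased as invariance under a translation, so that it passes to derivatives by
    [derive_translate]. *)
Definition tube_periodic h := forall p, tube p -> h (p + (0, 2 * pi, 0)) = h p.

Lemma tube_periodic_dvar j h : tube_periodic h -> tube_periodic (dvar j h).
Proof. by move=> ph p; exact: (derive_translate (@open_tube R m lams delta) ph). Qed.

Lemma tube_slice_smooth h : smooth_on tube h -> tube_periodic h ->
  smooth_periodic (fun theta => h (0, theta, lams)).
Proof.
move=> sh ph; have Up theta : tube (0, theta, lams) by rewrite /tube/= subrr normr0.
split=> [k|t]; last first.
  rewrite -(ph (0, t, lams))//; congr h.
  by rewrite -[RHS]/(0 + 0, t + 2 * pi, lams + 0) !addr0.
have [I [w [l wl]]] : framed (vec * R * R)%type.
  by apply: framed_pair; [apply: framed_pair|]; [exact: framed_mx|exact: framed_real..].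
apply: (Ck_on_comp (f := fun theta : R => (0, theta, lams) : vec * R * R) wl (@openT R)
  (@open_tube R m lams delta)) => //.
apply: Ck_on_pair; [exact: openT| |exact: Ck_on_cst].
apply: Ck_on_pair; [exact: openT|exact: Ck_on_cst|].
exact: (@Ck_on_linT _ _ _ k setT (idfun : {linear R -> R}) (fun x => cvg_id)).
Qed.

(** For [h] a y-derivative of the field, [e] is an entry of [E]: the mixed derivative becomes an
    ordinary derivative of that entry, which is thereby shown to be derivable. *)
Lemma dlam_derive1 h (e : R -> R) theta : smooth_on tube h ->
  (forall lambda, `|lambda - lams| < delta -> h (0, theta, lambda) = e lambda) ->
  is_derive lams 1 e (dlam h (0, theta, lams)).
Proof.
move=> sh he.
have lineE (t : R) : t *: (0, 0, 1) + (0, theta, 0) = (0, theta, t) :> vec * R * R.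
  by congr (_, _, _); rewrite /= ?scaler0 ?add0r ?addr0// [_ *: _]mulr1.
apply: (@near_eq_is_derive _ _ _ (fun x : R => h (x *: (0, 0, 1) + (0, theta, 0)))).
  have /cvgrPdist_lt/(_ delta delta_gt0) : (x @[x --> lams] --> lams) by exact: cvg_id.
  by apply: filterS => x xd; rewrite lineE; apply: he; rewrite distrC.
rewrite /dlam -[(0, theta, lams)]lineE; apply: is_derive_line; rewrite lineE.
by apply: smooth_on_diff sh _; rewrite /tube/= subrr normr0.
Qed.

End TubeSlices.

Section Constraint.
Context {R : realType} {m : nat}.
Local Notation vec := 'cV[R]_(2 + m).

(** The constraints are affine in [z] and [astar] satisfies them exactly, so the residual is a
    polynomial in eps without constant term. *)
Lemma constraint_residual_ansatz (z2 z3 : R -> R -> vec) (e : R) :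
  smooth_torus z2 -> smooth_torus z3 ->
  let c := fun z : R -> R -> vec =>
    \col_(i < 2) dbracket z (fun _ ph => if i == 0 then astar ph else dastar ph) in
  constraint_residual (fun th ph => z_ansatz z2 z3 th ph e) = e *: c z2 + e ^+ 2 *: c z3.
Proof.
move=> s2 s3 c; have [A B] := dmean_ansatz e s2 s3.
have p0 : (2 * pi) ^+ 2 != 0 :> R by rewrite expf_neq0// gt_eqF// tpi_gt0.
have [dA dB] : (forall z : R -> R -> vec, dbracket z (fun _ ph => astar ph)
      = ((2 * pi) ^+ 2)^-1 * dmean (amp z)) /\ (forall z : R -> R -> vec,
    dbracket z (fun _ ph => dastar ph) = ((2 * pi) ^+ 2)^-1 * dmean (phs z)).
  by split=> z; [exact: (dbracketE z).1|exact: (dbracketE z).2].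
apply/colP => i.
pose h (z : R -> R -> vec) := dbracket z (fun _ ph => if i == 0 then astar ph else dastar ph).
have lE (z : R -> R -> vec) : constraint_residual z i 0 = h z - (i == 0)%:R.
  by rewrite !mxE eqxx andbT.
have cE z : c z i 0 = h z by rewrite mxE.
have rE (x y : R) (u w : 'cV[R]_2) : (x *: u + y *: w) i 0 = x * u i 0 + y * w i 0.
  by rewrite !mxE.
rewrite lE rE !cE /h; have [_|_] := eqVneq i 0; rewrite /= ?dA ?dB ?A ?B.
  move: (dmean _) (dmean _) ((2 * pi) ^+ 2) p0 => x y p p0; by field.
by rewrite subr0; move: (dmean _) (dmean _) => x y; ring.
Qed.

End Constraint.

Theorem theorem4p1 (R : realType) (m : nat)
  (F : 'cV[R]_(2 + m) -> R -> R -> 'cV[R]_(2 + m))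
  (F_smooth : smooth_on setT
     (fun p : 'cV[R]_(2 + m) * R * R => F p.1.1 p.1.2 p.2))
  (F_periodic : forall x lambda, periodic2pi (fun theta => F x theta lambda))
  (* periodic solution at lambda = lams *)
  (lams : R) (vs : R -> 'cV[R]_(2 + m))
  (vs_periodic : periodic2pi vs)
  (vs_sol : forall theta, derivable vs theta 1 /\
     F (vs theta) theta lams - derive1 vs theta = 0)
  (* Floquet theory at lambda = lams *)
  (oms : R) (Ets : 'M[R]_m) (Ps : R -> 'M[R]_(2 + m))
  (Ps_periodic : periodic2pi Ps)
  (Ps_unit : forall theta, Ps theta \in unitmx)
  (Ps_floquet : forall theta, derivable Ps theta 1 /\
     Jac F (vs theta) theta lams *m Ps theta - derive1 Ps theta
     = Ps theta *m Emat 0 oms Ets)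
  (oms_gt0 : 0 < oms)
  (Ets_hyperbolic : forall mu : R[i], ceigenvalue Ets mu -> complex.Re mu != 0)
  (Es_strip : forall mu : R[i], ceigenvalue (Emat 0 oms Ets) mu ->
     - 2^-1 < complex.Im mu < 2^-1)
  (* smooth continuations for |lambda - lams| < delta *)
  (delta : R) (delta_gt0 : 0 < delta)
  (v : R -> R -> 'cV[R]_(2 + m)) (P : R -> R -> 'M[R]_(2 + m))
  (alphaR alphaI : R -> R) (Et : R -> 'M[R]_m)
  (v_smooth : smooth_on [set p : R * R | `|p.2 - lams| < delta]
     (fun p => v p.1 p.2))
  (P_smooth : smooth_on [set p : R * R | `|p.2 - lams| < delta]
     (fun p => P p.1 p.2))
  (E_smooth : smooth_on [set lambda : R | `|lambda - lams| < delta]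
     (fun lambda => Emat (alphaR lambda) (alphaI lambda) (Et lambda)))
  (v_periodic : forall lambda, `|lambda - lams| < delta ->
     periodic2pi (v ^~ lambda))
  (P_periodic : forall lambda, `|lambda - lams| < delta ->
     periodic2pi (P ^~ lambda))
  (P_unit : forall theta lambda, `|lambda - lams| < delta ->
     P theta lambda \in unitmx)
  (v_sol : forall theta lambda, `|lambda - lams| < delta ->
     F (v theta lambda) theta lambda = derive1 (v ^~ lambda) theta)
  (P_floquet : forall theta lambda, `|lambda - lams| < delta ->
     Jac F (v theta lambda) theta lambda *m P theta lambda
       - derive1 (P ^~ lambda) theta
     = P theta lambda *m Emat (alphaR lambda) (alphaI lambda) (Et lambda))
  (v_at : forall theta, v theta lams = vs theta)
  (P_at : forall theta, P theta lams = Ps theta)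
  (E_at : Emat (alphaR lams) (alphaI lams) (Et lams) = Emat 0 oms Ets)
  (transversality : derive1 alphaR lams != 0)
  (* no strong resonance *)
  (no_13 : oms != 3^-1) (no_14 : oms != 4^-1) :
  (forall (lam2 om2 : R) (z2 z3 : R -> R -> 'cV[R]_(2 + m)),
     smooth_torus z2 -> smooth_torus z3 ->
     system_expands F v P (quadratic_in_eps lams lam2)
       (quadratic_in_eps oms om2) (z_ansatz z2 z3)) /\
  (exists (lam2 om2 : R) (z2 z3 : R -> R -> 'cV[R]_(2 + m)),
     [/\ smooth_torus z2, smooth_torus z3,
         only_phi_modes [:: 0; 2]%N z2, only_phi_modes [:: 1; 3]%N z3
       & asymptotic_solution F v P 2 (quadratic_in_eps lams lam2)
           (quadratic_in_eps oms om2) (z_ansatz z2 z3)]) /\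
  (forall (lam2 om2 : R) (z2 z3 : R -> R -> 'cV[R]_(2 + m)),
     smooth_torus z2 -> smooth_torus z3 ->
     only_phi_modes [:: 0; 2]%N z2 -> only_phi_modes [:: 1; 3]%N z3 ->
     asymptotic_solution F v P 2 (quadratic_in_eps lams lam2)
       (quadratic_in_eps oms om2) (z_ansatz z2 z3) ->
     [/\ dbracket z3 (fun _ phi => astar phi) = 0,
         dbracket z3 (fun _ phi => dastar phi) = 0
       & exists a b : nat -> R -> R -> 'cV[R]_(2 + m),
         [/\ fourier_form (z_ansatz z2 z3) a b,
             [/\ eps_term 1 (a 0%N), eps_term 1 (a 2%N) & eps_term 1 (b 2%N)],
             [/\ eps_term 2 (a 1%N), eps_term 2 (b 1%N),
                 eps_term 2 (a 3%N) & eps_term 2 (b 3%N)]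
           & forall eps : R,
               bracket (fun theta => a 1%N theta eps) (fun _ => e1)
                 + bracket (fun theta => b 1%N theta eps) (fun _ => e2) = 0 /\
               bracket (fun theta => a 1%N theta eps) (fun _ => e2)
                 - bracket (fun theta => b 1%N theta eps) (fun _ => e1) = 0]]).
Proof.
pose E lambda := Emat (alphaR lambda) (alphaI lambda) (Et lambda).
pose g := floquet_field F v P.
have g_smooth i : smooth_on (tube lams delta) (fun p => g p.1.1 p.1.2 p.2 i 0).
  exact: floquet_field_smooth.
have g0 theta lambda : g 0 theta lambda = 0 by exact: floquet_field0.
have g_per y lambda : `|lambda - lams| < delta -> periodic2pi (g y ^~ lambda).
  by move=> ld; apply: (floquet_field_periodic F_periodic v_periodic P_periodic).
have gE theta lambda i j : `|lambda - lams| < delta ->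
    dvar j (fun p => g p.1.1 p.1.2 p.2 i 0) (0, theta, lambda) = E lambda i j.
  exact: (derive_floquet_field F_smooth v_smooth P_smooth P_unit P_floquet).
have resE lam2 om2 z2 z3 : (fun eps (p : R * R) =>
    pde_residual F v P (fun theta phi => z_ansatz z2 z3 theta phi eps)
      (quadratic_in_eps lams lam2 eps) (quadratic_in_eps oms om2 eps) eps p)
    = field_residual g lams oms lam2 om2 z2 z3.
  apply/funext => eps; apply/funext => p.
  by rewrite /pde_residual Gfun_floquet_field.
have res_exp lam2 om2 z2 z3 : smooth_torus z2 -> smooth_torus z3 ->
    expands_in_powers (field_residual g lams oms lam2 om2 z2 z3).
  by move=> s2 s3; apply: (field_residual_expands oms delta_gt0).
pose cv (z : R -> R -> 'cV[R]_(2 + m)) : 'cV[R]_2 :=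
  \col_(i < 2) dbracket z (fun _ ph => if i == 0 then astar ph else dastar ph).
have conE z2 z3 : smooth_torus z2 -> smooth_torus z3 ->
    (fun eps (_ : unit) => constraint_residual (fun theta phi => z_ansatz z2 z3 theta phi eps))
    = (fun eps _ => eps *: cv z2 + eps ^+ 2 *: cv z3).
  move=> s2 s3; apply/funext => eps; apply/funext => _.
  exact: constraint_residual_ansatz.
split; [|split].
- move=> lam2 om2 z2 z3 s2 s3; split; first by rewrite resE; exact: res_exp.
  by rewrite conE//; exact: expands_quadratic.
- have lams_in : `|lams - lams| < delta by rewrite subrr normr0.
  pose gi i := fun p : 'cV[R]_(2 + m) * R * R => g p.1.1 p.1.2 p.2 i 0.
  have gi_per i : tube_periodic lams delta (gi i).
    move=> [[y theta] lambda] Up.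
    have -> : (y, theta, lambda) + (0, 2 * pi, 0) = (y + 0, theta + 2 * pi, lambda + 0)
      :> 'cV[R]_(2 + m) * R * R by [].
    by rewrite !addr0 /gi /= g_per.
  pose G2 i j k theta := dvar k (dvar j (gi i)) (0, theta, lams).
  pose G3 i j k l theta := dvar l (dvar k (dvar j (gi i))) (0, theta, lams).
  have G2s i j k : smooth_periodic (G2 i j k).
    apply: (tube_slice_smooth delta_gt0); first by apply: smooth_dvar; apply: smooth_dvar; exact: g_smooth.
    by do 2!apply: tube_periodic_dvar.
  have G3s i j k l : smooth_periodic (G3 i j k l).
    apply: (tube_slice_smooth delta_gt0); first by apply: smooth_dvar; apply: smooth_dvar; apply: smooth_dvar; exact: g_smooth.
    by do 3!apply: tube_periodic_dvar.
  pose Ep : 'M[R]_(2 + m) := \matrix_(i, j) derive1 (fun lambda => E lambda i j) lams.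
  have EpE i j theta : dlam (dvar j (gi i)) (0, theta, lams) = Ep i j.
    have [_ <-] := dlam_derive1 delta_gt0 (smooth_dvar j (g_smooth i)) (fun lambda ld => gE theta lambda i j ld).
    by rewrite mxE derive1E.
  pose i0 : 'I_(2 + m) := lshift m 0; pose i1 : 'I_(2 + m) := lshift m 1.
  have [e100 e101 e200 e201] : [/\ (@e1 R m) i0 0 = 1, (@e1 R m) i1 0 = 0,
     (@e2 R m) i0 0 = 0 & (@e2 R m) i1 0 = 1] by split; rewrite mxE.
  have Ep00 : Ep i0 i0 = derive1 alphaR lams.
    rewrite mxE; congr (derive1 _ lams); apply/funext => lambda.
    by rewrite /E (Emat_entries _ _ _).1 e100 e200 mulr1 mulr0 addr0.
  have Ep11 : Ep i1 i1 = Ep i0 i0.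
    rewrite Ep00 mxE; congr (derive1 _ lams); apply/funext => lambda.
    by rewrite /E (Emat_entries _ _ _).2 e101 e201 mulr1 mulr0 add0r.
  have Ep01 : Ep i0 i1 = - Ep i1 i0.
    (* Moving the sign out of the derivative requires the entry to be derivable, which follows from
       the smoothness of the field. *)
    have [dE _] := dlam_derive1 delta_gt0 (smooth_dvar i0 (g_smooth i1)) (fun lambda ld => gE 0 lambda i1 i0 ld).
    rewrite !mxE !derive1E -deriveN//; congr (derive _ lams 1); apply/funext => lambda.
    rewrite -[RHS]/(- E lambda i1 i0) /E (Emat_entries _ _ _).1 (Emat_entries _ _ _).2.
    by rewrite e100 e200 e101 e201 mulr1 !mulr0 !addr0 add0r mulr1.
  have om_range : 0 < oms < 2^-1.
    by have /andP[_ H] := Es_strip _ (Emat_eigenvalue oms Ets); rewrite oms_gt0.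
  have Ep00n : Ep i0 i0 != 0 by rewrite Ep00.
  have [lam2 [om2 [A2 [B2 [A3 [B3]]]]]] := torus_solutions Ets_hyperbolic om_range no_13 no_14
     G2s G3s Ep00n Ep11 Ep01.
  set z2 := modes_vec _ A2 B2; set z3 := modes_vec _ A3 B3 => -[[sAB2 sAB3] eq2 eq3 [m1 m2]].
  have s2 : smooth_torus z2 by exact: modes_vec_smooth.
  have s3 : smooth_torus z3 by exact: modes_vec_smooth.
  exists lam2, om2, z2, z3; split=> //; [by exists A2, B2|by exists A3, B3|].
  split; last first.
    rewrite conE//; have [a2 p2] := dmean_modes02 sAB2; have [a3 p3] := dmean_modes13 sAB3.
    have cv0 z : dmean (amp z) = 0 -> dmean (phs z) = 0 -> cv z = 0.
      move=> az pz; apply/colP => i; rewrite !mxE; have [_|_] := eqVneq i 0.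
        by rewrite (dbracketE z).1 az mulr0.
      by rewrite (dbracketE z).2 pz mulr0.
    rewrite (cv0 z2)// (cv0 z3) ?a3 ?p3 ?m1 ?m2 ?mulr0//.
    by exists 0, 1; split=> // e _ _; rewrite !scaler0 addr0 normr0 mul0r.
  (* A uniform expansion exists, so it remains to see, at a fixed point of the torus and for a fixed
     entry, that the coefficients of orders 0, 1 and 2 vanish. *)
  rewrite resE; apply: bigO_eps_uniform; first exact: res_exp.
  move=> [th ph]; apply: bigO_eps_cV => i; apply: exp2_bigO.
  have ez j : exp2 (fun e => z_ansatz z2 z3 th ph e j 0) (astar ph j 0) (z2 th ph j 0) (z3 th ph j 0).
    apply: exp2_eq (exp2_poly _ _ _) _ _ _ _ => // e _; rewrite /z_ansatz.
    by move: (astar ph) (z2 th ph) (z3 th ph) => x y z; rewrite !mxE.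
  have gi0 lambda : `|lambda - lams| < delta -> gi i (0, th, lambda) = 0.
    by move=> _; rewrite /gi /= g0 mxE.
  have X1 := exp2_field lam2 delta_gt0 (g_smooth i) gi0 ez.
  have f1E j : dvar j (gi i) (0, th, lams) = Emat 0 oms Ets i j by rewrite gE// /E E_at.
  have [da0 da1] := @astar_derive R m i th ph.
  have X2 := exp2_add (exp2_add X1 (exp2_scale (-1) (exp2_poly
      ('D_(1, 0) (fun q : R * R => (@astar R m q.2) i 0) (th, ph))
      ('D_(1, 0) (fun q => z2 q.1 q.2 i 0) (th, ph))
      ('D_(1, 0) (fun q => z3 q.1 q.2 i 0) (th, ph)))))
    (exp2_scale (-1) (exp2_mul (exp2_poly oms 0 om2) (exp2_poly
      ('D_(0, 1) (fun q : R * R => (@astar R m q.2) i 0) (th, ph))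
      ('D_(0, 1) (fun q => z2 q.1 q.2 i 0) (th, ph))
      ('D_(0, 1) (fun q => z3 q.1 q.2 i 0) (th, ph))))).
  have f1S (x : 'I_(2 + m) -> R) :
      \sum_j x j * dvar j (gi i) (0, th, lams) = \sum_j x j * Emat 0 oms Ets i j.
    by apply: eq_bigr => j _; rewrite f1E.
  have f1S' : lam2 * \sum_j astar ph j 0 * dlam (dvar j (gi i)) (0, th, lams)
      = lam2 * \sum_j astar ph j 0 * Ep i j.
    by congr (_ * _); apply: eq_bigr => j _; rewrite EpE.
  (* The rotation block turns [astar] into [oms] times its phi-derivative, which settles order 0. *)
  have aE : \sum_j astar ph j 0 * Emat 0 oms Ets i j = oms * dastar ph i 0.
    have [Ei0 Ei1] := Emat_entries 0 oms Ets; rewrite sum_astar Ei0 Ei1.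
    by rewrite /dastar; move: (@e1 R m) (@e2 R m) => x y; rewrite !mxE; ring.
  apply: (exp2_eq X2).
  - by move=> e _; rewrite field_residual_coord// /quadratic_in_eps mulr0 addr0 !mulN1r.
  - rewrite f1S aE da0 da1; ring.
  - have alg (x y D d : R) : x + y + -1 * D + -1 * (oms * d + 0) = x - D - oms * d + y by ring.
    by rewrite (f1S (fun j => z2 th ph j 0)) mul0r alg; symmetry; exact: eq2.
  - have alg (x u w D d d0 l : R) : x + l + u + w + -1 * D + -1 * (oms * d + 0 + om2 * d0)
        = x - D - oms * d + (u + w) + l - om2 * d0 by ring.
    rewrite (f1S (fun j => z3 th ph j 0)) f1S' da1 mul0r alg.
    by symmetry; exact: eq3.
- move=> lam2 om2 z2 z3 s2 s3 [a2 [b2 z2E]] m3 [_]; rewrite conE// => O3.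
  (* The constraint residual equals [eps cv z2 + eps^2 cv z3] exactly; being of order 3, it has zero
     coefficients, and [cv z3] consists of the two brackets sought. *)
  pose c k := match k with 1%N => cv z2 | 2%N => cv z3 | _ => 0 end.
  have c2 : c 2%N = 0.
    apply: (@bigO_eps_coef0 _ _ 3) => //; move: O3; congr bigO_eps.
    apply/funext => e; apply/funext => _.
    by rewrite !big_ord_recl big_ord0 /= scaler0 add0r addr0 expr1.
  have [d1 d2] : dbracket z3 (fun _ phi => astar phi) = 0 /\ dbracket z3 (fun _ phi => dastar phi) = 0.
    have /colP H := c2; have := H 0; have := H 1; rewrite !mxE /=.
    by move=> -> ->.
  (* The coefficients supplied by [m3] may be irregular, and the integrals below are split only for
     continuous ones. *)
  have [A [B [sAB z3E]]] := modes13_recover s3 m3.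
  have p0 : ((2 * pi) ^+ 2)^-1 != 0 :> R by rewrite invr_neq0// expf_neq0// gt_eqF// tpi_gt0.
  have pi0 : pi != 0 :> R by rewrite gt_eqF// pi_gt0.
  have [A1 A2] : \int[lebesgue_measure]_(t in `[0, 2 * pi]) (A 1%N t (lshift m 0) 0 + B 1%N t (lshift m 1) 0) = 0
     /\ \int[lebesgue_measure]_(t in `[0, 2 * pi]) (A 1%N t (lshift m 1) 0 - B 1%N t (lshift m 0) 0) = 0.
    have [D1 D2] := dmean_modes13 sAB; rewrite -z3E in D1 D2.
    split; apply/eqP.
      by have /eqP := d1; rewrite (dbracketE z3).1 D1 mulf_eq0 (negbTE p0) /= mulf_eq0 (negbTE pi0).
    by have /eqP := d2; rewrite (dbracketE z3).2 D2 mulf_eq0 (negbTE p0) /= mulf_eq0 (negbTE pi0).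
  split=> //.
  (* Modes 0 and 2 come from [z2], modes 1 and 3 from [z3]; the sine coefficient of mode 0
     disappears because [sin 0 = 0]. *)
  exists (fun k theta eps => if k == 0%N then eps *: a2 0%N theta else
     if k == 2%N then eps *: a2 2%N theta else eps ^+ 2 *: A k theta),
    (fun k theta eps => if k == 2%N then eps *: b2 2%N theta else eps ^+ 2 *: B k theta).
  split.
  + move=> theta phi eps; rewrite /z_ansatz z2E z3E /modes_vec !big_cons !big_nil.
    rewrite !mul0r cos0 sin0 scale1r scale0r !addr0.
    apply/colP => i; move: (astar phi) => s.
    move: (a2 0%N theta) (a2 2%N theta) (b2 2%N theta) (A 1%N theta) (A 3%N theta) (B 1%N theta) (B 3%N theta) => u1 u2 u3 u4 u5 u6 u7.
    by rewrite !mxE; ring.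
  + by split; [exists (a2 0%N)|exists (a2 2%N)|exists (b2 2%N)].
  + by split; [exists (A 1%N)|exists (B 1%N)|exists (A 3%N)|exists (B 3%N)].
  move=> eps.
  have cont k (X : nat -> R -> 'cV[R]_(2 + m)) i : rsmooth (X k) -> continuous (fun t => X k t i 0).
    by move=> sX; have [/smooth_continuous] := sX i.
  have [sA sB] := sAB 1%N.
  have br (X : R -> 'cV[R]_(2 + m)) i : continuous (fun t => X t i 0) ->
      \int[lebesgue_measure]_(t in `[0, 2 * pi]) ((eps ^+ 2 *: X t) i 0) =
      eps ^+ 2 * \int[lebesgue_measure]_(t in `[0, 2 * pi]) (X t i 0).
    by move=> cX; rewrite -meanZ//; apply: eq_Rintegral => t _; rewrite mxE.
  rewrite /= !(coord_bracketE _).1 !(coord_bracketE _).2 !br; try exact: cont.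
  rewrite meanD in A1; try exact: cont.
  rewrite meanB in A2; try exact: cont.
  by rewrite -!mulrDr -!mulrBr A1 A2 !mulr0.
Qed.
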